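(* Let $n\ge2$ and let $M$ be a finite dimensional simple $MU(n)$-module of type $\mathbf 1$ and of depth $r$, for some $0\le r\le n$. Then $M\simeq L_{\lambda,r}$ for some dominant integral weight $\lambda$.
   Context: Let $K=\mathbb{C}(v)$ with $v$ an indeterminate, $n\ge2$, and for $1\le i,j\le n-1$ let $a_{ij}=2$ if $i=j$, $a_{ij}=-1$ if $|i-j|=1$, $a_{ij}=0$ if $|i-j|>1$. $U_v(\mathfrak{sl}_n)$ is the unital associative $K$-algebra with generators $e_i,f_i,k_i^{\pm1}$ ($1\le i\le n-1$) and relations: $k_ik_i^{-1}=k_i^{-1}k_i=1$, $k_ik_j=k_jk_i$; $k_ie_jk_i^{-1}=v^{a_{ij}}e_j$, $k_if_jk_i^{-1}=v^{-a_{ij}}f_j$; $e_if_j-f_je_i=\delta_{ij}\frac{k_i-k_i^{-1}}{v-v^{-1}}$; $e_ie_j=e_je_i$, $f_if_j=f_jf_i$ if $|i-j|\ne1$; $(v+v^{-1})e_ie_je_i=e_i^2e_j+e_je_i^2$ and $(v+v^{-1})f_if_jf_i=f_i^2f_j+f_jf_i^2$ if $|i-j|=1$. The mirabolic quantum group $MU(n)$ is the unital associative $K$-algebra with generators $\ell$ and $e_i,f_i,k_i^{\pm1}$ ($1\le i\le n-1$), subject to all the relations above together with: $\ell^2=\ell$, $k_i\ell=\ell k_i$; $\ell e_i=e_i\ell$, $\ell f_i=f_i\ell$ for $i\ge2$; $\ell e_1\ell=\ell e_1$, $\ell f_1\ell=f_1\ell$; $(v+v^{-1})e_1\ell e_1=v^{-1}e_1^2\ell+v\ell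 e_1^2$; $(v+v^{-1})f_1\ell f_1=v^{-1}\ell f_1^2+vf_1^2\ell$. There is an algebra map $\rho:MU(n)\to U_v(\mathfrak{sl}_n)\otimes MU(n)$ with $\rho(e_i)=1\otimes e_i+e_i\otimes k_i$, $\rho(f_i)=k_i^{-1}\otimes f_i+f_i\otimes1$, $\rho(k_i^{\pm1})=k_i^{\pm1}\otimes k_i^{\pm1}$, $\rho(\ell)=1\otimes\ell$. If $X$ is a $U_v(\mathfrak{sl}_n)$-module and $W$ an $MU(n)$-module, then $X\otimes W$ is an $MU(n)$-module via $\rho$. An (integral) weight is a class $\lambda\in\mathbb{Z}^n/\mathbb{Z}(1,\dots,1)$, written $\lambda=(\lambda_1,\dots,\lambda_n)$; it is dominant if $\lambda_1\ge\cdots\ge\lambda_n$. $L_\lambda$ is the simple finite dimensional $U_v(\mathfrak{sl}_n)$-module of highest weight $\lambda$ (of type $\mathbf 1$), generated by a vector $x_\lambda\neq 0$ with $e_ix_\lambda=0$, $k_ix_\lambda=v^{\lambda_i-\lambda_{i+1}}x_\lambda$. For $0\le r\le n$, $W_r=\wedge_v^r(K^n)$ is the $MU(n)$-module with basis $u_I$, $I\subset\{1,\dots,n\}$, $\#I=r$, and action: $k_iu_I=v\,u_I$ if $i\in I,i+1\notin I$; $k_iu_I=v^{-1}u_I$ if $i\notin I,i+1\in I$; $k_iu_I=u_I$ otherwise; $e_iu_I=u_{(I\setminus\{i+1\})\cup\{i\}}$ if $i+1\in I,i\notin I$, and $0$ otherwise; $f_iu_I=u_{(I\setminus\{i\})\cup\{i+1\}}$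 if $i\in I,i+1\notin I$, and $0$ otherwise; $\ell u_I=u_I$ if $1\notin I$ and $\ell u_I=0$ if $1\in I$. $L_{\lambda,r}:=L_\lambda\otimes W_r$, an $MU(n)$-module via $\rho$. For an $MU(n)$-module $M$ and weight $\mu$, the weight space is $M_\mu=\{x\in M: k_ix=v^{\mu_i-\mu_{i+1}}x\ \forall i\}$; elements of weight spaces are weight vectors. A finite dimensional $M$ is of type $\mathbf 1$ if $M=\bigoplus_\mu M_\mu$. A weight vector $x$ has depth $r$ ($0\le r\le n$) if $\ell f_1\cdots f_j\cdot x=0$ for all $0\le j<r$ (for $j=0$: $\ell x=0$) and, when $r<n$, $\ell f_1\cdots f_r\cdot x\ne0$. The depth of $M\neq0$ is the maximum of the depths of its nonzero weight vectors. *)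

(* Defs.v *)
From HB Require Import structures.
From mathcomp Require Import all_boot all_order all_algebra.
From mathcomp Require Import generic_quotient.
From mathcomp Require Import reals.
From mathcomp Require Import complex.
From mathcomp Require Import zify ring.

Set Implicit Arguments.
Unset Strict Implicit.
Unset Printing Implicit Defensive.

Import GRing.Theory VectorInternalTheory.
Local Open Scope ring_scope.

(* The type 'I_n.-1 indexes the generators: [i : 'I_n.-1] stands for the index
   i + 1 of the usual 1-based numbering.  Its two vertices in 'I_n, i.e. the
   1-based i + 1 and i + 2, are [lo i] and [hi i].  The relations on e_1, f_1
   are those with [i = 0], and those for i >= 2 have [0 < i]. *)
Section Indices.
Variable n : nat.

Definition lo (i : 'I_n.-1) : 'I_n := widen_ord (leq_pred n) i.

Fact hi_subproof (i : 'I_n.-1) : (i.+1 < n)%N.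
Proof. by have := ltn_ord i; lia. Qed.

Definition hi (i : 'I_n.-1) : 'I_n := Ordinal (hi_subproof i).

Definition adj (i j : 'I_n.-1) : bool := (i.+1 == j :> nat) || (j.+1 == i :> nat).

Definition cartan (i j : 'I_n.-1) : int :=
  if i == j then 2 else if adj i j then -1 else 0.

End Indices.

(* An alias of 'End(V) whose product is composition ([f * g] is "g, then f"). *)
Definition endo (F : fieldType) (V : vectType F) := 'End(V).
HB.instance Definition _ (F : fieldType) (V : vectType F) :=
  Vector.on (endo V).

Section EndoAlgebra.
Variables (F : fieldType) (V : vectType F).
Implicit Types f g h : endo V.

HB.instance Definition _ := GRing.Zmodule_isPzRing.Build (endo V)
  (@comp_lfunA F V V V V) (@comp_lfun1l F V V) (@comp_lfun1r F V V)
  (@comp_lfunDl F V V V) (@comp_lfunDr F V V V).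

Lemma endo_scaleAl (a : F) f g : a *: (f * g) = a *: f * g.
Proof. exact: comp_lfunZl. Qed.
Lemma endo_scaleAr (a : F) f g : a *: (f * g) = f * (a *: g).
Proof. exact: comp_lfunZr. Qed.
Lemma endoM f g x : (f * g) x = f (g x). Proof. exact: comp_lfunE. Qed.
Lemma endo1 x : (1 : endo V) x = x. Proof. exact: id_lfunE. Qed.

End EndoAlgebra.

Section Relations.
Variables (F : fieldType) (v : F) (n : nat) (V : vectType F).

(* The argument [ki] is the family of the generators k_i^{-1}. *)
Record U_relations (e f k ki : 'I_n.-1 -> endo V) : Prop := {
  rel_kki : forall i, k i * ki i = 1;
  rel_kik : forall i, ki i * k i = 1;
  rel_kk : forall i j, k i * k j = k j * k i;
  rel_ke : forall i j, k i * e j * ki i = v ^ cartan i j *: e j;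
  rel_kf : forall i j, k i * f j * ki i = v ^ (- cartan i j) *: f j;
  rel_ef : forall i j, e i * f j - f j * e i =
             (i == j)%:R *: ((v - v^-1)^-1 *: (k i - ki i));
  rel_ee : forall i j, ~~ adj i j -> e i * e j = e j * e i;
  rel_ff : forall i j, ~~ adj i j -> f i * f j = f j * f i;
  rel_eee : forall i j, adj i j ->
    (v + v^-1) *: (e i * e j * e i) = e i ^+ 2 * e j + e j * e i ^+ 2;
  rel_fff : forall i j, adj i j ->
    (v + v^-1) *: (f i * f j * f i) = f i ^+ 2 * f j + f j * f i ^+ 2 }.

Record MU_relations (e f k ki : 'I_n.-1 -> endo V) (l : endo V) : Prop := {
  rel_U :> U_relations e f k ki;
  rel_ll : l ^+ 2 = l;
  rel_kl : forall i, k i * l = l * k i;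
  rel_le : forall i : 'I_n.-1, (0 < i)%N -> l * e i = e i * l;
  rel_lf : forall i : 'I_n.-1, (0 < i)%N -> l * f i = f i * l;
  rel_lel : forall i : 'I_n.-1, i = 0%N :> nat -> l * e i * l = l * e i;
  rel_lfl : forall i : 'I_n.-1, i = 0%N :> nat -> l * f i * l = f i * l;
  rel_ele : forall i : 'I_n.-1, i = 0%N :> nat ->
    (v + v^-1) *: (e i * l * e i) =
    v^-1 *: (e i ^+ 2 * l) + v *: (l * e i ^+ 2);
  rel_flf : forall i : 'I_n.-1, i = 0%N :> nat ->
    (v + v^-1) *: (f i * l * f i) =
    v^-1 *: (l * f i ^+ 2) + v *: (f i ^+ 2 * l) }.

End Relations.


Section Tensor.
Variables (F : fieldType) (V W : vectType F).

(* A concrete model of the tensor product: matrices, with [pure x y] the outer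
   product of the coordinates of [x] and [y]; see [tens_universal]. *)
Definition tens : vectType F := 'M[F]_(dim V, dim W).
Definition pure (x : V) (y : W) : tens := (v2r x)^T *m v2r y.

(* f \otimes g; see [tensmap_pure]. *)
Definition tensmap (f : endo V) (g : endo W) : endo tens :=
  linfun (mulmxr (f2mx g) \o mulmx (f2mx f)^T).

Lemma v2r_lfun (U : vectType F) (f : endo U) x : v2r (f x) = v2r x *m f2mx f.
Proof. by rewrite unlock /= r2vK. Qed.

Lemma tensmapE f g (A : tens) :
  tensmap f g A = (f2mx f)^T *m (A : 'M_(_, _)) *m f2mx g.
Proof. by rewrite lfunE. Qed.

Lemma tensmap_pure f g x y : tensmap f g (pure x y) = pure (f x) (g y).
Proof. by rewrite tensmapE /pure !v2r_lfun trmx_mul !mulmxA. Qed.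

Lemma pureDl x x' y : pure (x + x') y = pure x y + pure x' y.
Proof. by rewrite /pure !linearD /= mulmxDl. Qed.
Lemma pureDr x y y' : pure x (y + y') = pure x y + pure x y'.
Proof. by rewrite /pure !linearD. Qed.
Lemma pureZl a x y : pure (a *: x) y = a *: pure x y.
Proof. by rewrite /pure !linearZ /= scalemxAl. Qed.
Lemma pureZr a x y : pure x (a *: y) = a *: pure x y.
Proof. by rewrite /pure !linearZ. Qed.

Lemma pure_delta i j :
  pure (r2v (delta_mx 0 i)) (r2v (delta_mx 0 j)) = delta_mx i j.
Proof. by rewrite /pure !r2vK trmx_delta mul_delta_mx. Qed.

Lemma tens_ext (Z : vectType F) (h h' : 'Hom(tens, Z)) :
  (forall x y, h (pure x y) = h' (pure x y)) -> h = h'.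
Proof.
move=> hh'; apply/lfunP => A; rewrite (matrix_sum_delta A) !linear_sum /=.
apply: eq_bigr => i _; rewrite !linear_sum /=; apply: eq_bigr => j _.
by rewrite !linearZ /= -pure_delta hh'.
Qed.

Lemma tens_universal (Z : vectType F) (b : V -> W -> Z) :
    (forall y, linear (b^~ y)) -> (forall x, linear (b x)) ->
  exists! h : 'Hom(tens, Z), forall x y, h (pure x y) = b x y.
Proof.
move=> bl br.
have blin (y : W) : exists g : {linear V -> Z}, g =1 b^~ y.
  pose m := GRing.isLinear.Build F V Z _ _ (bl y).
  by exists (HB.pack (b^~ y) m : {linear V -> Z}).
have brin (x : V) : exists g : {linear W -> Z}, g =1 b x.
  pose m := GRing.isLinear.Build F W Z _ _ (br x).
  by exists (HB.pack (b x) m : {linear W -> Z}).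
pose bv i := r2v (delta_mx 0 i) : V; pose bw j := r2v (delta_mx 0 j) : W.
pose h0 (A : tens) : Z :=
  \sum_i \sum_j (A : 'M_(_, _)) i j *: b (bv i) (bw j).
have h0l : linear h0.
  move=> a A B; rewrite /h0 scaler_sumr -big_split /=.
  apply: eq_bigr => i _; rewrite scaler_sumr -big_split /=.
  by apply: eq_bigr => j _; rewrite !mxE scalerDl scalerA.
pose m := GRing.isLinear.Build F tens Z _ _ h0l.
pose h := linfun (HB.pack h0 m : {linear tens -> Z}).
have hP x y : h (pure x y) = b x y.
  rewrite lfunE /= /h0.
  have [gy gyE] := blin y; rewrite -gyE -[x in RHS]v2rK.
  rewrite [v2r x in RHS]row_sum_delta !linear_sum /=; apply: eq_bigr => i _.
  rewrite !linearZ /= gyE.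
  have [gx gxE] := brin (r2v (delta_mx 0 i)); rewrite -gxE -[y in RHS]v2rK.
  rewrite [v2r y in RHS]row_sum_delta !linear_sum /=.
  apply: eq_bigr => j _; rewrite linearZ /= linearZ /= gxE !scalerA.
  by rewrite /pure !mxE big_ord1 !mxE.
exists h; split=> // h' h'P; apply: tens_ext => x y; by rewrite hP h'P.
Qed.

Lemma tensmapM f f' g g' :
  tensmap (f * f') (g * g') = tensmap f g * tensmap f' g'.
Proof. by apply: tens_ext => x y; rewrite !(endoM, tensmap_pure). Qed.
Lemma tensmap1 : tensmap 1 1 = 1.
Proof. by apply: tens_ext => x y; rewrite tensmap_pure !endo1. Qed.
Lemma tensmapDl f f' g : tensmap (f + f') g = tensmap f g + tensmap f' g.
Proof.
by apply: tens_ext => x y; rewrite add_lfunE !tensmap_pure add_lfunE pureDl.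
Qed.
Lemma tensmapDr f g g' : tensmap f (g + g') = tensmap f g + tensmap f g'.
Proof.
by apply: tens_ext => x y; rewrite add_lfunE !tensmap_pure add_lfunE pureDr.
Qed.
Lemma tensmapZl a f g : tensmap (a *: f) g = a *: tensmap f g.
Proof.
by apply: tens_ext => x y; rewrite scale_lfunE !tensmap_pure scale_lfunE pureZl.
Qed.
Lemma tensmapZr a f g : tensmap f (a *: g) = a *: tensmap f g.
Proof.
by apply: tens_ext => x y; rewrite scale_lfunE !tensmap_pure scale_lfunE pureZr.
Qed.
Lemma tensmap0l g : tensmap 0 g = 0.
Proof. by rewrite -(scale0r (0 : endo V)) tensmapZl scale0r. Qed.
Lemma tensmap0r f : tensmap f 0 = 0.
Proof. by rewrite -(scale0r (0 : endo W)) tensmapZr scale0r. Qed.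

End Tensor.

(* Linear identities between vectors, solved coefficient by coefficient. *)
Section LinearReflection.
Variables (F : fieldType) (V : lmodType F).

Inductive lin_expr : Type :=
| LVar of nat | LAdd of lin_expr & lin_expr | LOpp of lin_expr
| LScale of F & lin_expr.

Fixpoint lin_eval (env : seq V) (t : lin_expr) : V :=
  match t with
  | LVar i => env`_i
  | LAdd a b => lin_eval env a + lin_eval env b
  | LOpp a => - lin_eval env a
  | LScale c a => c *: lin_eval env a
  end.

Fixpoint lin_coef (t : lin_expr) (i : nat) : F :=
  match t with
  | LVar j => if j == i then 1 else 0
  | LAdd a b => lin_coef a i + lin_coef b i
  | LOpp a => - lin_coef a i
  | LScale c a => c * lin_coef a i
  end.

Lemma lin_evalE env t :
  lin_eval env t = \sum_(i < size env) lin_coef t i *: env`_i.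
Proof.
elim: t => /= [j|a -> b ->|a ->|c a ->].
- have [jlt|jge] := ltnP j (size env); last first.
    rewrite nth_default // big1 // => i _.
    by case: eqP (ltn_ord i) => [<-|_ _]; rewrite ?scale0r // ltnNge jge.
  rewrite (bigD1 (Ordinal jlt)) //= eqxx scale1r big1 ?addr0 // => i.
  by rewrite -val_eqE /= eq_sym => /negPf->; rewrite scale0r.
- by rewrite -big_split; apply: eq_bigr => i _; rewrite scalerDl.
- by rewrite -sumrN; apply: eq_bigr => i _; rewrite scaleNr.
- by rewrite scaler_sumr; apply: eq_bigr => i _; rewrite scalerA.
Qed.

Fixpoint lin_same (m : nat) (s t : lin_expr) : Prop :=
  if m is m'.+1 then lin_coef s m' = lin_coef t m' /\ lin_same m' s t else True.

Lemma lin_eq env s t :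
  lin_same (size env) s t -> lin_eval env s = lin_eval env t.
Proof.
move=> st; rewrite !lin_evalE; apply: eq_bigr => -[i ilt] _ /=; congr (_ *: _).
elim: (size env) st ilt => //= m IH [em st]; rewrite ltnS leq_eqVlt.
by case/predU1P => [->|/IH]; last exact.
Qed.

End LinearReflection.

Ltac lin_index x l :=
  lazymatch l with
  | x :: _ => constr:(0%N)
  | _ :: ?l' => let i := lin_index x l' in constr:(i.+1)
  end.
Ltac lin_atoms l t :=
  lazymatch t with
  | ?a + ?b => let l := lin_atoms l a in lin_atoms l b
  | - ?a => lin_atoms l a
  | _ *: ?a => lin_atoms l a
  | _ => match l with
         | context [t :: _] => l
         | _ => constr:(t :: l)
         end
  end.
Ltac lin_reify F l t :=
  lazymatch t with
  | ?a + ?b => let a := lin_reify F l a in let b := lin_reify F l b in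
               constr:(LAdd a b)
  | - ?a => let a := lin_reify F l a in constr:(LOpp a)
  | ?c *: ?a => let a := lin_reify F l a in constr:(LScale c a)
  | _ => let i := lin_index t l in constr:(LVar F i)
  end.
Ltac linear_identity F :=
  lazymatch goal with
  | |- @eq ?T ?a ?b =>
    let l := lin_atoms (@nil T) a in
    let l := lin_atoms l b in
    let s := lin_reify F l a in
    let t := lin_reify F l b in
    refine (@lin_eq F _ l s t _); rewrite /=; do ?split; try by [ring | field]
  end.

(* The identities behind the coproduct formulas: in each case [x + y] and
   [z + w] are the images of two generators. *)
Section CoproductIdentities.
Variables (F : fieldType) (v : F) (V : vectType F) (v0 : v != 0).
Implicit Types x y z w l : endo V.

Lemma coproduct_serre x y z w :
    (v + v^-1) *: (x * z * x) = x ^+ 2 * z + z * x ^+ 2 ->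
    (v + v^-1) *: (y * w * y) = y ^+ 2 * w + w * y ^+ 2 ->
    y * x = v ^+ 2 *: (x * y) ->
    y * z = v^-1 *: (z * y) -> w * x = v^-1 *: (x * w) ->
  (v + v^-1) *: ((x + y) * (z + w) * (x + y)) =
  (x + y) ^+ 2 * (z + w) + (z + w) * (x + y) ^+ 2.
Proof.
rewrite !expr2 => sx sy yx yz wx.
have -> : (v + v^-1) *: ((x + y) * (z + w) * (x + y)) =
    (v + v^-1) *: (x * z * x) + (v + v^-1) *: (y * w * y) +
    (v + v^-1) *: (x * z * y + x * (w * x) + x * w * y
      + y * z * x + (y * z) * y + y * (w * x)).
  rewrite !(mulrDl, mulrDr) !mulrA; linear_identity F.
rewrite {}sx {}sy !(mulrDl, mulrDr) !mulrA.
have yxL u : u * y * x = v ^+ 2 *: (u * x * y).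
  by rewrite -mulrA yx -endo_scaleAr mulrA.
have yzL u : u * y * z = v^-1 *: (u * z * y).
  by rewrite -mulrA yz -endo_scaleAr mulrA.
have wxL u : u * w * x = v^-1 *: (u * x * w).
  by rewrite -mulrA wx -endo_scaleAr mulrA.
rewrite !(yx, yz, wx, yxL, yzL, wxL, =^~ endo_scaleAl, =^~ endo_scaleAr, mulrA).
linear_identity F.
Qed.

Lemma coproduct_comm x y z w :
    x * z = z * x -> y * w = w * y -> y * z = z * y -> w * x = x * w ->
  (x + y) * (z + w) = (z + w) * (x + y).
Proof.
move=> xz yw yz wx; rewrite !(mulrDl, mulrDr) xz yw yz wx; linear_identity F.
Qed.

(* [e_1] and [l]: here [x] plays the role of [1 \otimes e_1]. *)
Lemma coproduct_ele x y l :
    (v + v^-1) *: (x * l * x) = v^-1 *: (x ^+ 2 * l) + v *: (l * x ^+ 2) ->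
    y * x = v ^+ 2 *: (x * y) -> y * l = l * y -> l * l = l ->
  (v + v^-1) *: ((x + y) * l * (x + y)) =
  v^-1 *: ((x + y) ^+ 2 * l) + v *: (l * (x + y) ^+ 2).
Proof.
rewrite !expr2 => sx yx yl ll.
have -> : (v + v^-1) *: ((x + y) * l * (x + y)) = (v + v^-1) *: (x * l * x) +
    (v + v^-1) *: (x * l * y + y * l * x + y * l * y).
  rewrite !(mulrDl, mulrDr); linear_identity F.
rewrite {}sx !(mulrDl, mulrDr) !mulrA.
have yxL u : u * y * x = v ^+ 2 *: (u * x * y).
  by rewrite -mulrA yx -endo_scaleAr mulrA.
have ylL u : u * y * l = u * l * y by rewrite -mulrA yl mulrA.
rewrite !(yx, yl, yxL, ylL, =^~ endo_scaleAl, =^~ endo_scaleAr, mulrA).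
linear_identity F.
Qed.

(* [f_1] and [l]: here [y] plays the role of [k_1^{-1} \otimes f_1]. *)
Lemma coproduct_flf x y l :
    (v + v^-1) *: (y * l * y) = v^-1 *: (l * y ^+ 2) + v *: (y ^+ 2 * l) ->
    y * x = v ^+ 2 *: (x * y) -> l * x = x * l ->
  (v + v^-1) *: ((x + y) * l * (x + y)) =
  v^-1 *: (l * (x + y) ^+ 2) + v *: ((x + y) ^+ 2 * l).
Proof.
rewrite !expr2 => sy yx lx.
have -> : (v + v^-1) *: ((x + y) * l * (x + y)) = (v + v^-1) *: (y * l * y) +
    (v + v^-1) *: (x * l * x + x * l * y + y * (l * x)).
  rewrite !(mulrDl, mulrDr) !mulrA; linear_identity F.
rewrite {}sy !(mulrDl, mulrDr) !mulrA.
have yxL u : u * y * x = v ^+ 2 *: (u * x * y).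
  by rewrite -mulrA yx -endo_scaleAr mulrA.
have lxL u : u * l * x = u * x * l by rewrite -mulrA lx mulrA.
rewrite !(yx, lx, yxL, lxL, =^~ endo_scaleAl, =^~ endo_scaleAr, mulrA).
linear_identity F.
Qed.

End CoproductIdentities.

Section DerivedRelations.
Variables (F : fieldType) (v : F) (n : nat) (V : vectType F) (v0 : v != 0).
Variables (e f k ki : 'I_n.-1 -> endo V).
Hypothesis h : U_relations v e f k ki.

Lemma rel_kMe i j : k i * e j = v ^ cartan i j *: (e j * k i).
Proof.
by rewrite endo_scaleAl -(rel_ke h) -!mulrA (rel_kik h) mulr1.
Qed.

Lemma rel_kMf i j : k i * f j = v ^ (- cartan i j) *: (f j * k i).
Proof.
by rewrite endo_scaleAl -(rel_kf h) -!mulrA (rel_kik h) mulr1.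
Qed.

Lemma rel_kiMe i j : ki i * e j = v ^ (- cartan i j) *: (e j * ki i).
Proof.
have /(congr1 (fun u => ki i * u * ki i)) := rel_kMe i j.
rewrite !mulrA (rel_kik h) mul1r -endo_scaleAr -endo_scaleAl => ->.
rewrite -!mulrA (rel_kki h) mulr1 scalerA -expfzDr // addNr expr0z.
by rewrite scale1r.
Qed.

Lemma rel_kiMf i j : ki i * f j = v ^ cartan i j *: (f j * ki i).
Proof.
have /(congr1 (fun u => ki i * u * ki i)) := rel_kMf i j.
rewrite !mulrA (rel_kik h) mul1r -endo_scaleAr -endo_scaleAl => ->.
rewrite -!mulrA (rel_kki h) mulr1 scalerA -expfzDr // addrN expr0z.
by rewrite scale1r.
Qed.

Lemma rel_kiki i j : ki i * ki j = ki j * ki i.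
Proof.
have E : k j * k i * (ki i * ki j) = k j * k i * (ki j * ki i).
  rewrite !mulrA -(mulrA (k j)) (rel_kki h) mulr1 (rel_kki h).
  by rewrite -(rel_kk h i j) -(mulrA (k i)) (rel_kki h) mulr1 (rel_kki h).
move/(congr1 (fun u => ki i * (ki j * u))): E.
by rewrite !mulrA -(mulrA (ki i)) (rel_kik h) mulr1 (rel_kik h) !mul1r.
Qed.

Lemma rel_kki_comm i j : k i * ki j = ki j * k i.
Proof.
have /(congr1 (fun u => ki j * u * ki j)) := rel_kk h i j.
rewrite !mulrA (rel_kik h) mul1r => <-.
by rewrite -!mulrA (rel_kki h) mulr1.
Qed.

End DerivedRelations.

Lemma adj_sym n (i j : 'I_n.-1) : adj i j = adj j i.
Proof. by rewrite /adj orbC. Qed.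

Lemma adj_irrefl n (i : 'I_n.-1) : adj i i = false.
Proof. by rewrite /adj; lia. Qed.

Lemma cartan_diag n (i : 'I_n.-1) : cartan i i = 2.
Proof. by rewrite /cartan eqxx. Qed.

Lemma cartan_adj n (i j : 'I_n.-1) : adj i j -> cartan i j = -1.
Proof.
by move=> ij; rewrite /cartan ij; case: eqP ij => // ->; rewrite adj_irrefl.
Qed.

Lemma cartan_far n (i j : 'I_n.-1) : i != j -> ~~ adj i j -> cartan i j = 0.
Proof. by rewrite /cartan => /negPf-> /negPf->. Qed.

Lemma cartan_sym n (i j : 'I_n.-1) : cartan i j = cartan j i.
Proof. by rewrite /cartan eq_sym adj_sym. Qed.

Section Coproduct.
Variables (F : fieldType) (v : F) (n : nat) (V W : vectType F) (v0 : v != 0).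

Definition rho_e (eV : 'I_n.-1 -> endo V) (eW kW : 'I_n.-1 -> endo W) i :
  endo (tens V W) := tensmap 1 (eW i) + tensmap (eV i) (kW i).
Definition rho_f (fV kiV : 'I_n.-1 -> endo V) (fW : 'I_n.-1 -> endo W) i :
  endo (tens V W) := tensmap (kiV i) (fW i) + tensmap (fV i) 1.
Definition rho_k (kV : 'I_n.-1 -> endo V) (kW : 'I_n.-1 -> endo W) i :
  endo (tens V W) := tensmap (kV i) (kW i).
Definition rho_l (l : endo W) : endo (tens V W) := tensmap 1 l.

Variables (eV fV kV kiV : 'I_n.-1 -> endo V).
Variables (eW fW kW kiW : 'I_n.-1 -> endo W) (l : endo W).
Hypothesis hV : U_relations v eV fV kV kiV.

Local Notation e := (rho_e eV eW kW).
Local Notation f := (rho_f fV kiV fW).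
Local Notation k := (rho_k kV kW).
Local Notation ki := (rho_k kiV kiW).
Local Notation "a '@@' b" := (tensmap a b) (at level 35).

Lemma rho_U_relations :
  U_relations v eW fW kW kiW -> U_relations v e f k ki.
Proof.
move=> hW.
have yx i j : (eV i @@ kW i) * (1 @@ eW j) =
    v ^ cartan i j *: ((1 @@ eW j) * (eV i @@ kW i)).
  by rewrite -!tensmapM mul1r mulr1 (rel_kMe hW) tensmapZr.
have qp i j : (kiV i @@ fW i) * (fV j @@ 1) =
    v ^ cartan i j *: ((fV j @@ 1) * (kiV i @@ fW i)).
  by rewrite -!tensmapM mul1r mulr1 (rel_kiMf v0 hV) tensmapZl.
split.
- by move=> i; rewrite -tensmapM (rel_kki hV) (rel_kki hW) tensmap1.
- by move=> i; rewrite -tensmapM (rel_kik hV) (rel_kik hW) tensmap1.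
- by move=> i j; rewrite -!tensmapM (rel_kk hV) (rel_kk hW).
- move=> i j; rewrite mulrDr mulrDl -!tensmapM mulr1 (rel_kki hV).
  rewrite (rel_ke hV) (rel_ke hW) (rel_kk hW) -mulrA (rel_kki hW) mulr1.
  by rewrite tensmapZl tensmapZr scalerDr.
- move=> i j; rewrite mulrDr mulrDl -!tensmapM mulr1 (rel_kki hW).
  rewrite (rel_kf hV) (rel_kf hW) (rel_kki_comm hV) -mulrA (rel_kki hV) mulr1.
  by rewrite tensmapZl tensmapZr scalerDr.
- move=> i j.
  have -> : e i * f j - f j * e i =
      (kiV j @@ (eW i * fW j - fW j * eW i)) +
      ((eV i * fV j - fV j * eV i) @@ kW i) +
      ((eV i * kiV j) @@ (kW i * fW j) - (kiV j * eV i) @@ (fW j * kW i)).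
    rewrite /rho_e /rho_f !(mulrDl, mulrDr) -!tensmapM !(mul1r, mulr1).
    by rewrite -!scaleN1r !(tensmapDr, tensmapDl, tensmapZl, tensmapZr);
       linear_identity F.
  rewrite (rel_kMf hW) (rel_kiMe v0 hV) tensmapZl tensmapZr cartan_sym subrr addr0.
  rewrite (rel_ef hV) (rel_ef hW).
  case: eqP => [->|_]; last first.
    by rewrite !scale0r tensmap0l tensmap0r addr0.
  rewrite /rho_k -!scaleN1r !(tensmapDr, tensmapDl, tensmapZl, tensmapZr).
  by linear_identity F.
- move=> i j nij; have [->|neq_ij] := eqVneq i j; first by [].
  have nji : ~~ adj j i by rewrite adj_sym.
  apply: (@coproduct_comm F).
  + by rewrite -!tensmapM (rel_ee hW).
  + by rewrite -!tensmapM (rel_ee hV) // (rel_kk hW).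
  + by rewrite yx cartan_far // scale1r.
  + by rewrite yx cartan_far 1?eq_sym // scale1r.
- move=> i j nij; have [->|neq_ij] := eqVneq i j; first by [].
  have nji : ~~ adj j i by rewrite adj_sym.
  apply: (@coproduct_comm F).
  + by rewrite -!tensmapM (rel_ff hW) // (rel_kiki hV).
  + by rewrite -!tensmapM (rel_ff hV).
  + by rewrite qp cartan_far 1?eq_sym // scale1r.
  + by rewrite qp cartan_far // scale1r.
- move=> i j ij; apply: coproduct_serre => //.
  + by rewrite !expr2 -!tensmapM !mulr1 -tensmapZr (rel_eee hW) // tensmapDr !expr2.
  + have kk1 : kW i * kW j * kW i = kW i * kW i * kW j.
      by rewrite -mulrA (rel_kk hW j) mulrA.
    have kk2 : kW j * (kW i * kW i) = kW i * kW i * kW j.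
      by rewrite mulrA (rel_kk hW j) kk1.
    rewrite !expr2 -!tensmapM kk1 kk2 -tensmapZl (rel_eee hV) // tensmapDl.
    by rewrite !expr2.
  + by rewrite yx cartan_diag.
  + by rewrite yx cartan_adj.
  + by rewrite yx cartan_adj // adj_sym.
- move=> i j ij.
  have adji : adj j i by rewrite adj_sym.
  rewrite /rho_f ![tensmap (kiV _) _ + _]addrC; apply: coproduct_serre => //.
  + by rewrite !expr2 -!tensmapM !mulr1 -tensmapZl (rel_fff hV) // tensmapDl !expr2.
  + have kk1 : kiV i * kiV j * kiV i = kiV i * kiV i * kiV j.
      by rewrite -mulrA (rel_kiki hV j) mulrA.
    have kk2 : kiV j * (kiV i * kiV i) = kiV i * kiV i * kiV j.
      by rewrite mulrA (rel_kiki hV j) kk1.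
    rewrite !expr2 -!tensmapM kk1 kk2 -tensmapZr (rel_fff hW) // tensmapDr.
    by rewrite !expr2.
  + by rewrite qp cartan_diag.
  + by rewrite qp cartan_adj.
  + by rewrite qp cartan_adj.
Qed.

Lemma rho_MU_relations :
  MU_relations v eW fW kW kiW l -> MU_relations v e f k ki (rho_l l).
Proof.
move=> hW; split.
- by apply: rho_U_relations; case: hW.
- by rewrite expr2 -tensmapM mulr1 -expr2 (rel_ll hW).
- by move=> i; rewrite -!tensmapM mulr1 mul1r (rel_kl hW).
- move=> i i0; rewrite mulrDr mulrDl -!tensmapM !(mul1r, mulr1).
  by rewrite (rel_le hW) // (rel_kl hW).
- move=> i i0; rewrite mulrDr mulrDl -!tensmapM !(mul1r, mulr1).
  by rewrite (rel_lf hW).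
- move=> i i0; rewrite mulrDr mulrDl -!tensmapM !(mul1r, mulr1).
  by rewrite (rel_lel hW) // -mulrA (rel_kl hW) mulrA -expr2 (rel_ll hW).
- move=> i i0; rewrite mulrDr !mulrDl -!tensmapM !(mul1r, mulr1).
  by rewrite (rel_lfl hW) // -expr2 (rel_ll hW).
- move=> i i0; apply: coproduct_ele => //.
  + rewrite !expr2 -!tensmapM !mulr1 -!tensmapZr (rel_ele hW) // tensmapDr.
    by rewrite !expr2.
  + by rewrite -!tensmapM mul1r mulr1 (rel_kMe hW) tensmapZr cartan_diag.
  + by rewrite -!tensmapM mul1r mulr1 (rel_kl hW).
  + by rewrite -tensmapM mulr1 -expr2 (rel_ll hW).
- move=> i i0; rewrite /rho_f [tensmap (kiV _) _ + _]addrC; apply: coproduct_flf => //.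
  + rewrite !expr2 -!tensmapM !mulr1 !mul1r -!tensmapZr (rel_flf hW) // tensmapDr.
    by rewrite !expr2.
  + by rewrite -!tensmapM mul1r mulr1 (rel_kiMf v0 hV) tensmapZl cartan_diag.
  + by rewrite -!tensmapM mul1r mulr1 mul1r mulr1.
Qed.

End Coproduct.

Section Wedge.
Variables (F : fieldType) (v : F) (n r : nat).

Definition rsubset : finType := {I : {set 'I_n} | #|I| == r}.
Definition wedge : vectType F := {ffun rsubset -> F^o}.

(* The basis vector u_I when #|I| = r, and 0 otherwise. *)
Definition uvec (I : {set 'I_n}) : wedge := [ffun J => (val J == I)%:R].

(* The linear map with u_I |-> g I for every r-subset I. *)
Definition wedge_map (g : {set 'I_n} -> wedge) : endo wedge :=
  linfun (fun w : wedge => \sum_(I : rsubset) (w I : F) *: g (val I)).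

Definition wedge_e (i : 'I_n.-1) : endo wedge := wedge_map (fun I =>
  if (hi i \in I) && (lo i \notin I) then uvec (lo i |: (I :\ hi i)) else 0).

Definition wedge_f (i : 'I_n.-1) : endo wedge := wedge_map (fun I =>
  if (lo i \in I) && (hi i \notin I) then uvec (hi i |: (I :\ lo i)) else 0).

Definition wedge_wt (i : 'I_n.-1) (I : {set 'I_n}) : F :=
  if (lo i \in I) && (hi i \notin I) then v
  else if (lo i \notin I) && (hi i \in I) then v^-1 else 1.

Definition wedge_k (i : 'I_n.-1) : endo wedge :=
  wedge_map (fun I => wedge_wt i I *: uvec I).
Definition wedge_ki (i : 'I_n.-1) : endo wedge :=
  wedge_map (fun I => (wedge_wt i I)^-1 *: uvec I).

(* The element 1 of {1, ..., n} is the ordinal of value 0. *)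
Definition wedge_l : endo wedge := wedge_map (fun I =>
  if [exists j in I, val j == 0%N] then 0 else uvec I).

Lemma uvec_out (I : {set 'I_n}) : #|I| != r -> uvec I = 0.
Proof.
move=> Ir; apply/ffunP => J; rewrite !ffunE.
by case: eqP => // IJ; rewrite -IJ (valP J) in Ir.
Qed.

Lemma wedge_sum (w : wedge) :
  w = \sum_(I : rsubset) (w I : F) *: uvec (val I).
Proof.
apply/ffunP => J; rewrite sum_ffunE (bigD1 J) //= big1 => [|I IJ].
  by rewrite !ffunE eqxx addr0; apply: esym; apply: mulr1.
by rewrite !ffunE val_eqE eq_sym (negPf IJ); apply: mulr0.
Qed.

Lemma wedge_ext (f g : endo wedge) :
  (forall I : {set 'I_n}, #|I| = r -> f (uvec I) = g (uvec I)) -> f = g.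
Proof.
move=> fg; apply/lfunP => w; rewrite (wedge_sum w) !linear_sum /=.
by apply: eq_bigr => I _; rewrite !linearZ /= fg //; apply/eqP/(valP I).
Qed.

Lemma wedge_map_out (g : {set 'I_n} -> wedge) (I : {set 'I_n}) :
  #|I| != r -> wedge_map g (uvec I) = 0.
Proof. by move/uvec_out->; rewrite linear0. Qed.

Lemma wedge_mapE (g : {set 'I_n} -> wedge) (I : {set 'I_n}) :
  #|I| = r -> wedge_map g (uvec I) = g I.
Proof.
pose h (w : wedge) := \sum_(I : rsubset) (w I : F) *: g (val I).
have hl : linear h.
  move=> a w w'; rewrite /h scaler_sumr -big_split /=; apply: eq_bigr => J _.
  by rewrite !ffunE scalerDl scalerA.
pose m := GRing.isLinear.Build F wedge wedge _ _ hl.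
move=> Ir; have -> : wedge_map g = linfun (HB.pack h m : {linear wedge -> wedge}).
  by [].
rewrite lfunE /= /h.
have IrP : #|I| == r by apply/eqP.
rewrite (bigD1 (Sub I IrP)) //= big1 => [|J JI]; rewrite ffunE.
  by rewrite SubK eqxx scale1r addr0.
have /negPf-> : val J != I.
  by apply: contraNneq JI => JI; rewrite -val_eqE SubK JI.
by rewrite scale0r.
Qed.

End Wedge.

Section WedgeRelations.
Variables (F : fieldType) (v : F) (n r : nat).
Hypotheses (v0 : v != 0) (v1 : v ^+ 2 != 1).
Local Notation uvec := (@uvec F n r).
Local Notation W := (wedge F n r).
Local Notation set := {set 'I_n}.

Definition slide (a b : 'I_n) : endo W := wedge_map (fun I =>
  if (a \in I) && (b \notin I) then uvec (b |: (I :\ a)) else 0).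

Lemma slideE a b (I : set) : slide a b (uvec I) =
  if (a \in I) && (b \notin I) then uvec (b |: (I :\ a)) else 0.
Proof.
have [/wedge_mapE->//|Ir] := eqVneq #|I| r.
rewrite wedge_map_out //; case: ifP => // /andP[aI bI].
rewrite uvec_out // cardsU1 !inE (negPf bI) andbF /=.
by rewrite (cardsD1 a I) aI in Ir.
Qed.

Lemma wedge_kE i (I : set) :
  wedge_k v r i (uvec I) = wedge_wt v i I *: uvec I.
Proof.
have [/wedge_mapE->//|Ir] := eqVneq #|I| r.
by rewrite wedge_map_out // uvec_out // scaler0.
Qed.

Lemma wedge_kiE i (I : set) :
  wedge_ki v r i (uvec I) = (wedge_wt v i I)^-1 *: uvec I.
Proof.
have [/wedge_mapE->//|Ir] := eqVneq #|I| r.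
by rewrite wedge_map_out // uvec_out // scaler0.
Qed.

Lemma wedge_lE (I : set) : wedge_l F n r (uvec I) =
  if [exists j in I, val j == 0%N] then 0 else uvec I.
Proof.
have [/wedge_mapE->//|Ir] := eqVneq #|I| r.
by rewrite wedge_map_out // uvec_out // if_same.
Qed.

Lemma slide_comm a b c d : a != b -> c != d -> a != d -> b != c ->
  slide a b * slide c d = slide c d * slide a b.
Proof.
move=> ab cd ad bc; apply: wedge_ext => I _.
rewrite !endoM !slideE !(fun_if (slide _ _)) !linear0 !slideE !inE.
rewrite (negPf ad) (negPf bc) [c == b]eq_sym [d == a]eq_sym (negPf ad) (negPf bc) /=.
have [eac|ac] := eqVneq a c; have [ebd|bd] := eqVneq b d => /=;
  rewrite ?eac ?ebd ?eqxx ?[c == a]eq_sym ?[d == b]eq_sym ?(negPf ac) ?(negPf bd) /= ?andbF ?if_same //.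
case: (a \in I); case: (b \in I); case: (c \in I); case: (d \in I) => //=.
congr uvec; apply/setP => x; rewrite !inE.
have [->|xd] := eqVneq x d; rewrite ?[d == a]eq_sym ?(negPf ad) ?[d == b]eq_sym ?(negPf bd) //=.
have [->|xb] := eqVneq x b; rewrite ?(negPf bc) //=.
by rewrite andbCA.
Qed.

Lemma slide_sandwich a b c d : a != b -> (a != d) || (b != c) ->
  slide a b * slide c d * slide a b = 0.
Proof.
move=> ab; rewrite -negb_and => adbc; apply: wedge_ext => I _.
rewrite zero_lfunE !endoM !slideE !(fun_if (slide _ _)) !linear0 !slideE.
case: ifP => // _; case: ifP => // _; last by rewrite linear0.
rewrite slideE !inE eqxx (negPf ab) /= andbF orbF.
move: adbc; case: (a == d) => //= /negPf bc.
by rewrite bc eqxx orbT.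
Qed.

Lemma slide_sq a b : a != b -> slide a b ^+ 2 = 0.
Proof.
move=> ab; apply: wedge_ext => I _.
rewrite zero_lfunE expr2 endoM slideE (fun_if (slide _ _)) linear0 slideE.
by case: ifP => // _; rewrite !inE eqxx (negPf ab).
Qed.

Lemma wedge_wtE i (I : set) :
  wedge_wt v i I = v ^ ((lo i \in I)%:Z - (hi i \in I)%:Z).
Proof. by rewrite /wedge_wt; case: (lo i \in I); case: (hi i \in I). Qed.

Lemma wedge_wt_neq0 i (I : set) : wedge_wt v i I != 0.
Proof. by rewrite wedge_wtE expfz_neq0. Qed.

Lemma lo_hi (i j : 'I_n.-1) : (lo i == hi j :> 'I_n) = (j.+1 == i :> nat).
Proof. by rewrite eq_sym. Qed.
Lemma hi_lo (i j : 'I_n.-1) : (hi i == lo j :> 'I_n) = (i.+1 == j :> nat).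
Proof. by []. Qed.
Lemma lo_lo (i j : 'I_n.-1) : (lo i == lo j :> 'I_n) = (i == j).
Proof. by []. Qed.
Lemma hi_hi (i j : 'I_n.-1) : (hi i == hi j :> 'I_n) = (i == j).
Proof. by rewrite -!val_eqE /= eqSS. Qed.
Lemma hi_neq_lo (i : 'I_n.-1) : hi i != lo i :> 'I_n.
Proof. by rewrite hi_lo; lia. Qed.

Lemma wt_slide_e i j (I : set) : hi j \in I -> lo j \notin I ->
  wedge_wt v i (lo j |: (I :\ hi j)) = v ^ cartan i j * wedge_wt v i I.
Proof.
move=> hI lI; rewrite !wedge_wtE -expfzDr // !inE lo_hi hi_lo lo_lo hi_hi /cartan /adj.
congr (v ^ _).
have [->|ij] := eqVneq i j; first by rewrite hI (negPf lI) /=; lia.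
have [e1|_] := eqVneq i.+1 (j : nat).
  have -> : hi i = lo j by apply/val_inj.
  rewrite (negPf lI) (_ : j.+1 == i = false) /=; lia.
have [e1|_] /= := eqVneq j.+1 (i : nat).
  have -> : lo i = hi j by apply/val_inj.
  by rewrite hI; lia.
by rewrite add0r.
Qed.

Lemma wt_slide_f i j (I : set) : lo j \in I -> hi j \notin I ->
  wedge_wt v i (hi j |: (I :\ lo j)) = v ^ (- cartan i j) * wedge_wt v i I.
Proof.
move=> lI hI; rewrite !wedge_wtE -expfzDr // !inE lo_hi hi_lo lo_lo hi_hi /cartan /adj.
congr (v ^ _).
have [->|ij] := eqVneq i j; first by rewrite lI (negPf hI) /=; lia.
have [e1|_] := eqVneq i.+1 (j : nat).
  have -> : hi i = lo j by apply/val_inj.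
  rewrite lI (_ : j.+1 == i = false) /=; lia.
have [e1|_] /= := eqVneq j.+1 (i : nat).
  have -> : lo i = hi j by apply/val_inj.
  by rewrite (negPf hI); lia.
by rewrite oppr0 add0r.
Qed.

Lemma wedge_MU_relations :
  MU_relations v (@wedge_e F n r) (@wedge_f F n r) (@wedge_k F v n r)
    (@wedge_ki F v n r) (@wedge_l F n r).
Proof.
have hl (i : 'I_n.-1) : hi i != lo i := hi_neq_lo i.
have lh (i : 'I_n.-1) : lo i != hi i by rewrite eq_sym hl.
have eE (i : 'I_n.-1) : wedge_e F r i = slide (hi i) (lo i) by [].
have fE (i : 'I_n.-1) : wedge_f F r i = slide (lo i) (hi i) by [].
have has1 (I : set) (a b : 'I_n) : (0 < a)%N -> (0 < b)%N ->
    [exists j in b |: (I :\ a), val j == 0%N] = [exists j in I, val j == 0%N].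
  move=> a0 b0; apply: eq_existsb => j; rewrite !inE.
  have [j0|_] := eqVneq (val j) 0%N; rewrite ?andbF // !andbT.
  have [E|_] := eqVneq j b; first by move: b0; rewrite -E [X in (_ < X)%N]j0.
  by have [E|_] := eqVneq j a; first by move: a0; rewrite -E [X in (_ < X)%N]j0.
have has0 (I : set) (i : 'I_n.-1) : i = 0%N :> nat -> lo i \in I ->
    [exists j in I, val j == 0%N].
  by move=> i0 iI; apply/existsP; exists (lo i); rewrite iI /= i0.
split; first split.
- move=> i; apply: wedge_ext => I _; rewrite endoM endo1 wedge_kiE linearZ /=.
  by rewrite wedge_kE scalerA mulVf ?scale1r // wedge_wt_neq0.
- move=> i; apply: wedge_ext => I _; rewrite endoM endo1 wedge_kE linearZ /=.
  by rewrite wedge_kiE scalerA mulfV ?scale1r // wedge_wt_neq0.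
- move=> i j; apply: wedge_ext => I _; rewrite !endoM !wedge_kE !linearZ /=.
  by rewrite !wedge_kE !scalerA mulrC.
- move=> i j; apply: wedge_ext => I _; rewrite scale_lfunE !endoM eE !wedge_kiE.
  rewrite !linearZ /= slideE; case: ifP => [/andP[hI lI]|_]; last first.
    by rewrite !linear0.
  rewrite wedge_kE wt_slide_e // scalerA mulrCA mulVf ?wedge_wt_neq0 //.
  by rewrite mulr1.
- move=> i j; apply: wedge_ext => I _; rewrite scale_lfunE !endoM fE !wedge_kiE.
  rewrite !linearZ /= slideE; case: ifP => [/andP[lI hI]|_]; last first.
    by rewrite !linear0.
  rewrite wedge_kE wt_slide_f // scalerA mulrCA mulVf ?wedge_wt_neq0 //.
  by rewrite mulr1.
- move=> i j; rewrite eE fE; case: eqVneq => [->|ij]; last first.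
    rewrite scale0r slide_comm ?subrr // ?hi_hi //.
  apply: wedge_ext => I _; rewrite scale1r scale_lfunE !add_lfunE !opp_lfunE.
  rewrite !endoM wedge_kE wedge_kiE !slideE /wedge_wt.
  have back (a b : 'I_n) : a \in I -> b \notin I -> a != b -> a |: (b |: I :\ a) :\ b = I.
    move=> aI bI ab; apply/setP => x; rewrite !inE.
    have [->|xa] //= := eqVneq x a.
    by have [->|] //= := eqVneq x b; rewrite (negPf bI).
  have vv : v - v^-1 != 0.
    rewrite subr_eq0; apply: contraNneq v1 => vE.
    by rewrite expr2 {1}vE mulVf.
  case: (boolP (lo j \in I)) => lI; case: (boolP (hi j \in I)) => hI /=;
    rewrite ?linear0 ?invr1 ?subrr ?scaler0 ?subr0 ?sub0r ?oppr0 ?addr0 ?add0r //.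
  + rewrite slideE !inE !eqxx (negPf (lh j)) /= back ?lh //.
    by rewrite -scalerBl scalerA mulVf // scale1r.
  + rewrite slideE !inE !eqxx (negPf (hl j)) /= back ?hl //.
    by rewrite -scalerBl scalerA invrK -[v^-1 - v]opprB mulrN mulVf // scaleN1r.
- move=> i j; rewrite !eE /adj negb_or => /andP[ij ji].
  by have [->//|neq] := eqVneq i j; rewrite slide_comm // eq_sym.
- move=> i j; rewrite !fE /adj negb_or => /andP[ij ji].
  by have [->//|neq] := eqVneq i j; rewrite slide_comm // eq_sym.
- move=> i j ij; rewrite !eE slide_sq // mul0r mulr0 addr0.
  rewrite slide_sandwich ?scaler0 // !hi_lo lo_hi.
  by move: ij; rewrite /adj; lia.
- move=> i j ij; rewrite !fE slide_sq // mul0r mulr0 addr0.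
  rewrite slide_sandwich ?scaler0 // hi_lo !lo_hi.
  by move: ij; rewrite /adj; lia.
- apply: wedge_ext => I _; rewrite expr2 endoM wedge_lE (fun_if (wedge_l _ _ _)).
  by rewrite linear0 wedge_lE; case: ifP => // ->.
- move=> i; apply: wedge_ext => I _; rewrite !endoM wedge_lE wedge_kE linearZ /=.
  by rewrite wedge_lE (fun_if (wedge_k _ _ _)) linear0 wedge_kE; case: ifP; rewrite ?scaler0.
- move=> i i0; apply: wedge_ext => I _; rewrite !endoM wedge_lE eE slideE.
  rewrite !(fun_if (slide _ _)) !(fun_if (wedge_l _ _ _)) !linear0 slideE wedge_lE.
  by rewrite has1 //; case: ifP; rewrite ?if_same // => ->.
- move=> i i0; apply: wedge_ext => I _; rewrite !endoM wedge_lE fE slideE.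
  rewrite !(fun_if (slide _ _)) !(fun_if (wedge_l _ _ _)) !linear0 slideE wedge_lE.
  by rewrite has1 //; case: ifP; rewrite ?if_same // => ->.
- move=> i i0.
  suff -> : wedge_l F n r * wedge_e F r i = 0 by rewrite mul0r.
  apply: wedge_ext => I _; rewrite zero_lfunE endoM eE slideE.
  case: ifP => _; last by rewrite linear0.
  by rewrite wedge_lE (has0 _ i) // !inE eqxx.
- move=> i i0.
  suff E : wedge_f F r i * wedge_l F n r = 0 by rewrite -mulrA E mulr0.
  apply: wedge_ext => I _; rewrite zero_lfunE endoM wedge_lE.
  case: ifPn => I1; first by rewrite linear0.
  rewrite fE slideE; case: ifP => // /andP[lI _].
  by rewrite (has0 _ i) in I1.
- move=> i i0; rewrite eE slide_sq // mul0r mulr0 !scaler0 addr0.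
  suff E : wedge_l F n r * wedge_e F r i = 0 by rewrite -mulrA -eE E mulr0 scaler0.
  apply: wedge_ext => I _; rewrite zero_lfunE endoM eE slideE.
  case: ifP => _; last by rewrite linear0.
  by rewrite wedge_lE (has0 _ i) // !inE eqxx.
- move=> i i0; rewrite fE slide_sq // mul0r mulr0 !scaler0 addr0.
  suff E : wedge_f F r i * wedge_l F n r = 0 by rewrite -fE E mul0r scaler0.
  apply: wedge_ext => I _; rewrite zero_lfunE endoM wedge_lE.
  case: ifPn => I1; first by rewrite linear0.
  rewrite fE slideE; case: ifP => // /andP[lI _].
  by rewrite (has0 _ i) in I1.
Qed.

End WedgeRelations.

(* Integral weights: the quotient of Z^n by Z(1, ..., 1). *)
Section Weights.
Variable n : nat.
Implicit Types a b : {ffun 'I_n -> int}.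

Definition weight_equiv a b : bool :=
  [forall i, forall j, a i - b i == a j - b j].

Lemma weight_equivP a b :
  reflect (exists c, forall i, a i = b i + c) (weight_equiv a b).
Proof.
apply: (iffP forallP) => [h|[c h] i]; last first.
  by apply/forallP => j; rewrite !h; apply/eqP; ring.
have [j _|n0] := pickP 'I_n; last by exists 0 => i; have := n0 i.
exists (a j - b j) => i; have /forallP/(_ j)/eqP <- := h i.
by ring.
Qed.

Lemma weight_equiv_refl : reflexive weight_equiv.
Proof. by move=> a; apply/weight_equivP; exists 0 => i; rewrite addr0. Qed.

Lemma weight_equiv_sym : symmetric weight_equiv.
Proof.
by move=> a b; apply/weight_equivP/weight_equivP => -[c h]; exists (- c) => i;
  rewrite h addrK.
Qed.

Lemma weight_equiv_trans : transitive weight_equiv.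
Proof.
move=> b a c /weight_equivP[d h] /weight_equivP[d' h'].
by apply/weight_equivP; exists (d' + d) => i; rewrite h h' addrA.
Qed.

Canonical weight_equiv_rel :=
  EquivRel weight_equiv weight_equiv_refl weight_equiv_sym weight_equiv_trans.

Definition weight := {eq_quot weight_equiv_rel}%qT.
HB.instance Definition _ : EqQuotient _ weight_equiv weight :=
  EqQuotient.on weight.
HB.instance Definition _ := Choice.on weight.

(* lambda_i - lambda_{i+1} *)
Definition wt_diff (mu : weight) (i : 'I_n.-1) : int :=
  repr mu (lo i) - repr mu (hi i).

Definition dominant (mu : weight) : Prop :=
  forall i j : 'I_n, (i <= j)%N -> repr mu j <= repr mu i.

Lemma repr_pi a : exists c, forall i, repr (\pi_weight a)%qT i = a i + c.
Proof. by apply/weight_equivP; rewrite -eqmodE reprK. Qed.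

Lemma wt_diff_pi a i : wt_diff (\pi_weight a)%qT i = a (lo i) - a (hi i).
Proof. by rewrite /wt_diff; have [c h] := repr_pi a; rewrite !h; ring. Qed.

Lemma dominant_pi a : dominant (\pi_weight a)%qT <->
  (forall i j : 'I_n, (i <= j)%N -> a j <= a i).
Proof.
have [c h] := repr_pi a.
by split=> d i j /d; rewrite !h; lia.
Qed.

End Weights.

Section Modules.
Variables (R : realType) (n : nat).

Definition ratfun : fieldType := {fraction {poly R[i]}}.
Definition vpar : ratfun := tofrac 'X.

Lemma vpar_neq0 : vpar != 0.
Proof. by rewrite tofrac_eq0 polyX_eq0. Qed.

Lemma vpar_sq_neq1 : vpar ^+ 2 != 1.
Proof.
rewrite /vpar -tofracXn -tofrac1 tofrac_eq; apply/eqP => /(congr1 (size \o val)).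
by rewrite /= size_polyXn size_poly1.
Qed.

(* Modules over algebras given by generators and relations: a finite
   dimensional space with operators satisfying the relations. *)
Record U_module := UModule {
  U_space :> vectType ratfun;
  U_e : 'I_n.-1 -> endo U_space;
  U_f : 'I_n.-1 -> endo U_space;
  U_k : 'I_n.-1 -> endo U_space;
  U_ki : 'I_n.-1 -> endo U_space;
  U_rel : U_relations vpar U_e U_f U_k U_ki }.

Record MU_module := MUModule {
  MU_space :> vectType ratfun;
  MU_e : 'I_n.-1 -> endo MU_space;
  MU_f : 'I_n.-1 -> endo MU_space;
  MU_k : 'I_n.-1 -> endo MU_space;
  MU_ki : 'I_n.-1 -> endo MU_space;
  MU_l : endo MU_space;
  MU_rel : MU_relations vpar MU_e MU_f MU_k MU_ki MU_l }.

Definition tens_module (X : U_module) (W : MU_module) : MU_module :=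
  MUModule (rho_MU_relations vpar_neq0 (U_rel X) (MU_rel W)).

Definition wedge_module (r : nat) : MU_module :=
  MUModule (wedge_MU_relations n r vpar_neq0 vpar_sq_neq1).

Definition U_stable (X : U_module) (S : {vspace X}) : Prop := forall i,
  [/\ (U_e X i @: S <= S)%VS, (U_f X i @: S <= S)%VS,
      (U_k X i @: S <= S)%VS & (U_ki X i @: S <= S)%VS].

Definition MU_stable (M : MU_module) (S : {vspace M}) : Prop :=
  (forall i, [/\ (MU_e M i @: S <= S)%VS, (MU_f M i @: S <= S)%VS,
                 (MU_k M i @: S <= S)%VS & (MU_ki M i @: S <= S)%VS])
  /\ (MU_l M @: S <= S)%VS.

Definition U_simple (X : U_module) : Prop :=
  {:X}%VS <> 0%VS /\
  forall S : {vspace X}, U_stable S -> S = 0%VS \/ S = {:X}%VS.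

Definition MU_simple (M : MU_module) : Prop :=
  {:M}%VS <> 0%VS /\
  forall S : {vspace M}, MU_stable S -> S = 0%VS \/ S = {:M}%VS.

Definition MU_iso (M N : MU_module) : Prop :=
  exists g : 'Hom(M, N), bijective g /\ forall x,
    (forall i, [/\ g (MU_e M i x) = MU_e N i (g x),
                   g (MU_f M i x) = MU_f N i (g x),
                   g (MU_k M i x) = MU_k N i (g x)
                 & g (MU_ki M i x) = MU_ki N i (g x)])
    /\ g (MU_l M x) = MU_l N (g x).

Section WeightSpaces.
Variables (V : vectType ratfun) (k : 'I_n.-1 -> endo V).

Definition weight_space (mu : weight n) : {vspace V} :=
  (\bigcap_(i < n.-1) lker (k i - vpar ^ wt_diff mu i *: \1%VF))%VS.

Lemma weight_spaceP mu x :
  reflect (forall i, k i x = vpar ^ wt_diff mu i *: x) (x \in weight_space mu).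
Proof.
have E i : (x \in lker (k i - vpar ^ wt_diff mu i *: \1%VF)) =
    (k i x == vpar ^ wt_diff mu i *: x).
  by rewrite memv_ker add_lfunE opp_lfunE scale_lfunE id_lfunE subr_eq0.
rewrite /weight_space memvE; apply: (iffP subv_bigcapP) => h i.
  by apply/eqP; rewrite -E memvE h.
by rewrite -memvE E h.
Qed.

(* V is the direct sum of all its weight spaces: they are independent, and
   finitely many of them span V. *)
Definition type1 : Prop :=
  (forall s : seq (weight n), uniq s ->
     directv (\sum_(mu <- s) weight_space mu)%VS) /\
  exists s : seq (weight n), (\sum_(mu <- s) weight_space mu)%VS = {:V}%VS.

End WeightSpaces.

Definition U_type1 (X : U_module) : Prop := type1 (U_k X).
Definition MU_type1 (M : MU_module) : Prop := type1 (MU_k M).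

(* L is (a copy of) L_lambda, which is unique up to isomorphism. *)
Definition is_L (lambda : weight n) (L : U_module) : Prop :=
  [/\ U_simple L, U_type1 L
    & exists x : L,
      [/\ x != 0, forall i, U_e L i x = 0,
          forall i, U_k L i x = vpar ^ wt_diff lambda i *: x
        & forall S : {vspace L}, U_stable S -> x \in S -> S = {:L}%VS]].

Section Depth.
Variable M : MU_module.

(* f_1 (f_2 (... (f_j x))), for j <= n - 1 *)
Definition f_word (j : nat) (x : M) : M :=
  foldr (fun i y => MU_f M i y) x (take j (enum 'I_n.-1)).

Definition weight_vector (x : M) : Prop :=
  exists mu, x \in weight_space (MU_k M) mu.

Definition has_depth (x : M) (r : nat) : Prop :=
  [/\ (r <= n)%N,
      forall j, (j < r)%N -> MU_l M (f_word j x) = 0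
    & (r < n)%N -> MU_l M (f_word r x) <> 0].

Definition MU_depth (r : nat) : Prop :=
  (exists x, [/\ x != 0, weight_vector x & has_depth x r]) /\
  (forall x s, x != 0 -> weight_vector x -> has_depth x s -> (s <= r)%N).

End Depth.

End Modules.

(* Main.v *)
From HB Require Import structures.
Require Import Defs.
From mathcomp Require Import all_boot all_order all_algebra.
From mathcomp Require Import generic_quotient boolp.
From mathcomp Require Import reals complex.
From mathcomp Require Import zify ring.

Set Implicit Arguments.
Unset Strict Implicit.
Unset Printing Implicit Defensive.

Import Order.TTheory GRing.Theory Num.Theory VectorInternalTheory.
Local Open Scope ring_scope.

(** For r fixed, put l_1 = l, b_i = [e_i, l_i], g_i = v k_i [l_i, f_i] and
    l_{i+1} = l_i + b_i g_i - g_i b_i.  The operators l_{i+1} and e_j, f_j, k_j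
    (j > i) again satisfy the mirabolic relations.  Hence the l_i are commuting
    projections; on W_r, l_i is the projection onto the span of the u_I with i not
    in I, and b_i, g_i are e_i, f_i; in general b_i and g_i exchange the vectors
    killed by l_{i+1} and fixed by l_i with those killed by l_i and fixed by
    l_{i+1}.
    Both e_j - b_j and f_j - [l_j, f_j] commute, up to powers of v, with all l_i,
    b_i, g_i.  So the space X of linear maps W_r -> M intertwining the l_i, b_i,
    g_i is stable under the adjoint action of U_v(sl_n), and evaluation
    X (x) W_r -> M is a map of MU(n)-modules.  The depth of a weight vector is
    the length of the initial run of the l_i killing it, and it can be pushed up
    with the b_i; maximality of r yields a vector killed exactly by the l_i with
    i <= r, which extends to a nonzero element of X.  For a minimal
    submodule L of X, which is some L_lambda, evaluation L (x) W_r -> M is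
    injective, as the l_i separate the basis of W_r, and then bijective because M
    is simple. *)

(** * Transposition *)

(** All the constructions are read off from the expected answer. In L (x) W_r the operators l_i come
    from the second factor, so [e_i, l_i] is 1 (x) e_i and [l_i, f_i] is k_i^{-1} (x) f_i, which the
    factor v k_i turns into 1 (x) f_i; what remains of the coproduct is e_i - b_i = e_i (x) k_i and
    f_i - [l_i, f_i] = f_i (x) 1. The proof has to establish in an arbitrary module the relations
    visible there. The adjoint action is forced in the same way: evaluation is linear over MU(n)
    only if e (p w) = p (e w) + (e p) (k w) and f (p w) = (k^{-1} p) (f w) + (f p) w.

    The relations of l_{i+1} with the generators of larger index pass from one index to the next.
    The obstacle is its relation with those of smaller index: in general e_i commutes neither with
    l_i nor with l_{i+1}, and that it commutes with l_{i+2} depends on the interaction of b_i with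
    b_{i+1} and g_{i+1}, hence the rank two computation. *)

Section Transpose.
Variables (F : fieldType) (V : vectType F).
Implicit Types (a b : endo V) (x y : V).

(** The standard bilinear form in coordinates. It identifies the dual space with [V], so that a
    transpose is again an endomorphism of [V] and every lemma applies to it. *)
Definition dotv x y : F := (v2r x *m (v2r y)^T) 0 0.
Definition tr_endo a : endo V := Hom (f2mx a)^T.

Lemma dotvDl x x' y : dotv (x + x') y = dotv x y + dotv x' y.
Proof. by rewrite /dotv linearD mulmxDl mxE. Qed.
Lemma dotvZl c x y : dotv (c *: x) y = c * dotv x y.
Proof. by rewrite /dotv linearZ -scalemxAl mxE. Qed.
Lemma dotvDr x y y' : dotv x (y + y') = dotv x y + dotv x y'.
Proof. by rewrite /dotv linearD /= linearD /= mulmxDr mxE. Qed.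
Lemma dotvZr c x y : dotv x (c *: y) = c * dotv x y.
Proof. by rewrite /dotv linearZ /= linearZ /= -scalemxAr mxE. Qed.

Lemma dotv_inj x x' : (forall y, dotv y x = dotv y x') -> x = x'.
Proof.
move=> eq_xx'; apply: v2r_inj; apply: trmx_inj; apply/matrixP => i j.
have := eq_xx' (r2v (delta_mx 0 i)).
by rewrite /dotv r2vK -!rowE !mxE (ord1 j).
Qed.

Lemma dotv_tr a x y : dotv x (tr_endo a y) = dotv (a x) y.
Proof.
by rewrite /dotv !v2r_lfun /tr_endo /= trmx_mul trmxK mulmxA.
Qed.

Lemma tr_endoK a : tr_endo (tr_endo a) = a.
Proof. by rewrite /tr_endo /= trmxK; case: a. Qed.

Lemma tr_endoM a b : tr_endo (a * b) = tr_endo b * tr_endo a.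
Proof.
by apply/lfunP => x; apply: dotv_inj => y; rewrite endoM !dotv_tr endoM.
Qed.
Lemma tr_endoD a b : tr_endo (a + b) = tr_endo a + tr_endo b.
Proof.
apply/lfunP => x; apply: dotv_inj => y.
by rewrite add_lfunE dotvDr !dotv_tr add_lfunE dotvDl.
Qed.
Lemma tr_endoZ c a : tr_endo (c *: a) = c *: tr_endo a.
Proof.
apply/lfunP => x; apply: dotv_inj => y.
by rewrite scale_lfunE dotvZr !dotv_tr scale_lfunE dotvZl.
Qed.
Lemma tr_endoB a b : tr_endo (a - b) = tr_endo a - tr_endo b.
Proof. by rewrite -scaleN1r tr_endoD tr_endoZ scaleN1r. Qed.

End Transpose.

(* Subtracts [c] times the known relation [l = r] from the goal. *)
Lemma lincomb (F : fieldType) (V : lmodType F) (c : F) (l r : V) (a b : V) :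
  l = r -> a + c *: r = b + c *: l -> a = b.
Proof. by move=> -> /addIr. Qed.

Definition far (i j : nat) := (i.+1 < j)%N || (j.+1 < i)%N.
Definition nadj (i j : nat) := (i.+1 == j) || (j.+1 == i).

Lemma far_sym i j : far i j = far j i. Proof. exact: orbC. Qed.
Lemma nadj_sym i j : nadj i j = nadj j i. Proof. exact: orbC. Qed.

Lemma index_cases i j : [\/ i = j, nadj i j /\ i != j | far i j /\ i != j].
Proof.
rewrite /nadj /far; case: (eqVneq i j) => [|ij]; first by constructor 1.
by case: (boolP ((i.+1 == j) || (j.+1 == i))) => h; [constructor 2|constructor 3]; lia.
Qed.

(** * The mirabolic relations from an index on *)

(* The relations of U_v(sl_n) and of MU(n) on vectors, the generators being
   indexed by [nat] and only meaningful below [m = n - 1].  In [Lrel p l] the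
   idempotent [l] plays the role of the mirabolic one for the generators with
   index at least [p], while it has to commute with all the [k i]. *)
Section Abstract.
Variables (F : fieldType) (v : F) (V : vectType F) (m : nat).

Record Urel (e f k ki : nat -> endo V) : Prop := {
  kkiP : forall i x, (i < m)%N -> k i (ki i x) = x;
  kikP : forall i x, (i < m)%N -> ki i (k i x) = x;
  kkP : forall i j x, (i < m)%N -> (j < m)%N -> k i (k j x) = k j (k i x);
  ke2P : forall i x, (i < m)%N -> k i (e i x) = v ^+ 2 *: e i (k i x);
  kf2P : forall i x, (i < m)%N -> f i (k i x) = v ^+ 2 *: k i (f i x);
  keaP : forall i j x, (i < m)%N -> (j < m)%N -> nadj i j ->
    e j (k i x) = v *: k i (e j x);
  kfaP : forall i j x, (i < m)%N -> (j < m)%N -> nadj i j ->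
    k i (f j x) = v *: f j (k i x);
  ke0P : forall i j x, (i < m)%N -> (j < m)%N -> far i j ->
    k i (e j x) = e j (k i x);
  kf0P : forall i j x, (i < m)%N -> (j < m)%N -> far i j ->
    k i (f j x) = f j (k i x);
  ef1P : forall i x, (i < m)%N ->
    e i (f i x) = f i (e i x) + (v - v^-1)^-1 *: (k i x - ki i x);
  ef0P : forall i j x, (i < m)%N -> (j < m)%N -> i != j ->
    e i (f j x) = f j (e i x);
  eeP : forall i j x, (i < m)%N -> (j < m)%N -> far i j ->
    e i (e j x) = e j (e i x);
  ffP : forall i j x, (i < m)%N -> (j < m)%N -> far i j ->
    f i (f j x) = f j (f i x);
  eeeP : forall i j x, (i < m)%N -> (j < m)%N -> nadj i j ->
    (v + v^-1) *: e i (e j (e i x)) = e i (e i (e j x)) + e j (e i (e i x));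
  fffP : forall i j x, (i < m)%N -> (j < m)%N -> nadj i j ->
    (v + v^-1) *: f i (f j (f i x)) = f i (f i (f j x)) + f j (f i (f i x)) }.

Record Lrel (e f k : nat -> endo V) (p : nat) (l : endo V) : Prop := {
  llP : forall x, l (l x) = l x;
  lkP : forall i x, (i < m)%N -> l (k i x) = k i (l x);
  l_eP : forall i x, (p < i)%N -> (i < m)%N -> l (e i x) = e i (l x);
  l_fP : forall i x, (p < i)%N -> (i < m)%N -> l (f i x) = f i (l x);
  lelP : forall x, (p < m)%N -> l (e p (l x)) = l (e p x);
  lflP : forall x, (p < m)%N -> l (f p (l x)) = f p (l x);
  eleP : forall x, (p < m)%N -> (v + v^-1) *: e p (l (e p x)) =
    v^-1 *: e p (e p (l x)) + v *: l (e p (e p x));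
  flfP : forall x, (p < m)%N -> (v + v^-1) *: f p (l (f p x)) =
    v^-1 *: l (f p (f p x)) + v *: f p (f p (l x)) }.

Ltac dualize H :=
  let y := fresh "y" in
  apply: dotv_inj => y;
  rewrite ?(dotvDr, dotvZr, dotv_tr, =^~ scaleN1r) -?(dotvZl, dotvDl);
  congr dotv; rewrite ?scaleN1r; first [apply: H | apply: esym; apply: H];
  by rewrite // 1?nadj_sym 1?far_sym // eq_sym.

(* Transposition exchanges the e_i and the f_i and preserves the relations: each
   statement about the e_i yields one about the f_i. *)
Lemma Urel_tr e f k ki : Urel e f k ki ->
  Urel (fun i => tr_endo (f i)) (fun i => tr_endo (e i))
       (fun i => tr_endo (k i)) (fun i => tr_endo (ki i)).
Proof.
move=> U; split.
- by move=> *; dualize (kikP U).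
- by move=> *; dualize (kkiP U).
- by move=> *; dualize (kkP U).
- by move=> *; dualize (kf2P U).
- by move=> *; dualize (ke2P U).
- by move=> *; dualize (kfaP U).
- by move=> *; dualize (keaP U).
- by move=> *; dualize (kf0P U).
- by move=> *; dualize (ke0P U).
- by move=> *; dualize (ef1P U).
- by move=> *; dualize (ef0P U).
- by move=> *; dualize (ffP U).
- by move=> *; dualize (eeP U).
- move=> i j x im jm ij; rewrite [RHS]addrC; dualize (fffP U).
- move=> i j x im jm ij; rewrite [RHS]addrC; dualize (eeeP U).
Qed.

Lemma Lrel_tr e f k p l : Lrel e f k p l ->
  Lrel (fun i => tr_endo (f i)) (fun i => tr_endo (e i))
       (fun i => tr_endo (k i)) p (tr_endo l).
Proof.
move=> L; split.
- by move=> *; dualize (llP L).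
- by move=> *; dualize (lkP L).
- by move=> *; dualize (l_fP L).
- by move=> *; dualize (l_eP L).
- by move=> *; dualize (lflP L).
- by move=> *; dualize (lelP L).
- by move=> *; dualize (flfP L).
- by move=> *; dualize (eleP L).
Qed.

End Abstract.

(** * The recursion step from one projection to the next *)

Section Step.
Variables (F : fieldType) (v : F) (V : vectType F) (m : nat).
Hypotheses (v0 : v != 0) (v1 : v ^+ 2 - 1 != 0) (v2 : v ^+ 2 + 1 != 0).
Implicit Types (x : V).

Fact v_subV_neq0 : v - v^-1 != 0.
Proof.
rewrite subr_eq0; apply: contraNneq v1 => vE.
by rewrite subr_eq0 expr2 {1}vE mulVf.
Qed.

Lemma endoD (a : endo V) x y : a (x + y) = a x + a y. Proof. exact: linearD. Qed.
Lemma endoN (a : endo V) x : a (- x) = - a x. Proof. exact: linearN. Qed.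
Lemma endoZ (a : endo V) c x : a (c *: x) = c *: a x. Proof. exact: linearZ. Qed.
Lemma endo0 (a : endo V) : a 0 = 0. Proof. exact: linear0. Qed.
Definition zeroL (W : zmodType) := (@subr0 W, @addr0 W, @add0r W, @sub0r W, @oppr0 W).
Definition endoL := (endoD, endoN, endoZ, endo0).

(* b_i, [l_i, f_i], g_i and l_{i+1}. *)
Definition bet (e l : endo V) : endo V := e * l - l * e.
Definition del (l f : endo V) : endo V := l * f - f * l.
Definition gam (k l f : endo V) : endo V := v *: (k * del l f).
Definition nxt (e f k l : endo V) : endo V :=
  l + bet e l * gam k l f - gam k l f * bet e l.

Lemma betE e l x : bet e l x = e (l x) - l (e x).
Proof. by rewrite add_lfunE opp_lfunE !endoM. Qed.
Lemma delE l f x : del l f x = l (f x) - f (l x).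
Proof. by rewrite add_lfunE opp_lfunE !endoM. Qed.
Lemma gamE k l f x : gam k l f x = v *: k (del l f x).
Proof. by rewrite scale_lfunE endoM. Qed.
Lemma nxtE e f k l x : nxt e f k l x =
  l x + bet e l (gam k l f x) - gam k l f (bet e l x).
Proof. by rewrite add_lfunE opp_lfunE add_lfunE !endoM. Qed.

Lemma tr_bet (e l : endo V) : tr_endo (bet e l) = del (tr_endo l) (tr_endo e).
Proof. by rewrite tr_endoB !tr_endoM. Qed.
Lemma tr_del (l f : endo V) : tr_endo (del l f) = bet (tr_endo f) (tr_endo l).
Proof. by rewrite tr_endoB !tr_endoM. Qed.

Ltac lin_id := linear_identity F; field; rewrite -?expr2 ?v0 ?v1 ?v2 //.

Section Rank1.
Variables (e f k ki : nat -> endo V) (p : nat) (l : endo V).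
Hypotheses (U : Urel v m e f k ki) (L : Lrel v m e f k p l) (pm : (p < m)%N).

Local Notation b := (bet (e p) l).
Local Notation c := (del l (f p)).

(** Split [V] into the kernel and the image of [l]: by [lelP], [e p] preserves the kernel, and by
    [lflP], [f p] preserves the image. So [b] is the block of [e p] from the image to the kernel,
    and [c] the block of [f p] from the kernel to the image; [e p - b] and [f p - c] are the block
    diagonal parts. *)
Lemma l_bet x : l (b x) = 0.
Proof. by rewrite betE ?endoL (lelP L) // (llP L) subrr. Qed.
Lemma bet_l x : b (l x) = b x.
Proof. by rewrite !betE (llP L) (lelP L). Qed.
Lemma l_del x : l (c x) = c x.
Proof. by rewrite delE ?endoL (llP L) (lflP L). Qed.
Lemma del_l x : c (l x) = 0.
Proof. by rewrite !delE (lflP L) // (llP L) subrr. Qed.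
Lemma e_l x : e p (l x) = l (e p x) + b x.
Proof. by rewrite betE addrC subrK. Qed.

(** This is the cubic relation [eleP], regrouped after multiplication by [v]. *)
Lemma e_bet x : e p (b x) = v ^+ 2 *: b (e p x).
Proof.
rewrite !betE ?endoL; apply: (lincomb (c := - v) (eleP L x pm)).
lin_id.
Qed.

Lemma k_l i x : (i < m)%N -> k i (l x) = l (k i x).
Proof. by move=> im; rewrite (lkP L). Qed.
Lemma ki_l i x : (i < m)%N -> ki i (l x) = l (ki i x).
Proof.
by move=> im; rewrite -{1}(kkiP U x im) (lkP L) // (kikP U).
Qed.

Lemma k_bet x : k p (b x) = v ^+ 2 *: b (k p x).
Proof. by rewrite !betE ?endoL ?(ke2P U, k_l) // !endoZ scalerBr. Qed.

Lemma bet_ki x : b (ki p x) = v ^+ 2 *: ki p (b x).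
Proof.
by rewrite -{2}(kkiP U x pm) -endoZ -k_bet (kikP U).
Qed.

(** The last term is the component in the image of [l]. In the other component [e p] and [f p] may
    be exchanged, because their commutator is a combination of [k p] and [ki p] and commutes with
    [l]. *)
Lemma f_bet x : f p (b x) = b (f p (l x)) + l (f p (b x)).
Proof.
rewrite !betE ?endoL !(lflP L) // !(ef1P U) // ?endoL.
rewrite ?(k_l, ki_l) // ?(llP L).
lin_id.
Qed.

(* Comes from applying the q-commutation of [b] and [e p] to [f p (l x)]. *)
Lemma bet_f_bet x : b (f p (b x)) = v *: ki p (b x).
Proof.
have bfl y : b (f p (l y)) = f p (b y) - l (f p (b y)).
  by rewrite {1}f_bet addrK.
have be y : b (e p y) = v ^- 2 *: e p (b y).
  by rewrite e_bet scalerA mulVf ?scale1r // expf_neq0.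
have := be (f p (l x)).
rewrite (ef1P U) // bfl ?endoL e_l ?endoL.
rewrite bfl be !(ef1P U) // e_l (ef1P U) // ?endoL.
rewrite ?(k_l, ki_l) // ?l_bet ?endoL k_bet !bet_l bet_ki.
rewrite -ki_l // ?endoL !l_bet ?endoL ?(scaler0, zeroL) => H.
(* [H] determines [b (f p (b x))] up to the factor 1 + v^-2, which is invertible as v^2 + 1 is
   nonzero. *)
apply: (lincomb (c := (1 + v^-2)^-1) H).
lin_id.
Qed.

(** Rearranged, the diagonal part [e p - b] commutes with [c]. Its transpose [f_bet_del] says that
    [f p - c] commutes with [b]. *)
Lemma e_del x : e p (c x) = c (e p x) + b (c x) - c (b x).
Proof.
rewrite !(betE, delE) ?endoL !(lflP L) // !(lelP L) // ?(llP L).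
rewrite !(ef1P U) // ?endoL ?(k_l, ki_l) // ?(llP L) //.
lin_id.
Qed.

Lemma k_del x : c (k p x) = v ^+ 2 *: k p (c x).
Proof. by rewrite !delE (lkP L) // !(kf2P U) // ?endoL (lkP L) // scalerBr. Qed.
End Rank1.

Section Rank1Dual.
Variables (e f k ki : nat -> endo V) (p : nat) (l : endo V).
Hypotheses (U : Urel v m e f k ki) (L : Lrel v m e f k p l) (pm : (p < m)%N).

Local Notation b := (bet (e p) l).
Local Notation c := (del l (f p)).
Let U' := Urel_tr U.
Let L' := Lrel_tr L.

Lemma del_e_del x : c (e p (c x)) = v *: c (ki p x).
Proof.
apply: dotv_inj => y; have /(congr1 (fun z => dotv z x)) := bet_f_bet U' L' pm y.
by rewrite -tr_del dotvZl -!dotv_tr !tr_endoK -dotvZr.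
Qed.

Lemma f_bet_del x : b (f p x) = f p (b x) + b (c x) - c (b x).
Proof.
apply: dotv_inj => y; have /(congr1 (fun z => dotv z x)) := e_del U' L' pm y.
rewrite -tr_bet -tr_del -scaleN1r 2!dotvDl dotvZl -!dotv_tr !tr_endoK => ->.
by rewrite -[in RHS]scaleN1r !dotvDr dotvZr.
Qed.

End Rank1Dual.

(* v ^ a_{ij} *)
Definition awt i j : F := if i == j then v ^+ 2 else if nadj i j then v^-1 else 1.

Lemma awt_neq0 i j : awt i j != 0.
Proof. by rewrite /awt; do 2?case: ifP => _; rewrite ?expf_neq0 ?invr_eq0 ?oner_neq0. Qed.
Lemma awt_diag i : awt i i = v ^+ 2. Proof. by rewrite /awt eqxx. Qed.
Lemma awt_adj i j : nadj i j -> awt i j = v^-1.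
Proof. by rewrite /awt => ij; rewrite ij; case: eqP ij => // ->; rewrite /nadj; lia. Qed.
Lemma awt_far i j : far i j -> awt i j = 1.
Proof.
move=> ij; rewrite /awt; case: eqP ij => [->|_]; first by rewrite /far; lia.
by rewrite /far /nadj; case: ifP => //; lia.
Qed.

Section Rank1.
Variables (e f k ki : nat -> endo V) (p : nat) (l : endo V).
Hypotheses (U : Urel v m e f k ki) (L : Lrel v m e f k p l) (pm : (p < m)%N).

Local Notation b := (bet (e p) l).
Local Notation c := (del l (f p)).
Local Notation g := (gam (k p) l (f p)).
Local Notation n := (nxt (e p) (f p) (k p) l).

Lemma k_e i j x : (i < m)%N -> (j < m)%N ->
  k i (e j x) = awt i j *: e j (k i x).
Proof.
move=> im jm; have [<-|[ij _]|[ij _]] := index_cases i j.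
- by rewrite awt_diag (ke2P U).
- by rewrite awt_adj // (keaP U) // scalerA mulVf // scale1r.
- by rewrite awt_far // (ke0P U) // scale1r.
Qed.

Lemma k_f i j x : (i < m)%N -> (j < m)%N ->
  k i (f j x) = (awt i j)^-1 *: f j (k i x).
Proof.
move=> im jm; have [<-|[ij _]|[ij _]] := index_cases i j.
- by rewrite awt_diag (kf2P U) // scalerA mulVf ?expf_neq0 // scale1r.
- by rewrite awt_adj // invrK (kfaP U).
- by rewrite awt_far // (kf0P U) // invr1 scale1r.
Qed.

Lemma ki_k_switch i c a (s : endo V) : (i < m)%N -> a != 0 ->
  (forall x, k i (s x) = a *: s (k i x)) -> ki i (s c) = a^-1 *: s (ki i c).
Proof.
move=> im a0 H; rewrite -{1}(kkiP U c im).
have -> : s (k i (ki i c)) = a^-1 *: k i (s (ki i c)).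
  by rewrite H scalerA mulVf // scale1r.
by rewrite endoZ (kikP U).
Qed.

Lemma k_bet' i x : (i < m)%N -> k i (b x) = awt i p *: b (k i x).
Proof.
move=> im; rewrite !betE ?endoL !(k_e, k_l L, endoZ) //.
by rewrite scalerBr.
Qed.

Lemma k_del' i x : (i < m)%N -> k i (c x) = (awt i p)^-1 *: c (k i x).
Proof.
move=> im; rewrite !delE ?endoL !(k_f, k_l L, endoZ) //.
by rewrite scalerBr.
Qed.

Lemma k_gam i x : (i < m)%N -> k i (g x) = (awt i p)^-1 *: g (k i x).
Proof.
move=> im; rewrite !gamE endoZ (kkP U) // k_del' // endoZ.
by rewrite !scalerA mulrC.
Qed.

Lemma bet_k x : b (k p x) = v ^- 2 *: k p (b x).
Proof. by rewrite (k_bet U L) // scalerA mulVf ?scale1r // expf_neq0. Qed.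

Lemma bet_bet x : b (b x) = 0.
Proof. by rewrite -(bet_l L) // (l_bet L) // endo0. Qed.

Lemma bet_del_bet x : b (c (b x)) = v *: ki p (b x).
Proof.
by rewrite [c _]delE (l_bet L) // endo0 subr0 (bet_l L) // (bet_f_bet U L).
Qed.
Lemma del_bet_del x : c (b (c x)) = v *: c (ki p x).
Proof.
by rewrite [b _]betE (l_del L) // endoD endoN (del_l L) // subr0 (del_e_del U L).
Qed.

Lemma l_gam x : l (g x) = g x.
Proof. by rewrite !gamE endoZ (lkP L) // (l_del L). Qed.
Lemma gam_l x : g (l x) = 0.
Proof. by rewrite !gamE (del_l L) // endo0 scaler0. Qed.
Lemma gam_gam x : g (g x) = 0.
Proof. by rewrite -[g x]l_gam gam_l. Qed.

(** The factor [v *: k p] in [g] is chosen so that [b] and [g] become generalized inverses of each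
    other. Then g b and b g are idempotents, g b a summand of [l] and b g a summand of its
    complement, and [nxt] replaces the first by the second in [l]; this is why [n] is again
    idempotent. *)
Lemma bet_gam_bet x : b (g (b x)) = b x.
Proof.
rewrite gamE endoZ bet_k bet_del_bet endoZ (kkiP U) // !scalerA.
by rewrite -[RHS]scale1r; congr (_ *: _); field.
Qed.

Lemma gam_bet_gam x : g (b (g x)) = g x.
Proof.
rewrite !gamE !endoZ bet_k !endoZ (k_del U L) // !endoZ del_bet_del.
rewrite -[in RHS](kkiP U x pm) (k_del U L) // !endoZ !scalerA.
by congr (_ *: _); field.
Qed.

Lemma e_gam x : e p (g x) = v ^- 2 *: g (e p x) + b (g x) - v ^- 2 *: g (b x).
Proof.
rewrite !gamE !endoZ bet_k.
have -> : e p (k p (c x)) = v ^- 2 *: k p (e p (c x)).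
  by rewrite (ke2P U) // scalerA mulVf ?scale1r // expf_neq0.
rewrite (e_del U L) // ?endoL.
lin_id.
Qed.

Lemma nxt_bet x : n (b x) = b x.
Proof. by rewrite nxtE (l_bet L) // bet_bet endo0 bet_gam_bet add0r subr0. Qed.
Lemma bet_nxt x : b (n x) = 0.
Proof. by rewrite nxtE ?endoL (bet_l L) // bet_bet bet_gam_bet addr0 subrr. Qed.
Lemma nxt_gam x : n (g x) = 0.
Proof. by rewrite nxtE l_gam gam_gam endo0 gam_bet_gam addr0 subrr. Qed.
Lemma gam_nxt x : g (n x) = g x.
Proof. by rewrite nxtE ?endoL gam_l gam_bet_gam gam_gam add0r subr0. Qed.
Lemma l_nxt x : l (n x) = l x - g (b x).
Proof. by rewrite nxtE ?endoL (llP L) (l_bet L) // l_gam addr0. Qed.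
Lemma nxt_l x : n (l x) = l x - g (b x).
Proof. by rewrite nxtE (llP L) gam_l endo0 addr0 (bet_l L). Qed.
Lemma nxt_nxt x : n (n x) = n x.
Proof. by rewrite [LHS]nxtE l_nxt bet_nxt gam_nxt endo0 subr0 nxtE addrAC. Qed.

Lemma k_nxt i x : (i < m)%N -> k i (n x) = n (k i x).
Proof.
move=> im; rewrite !nxtE ?endoL -(lkP L) // !(k_bet', k_gam) //.
by rewrite !endoZ !scalerA mulVf ?mulfV ?awt_neq0 // !scale1r.
Qed.

(** As n b = b and b n = 0, this says that [e p - b] commutes with [n]. *)
Lemma e_nxt x : e p (n x) = n (e p x) - b x.
Proof.
rewrite !nxtE ?endoL (e_l e p l) (e_bet L) // !e_gam (e_bet L) // ?endoL.
rewrite !bet_bet !bet_gam_bet !endo0 ?(scaler0, zeroL).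
lin_id.
Qed.

End Rank1.

Section NextE.
Variables (e f k ki : nat -> endo V) (p : nat) (l : endo V).
Hypotheses (U : Urel v m e f k ki) (L : Lrel v m e f k p l) (pm : (p < m)%N).

Local Notation b := (bet (e p) l).
Local Notation c := (del l (f p)).
Local Notation g := (gam (k p) l (f p)).
Local Notation n := (nxt (e p) (f p) (k p) l).

(** Transposition moves [k p] to the other side of [g]. In [nxt] it only occurs in products of one
    [b] and one [c], and the powers of [v] for crossing these two cancel. *)
Lemma tr_nxt : tr_endo n =
  nxt (tr_endo (f p)) (tr_endo (e p)) (tr_endo (k p)) (tr_endo l).
Proof.
apply/lfunP => x; apply: dotv_inj => y.
rewrite dotv_tr !nxtE !gamE -!tr_del -!tr_bet ?endoL -!scaleN1r.
rewrite !(dotvDl, dotvZl, dotvDr, dotvZr, dotv_tr).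
rewrite !(bet_k U L) // ?endoZ !(k_del U L) // ?(endoZ, dotvZl).
by congr (_ + _ + _); field.
Qed.

Lemma e_del_comm j x : (p < j < m)%N -> e j (c x) = c (e j x).
Proof.
case/andP=> pj jm.
have ef y : e j (f p y) = f p (e j y) by rewrite (ef0P U) //; lia.
by rewrite !delE ?endoL ef -(l_eP L (f p x)) // ef (l_eP L x pj).
Qed.

Lemma e_gam_comm j x : (p < j < m)%N ->
  e j (g x) = (awt p j)^-1 *: g (e j x).
Proof.
move=> pjm; have /andP[pj jm] := pjm; rewrite !gamE !endoZ.
rewrite -e_del_comm // (k_e U) // !scalerA; congr (_ *: _).
by rewrite mulrCA mulVf ?mulr1 ?awt_neq0.
Qed.

Lemma e_bet_far j x : (p.+1 < j < m)%N -> e j (b x) = b (e j x).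
Proof.
case/andP=> pj jm; have pj' := ltnW pj.
have ee y : e j (e p y) = e p (e j y) by rewrite (eeP U) // /far; lia.
by rewrite !betE ?endoL ee -(l_eP L (e p x)) // ee (l_eP L x pj').
Qed.

Lemma f_bet_comm j x : (p < j < m)%N -> f j (b x) = b (f j x).
Proof.
case/andP=> pj jm.
have ef y : f j (e p y) = e p (f j y) by rewrite (ef0P U) //; lia.
by rewrite !betE ?endoL ef -(l_fP L (e p x)) // ef (l_fP L x pj).
Qed.

Lemma awt_up j : (p.+1 < j)%N -> awt p j = 1.
Proof. by move=> pj; rewrite awt_far // /far pj. Qed.

Lemma nxt_e j x : (p.+1 < j)%N -> (j < m)%N -> n (e j x) = e j (n x).
Proof.
move=> pj jm; have pjm : (p.+1 < j < m)%N by rewrite pj.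
have pjm' : (p < j < m)%N by lia.
rewrite !nxtE ?endoL (l_eP L) ?(ltnW pj) // e_gam_comm // !e_bet_far //.
by rewrite e_gam_comm // awt_up // invr1 !scale1r.
Qed.

Let q := p.+1.
Hypothesis qm : (q < m)%N.

Let pq : (p < q < m)%N. Proof. by rewrite /q leqnn. Qed.
Let apq : awt p q = v^-1.
Proof. by rewrite awt_adj // /nadj eqxx. Qed.

Lemma eq_gam x : e q (g x) = v *: g (e q x).
Proof. by rewrite e_gam_comm // apq invrK. Qed.
Lemma gam_eq x : g (e q x) = v^-1 *: e q (g x).
Proof. by rewrite eq_gam scalerA mulVf // scale1r. Qed.

Lemma l_eq x : l (e q x) = e q (l x).
Proof. by rewrite (l_eP L). Qed.

Lemma bet_e_bet x : b (e q (b x)) = 0.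
Proof. by rewrite -(bet_l L) // l_eq (l_bet L) // !endo0. Qed.

Lemma bet_e_l x : b (e q (l x)) = b (e q x).
Proof. by rewrite -l_eq (bet_l L). Qed.

(** The Serre relation is linear in [e p], and [e q] commutes with [l]; so taking the commutator of
    the relation with [l] replaces [e p] by [b]. *)
Lemma serre_bet x :
  (v + v^-1) *: e q (b (e q x)) = e q (e q (b x)) + b (e q (e q x)).
Proof.
have qp : nadj q p by rewrite /nadj /q eqxx orbT.
have := congr1 l (eeeP U x qm pm qp); rewrite ?endoL !l_eq => Hl.
rewrite !betE ?endoL !l_eq.
apply: (lincomb (c := 1) (eeeP U (l x) qm pm qp)).
apply: (lincomb (c := -1) Hl).
lin_id.
Qed.

Lemma nxt_e_nxt x : n (e q (n x)) = n (e q x).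
Proof.
rewrite [LHS]nxtE [RHS]nxtE !l_eq (l_nxt L) // ?endoL.
rewrite [g (e q (n x))]gam_eq (gam_nxt U L) // -gam_eq.
rewrite [b (e q (n x))](_ : _ = b (e q x) - v *: b (g (e q (b x)))); last first.
  by rewrite nxtE ?endoL bet_e_l bet_e_bet eq_gam ?endoL addr0.
rewrite ?endoL (gam_bet_gam U L) // eq_gam.
lin_id.
Qed.

(** The summand [l] of [n] commutes with [e q] and is harmless. For the products of [b] and [g],
    moving [e q] across [g] reduces the claim to [serre_bet], applied before [g] in one product and
    after it in the other; the power of [v] picked up on the way turns the symmetric Serre relation
    into the asymmetric mirabolic one. *)
Lemma ele_nxt x : (v + v^-1) *: e q (n (e q x)) =
  v^-1 *: e q (e q (n x)) + v *: n (e q (e q x)).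
Proof.
rewrite !nxtE ?endoL !l_eq !gam_eq ?endoL.
rewrite !(eq_gam (b _)) ?endoL !(eq_gam (e q (b _))).
have := congr1 g (serre_bet x); rewrite ?endoL => Hg.
apply: (lincomb (c := v^-1) (serre_bet (g x))).
apply: (lincomb (c := - v) Hg).
lin_id.
Qed.
End NextE.

Lemma Lrel_nxt (e f k ki : nat -> endo V) (p : nat) (l : endo V) :
    Urel v m e f k ki -> Lrel v m e f k p l -> (p < m)%N ->
  Lrel v m e f k p.+1 (nxt (e p) (f p) (k p) l).
Proof.
move=> U L pm; have U' := Urel_tr U; have L' := Lrel_tr L.
have tn := tr_nxt U L pm.
split.
- exact: nxt_nxt U L pm.
- by move=> i x im; rewrite (k_nxt U L).
- by move=> i x pi im; rewrite (nxt_e U L).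
- move=> i x pi im; apply: dotv_inj => y.
  have := nxt_e U' L' pm y pi im; rewrite -tn => /(congr1 (fun z => dotv z x)).
  by rewrite -!dotv_tr !tr_endoK.
- by move=> x qm; rewrite (nxt_e_nxt U L).
- move=> x qm; apply: dotv_inj => y.
  have := nxt_e_nxt U' L' pm qm y; rewrite -tn => /(congr1 (fun z => dotv z x)).
  by rewrite -!dotv_tr !tr_endoK.
- by move=> x qm; rewrite (ele_nxt U L).
- move=> x qm; apply: dotv_inj => y.
  have := ele_nxt U' L' pm qm y; rewrite -tn => /(congr1 (fun z => dotv z x)).
  by rewrite !(dotvDl, dotvZl) -!dotv_tr !tr_endoK !(dotvDr, dotvZr).
Qed.

(** * Two neighbouring indices *)

Section Rank2.
Variables (e f k ki : nat -> endo V) (p : nat) (l : endo V).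
Hypotheses (U : Urel v m e f k ki) (L : Lrel v m e f k p l).
Local Notation q := p.+1.
Hypothesis qm : (q < m)%N.
Let pm : (p < m)%N := ltnW qm.

Local Notation b := (bet (e p) l).
Local Notation g := (gam (k p) l (f p)).
Local Notation n := (nxt (e p) (f p) (k p) l).
Local Notation b' := (bet (e q) n).
Local Notation c' := (del n (f q)).
Local Notation g' := (gam (k q) n (f q)).
Local Notation n' := (nxt (e q) (f q) (k q) n).
Let L' : Lrel v m e f k q n := Lrel_nxt U L pm.
Let pq : (p < q < m)%N. Proof. by rewrite leqnn. Qed.

Lemma bet_bet_next x : b (b' x) = b (e q x) - v *: b (g (e q (b x))).
Proof.
rewrite [b' x]betE ?endoL (bet_nxt U L) // subr0 nxtE ?endoL (bet_e_l L) //.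
by rewrite (bet_e_bet L) // (eq_gam U L) // ?endoL addr0.
Qed.

Lemma bet_next_bet x : b' (b x) = e q (b x) - b (g (e q (b x))).
Proof.
rewrite betE (nxt_bet U L) // nxtE (l_eq L) // (l_bet L) // (bet_e_bet L) // !endo0.
by rewrite add0r subr0.
Qed.

Lemma eq_bet x : e q (b x) = b' (b x) + v^-1 *: b (e q x) - v^-1 *: b (b' x).
Proof. rewrite bet_bet_next bet_next_bet; lin_id. Qed.

(* [t] q-commutes with [e p], and [b'] is a q-commutator of [t] with [g]; this is
   how [b'] is related to [e p]. *)
Local Notation t := (e q * b - v^-1 *: (b * e q)).

Lemma tE x : t x = e q (b x) - v^-1 *: b (e q x).
Proof. by rewrite add_lfunE opp_lfunE scale_lfunE !endoM. Qed.

Lemma t_bet x : t (b x) = 0.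
Proof. by rewrite tE (bet_bet L) // (bet_e_bet L) // endo0 scaler0 subr0. Qed.

Lemma bet_t x : b (t x) = 0.
Proof. by rewrite tE ?endoL (bet_bet L) // (bet_e_bet L) // scaler0 subr0. Qed.

Lemma bet_next_t x : b' x = t (g x) - v *: g (t x).
Proof.
rewrite betE !nxtE !tE ?endoL (l_eq L) // !(gam_eq U L) // !(eq_gam U L) // ?endoL.
lin_id.
Qed.

Lemma ep_t x : e p (t x) = v *: t (e p x).
Proof.
have pq' : nadj p q by rewrite /nadj eqxx.
have Hs := congr1 l (eeeP U x pm qm pq').
have He := congr1 (e q) (eleP L x pm).
rewrite ?endoL in Hs He.
have be : b (e p x) = v ^- 2 *: e p (b x).
  by rewrite (e_bet L) // scalerA mulVf ?scale1r // expf_neq0.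
rewrite !tE ?endoL be (e_bet L) //.
rewrite !betE ?endoL !(l_eq L) // in Hs He *.
(* Only words with two [e p], one [e q] and one [l] occur. Since [l] commutes with [e q], the
   relations among them are the Serre relation with [l] on either side and the mirabolic relation
   with [e q] on either side; the coefficients solve the resulting linear system. *)
apply: (lincomb (c := (v + v^-1)^-1) (eeeP U (l x) pm qm pq')).
apply: (lincomb (c := - (v + v^-1)^-1) Hs).
apply: (lincomb (c := - v / (v + v^-1)) (eleP L (e q x) pm)).
apply: (lincomb (c := v^-1 / (v + v^-1)) He).
rewrite ?(l_eq L) //.
lin_id.
Qed.

Lemma ep_bet_next x :
  e p (b' x) = v^-1 *: b' (e p x) + b (b' x) - v^-1 *: b' (b x).
Proof.
rewrite !bet_next_t ?endoL.
rewrite ?(ep_t, e_gam U L, endoL) // ?(t_bet, bet_t) ?(endo0, scaler0, zeroL).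
lin_id.
Qed.

Lemma ep_gam_next x : e p (g' x) = v *: g' (e p x).
Proof.
have qp : nadj q p by rewrite /nadj eqxx orbT.
rewrite !gamE ?endoL (keaP U) // !delE ?endoL (e_nxt U L) //.
rewrite !(ef0P U) ?(e_nxt U L) ?endoL ?(f_bet_comm U L) //; [|by lia..].
lin_id.
Qed.

Lemma bet_gam_next x : b (g' x) = 0.
Proof. by rewrite -[g' x](l_gam L') // (bet_nxt U L). Qed.

Lemma gam_next_bet x : g' (b x) = 0.
Proof.
rewrite gamE delE (nxt_bet U L) // !(f_bet_comm U L) // (nxt_bet U L) //.
by rewrite subrr endo0 scaler0.
Qed.

Lemma bet_next_gam x : b' (g x) = 0.
Proof. by rewrite -(bet_l L') // (nxt_gam U L) // endo0. Qed.

Lemma gam_bet_next x : g (b' x) = 0.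
Proof. by rewrite -(gam_nxt U L) // (l_bet L') // endo0. Qed.

(* The interaction of [e q] and [f q] with [b] gives [b] in terms of [b'], [g'];
   it is what makes l_{p+2} commute with [e p]. *)
Lemma bet_split x : b x = g' (b' (b x)) + b (b' (g' x)).
Proof.
have qp : nadj q p by rewrite /nadj eqxx orbT.
have kb y : k q (b y) = v^-1 *: b (k q y) by rewrite (k_bet' U L) // awt_adj.
have kib y : ki q (b y) = v *: b (ki q y).
  by rewrite (ki_k_switch U y qm _ kb) ?invrK // invr_eq0.
(* Comparing [eq_bet] at [f q x] with [f q] applied to [eq_bet] at [x] leaves only terms in [k q],
   [ki q] and products of [b], [b'], [c']. Applying [k q] at the end turns [c'] into [g']. *)
have := eq_bet (f q x).
rewrite -(f_bet_comm U L) // (ef1P U) // eq_bet !(f_bet_del U L') //.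
have cb y : c' (b y) = 0.
  by rewrite delE (nxt_bet U L) // !(f_bet_comm U L) // (nxt_bet U L) // subrr.
have bc y : b (c' y) = 0 by rewrite -(l_del L') // (bet_nxt U L).
rewrite (ef1P U) // ?endoL !(f_bet_comm U L) // cb ?endoL bc kib.
rewrite [k q (b x)]kb ?(scaler0, endo0, zeroL) => H.
have K : b (ki q x) = c' (b' (b x)) + v^-1 *: b (b' (c' x)).
  apply: (lincomb (c := - 1) H).
  lin_id.
have := congr1 (k q) K.
rewrite kb (kkiP U) // endoD endoZ kb => K'.
rewrite (k_bet U L') // endoZ in K'.
rewrite !gamE ?endoL; apply: (lincomb (c := v) K').
lin_id.
Qed.

(** Moving [e p] across the three summands of [n'] leaves the errors -b, b b' g' and g' b' b, whose
    sum is zero by [bet_split]. *)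
Lemma ep_nxt2 x : e p (n' x) = n' (e p x).
Proof.
rewrite [n' x]nxtE [n' (e p x)]nxtE ?endoL (e_nxt U L) //.
rewrite ?(ep_bet_next, ep_gam_next, endoL) bet_gam_next gam_next_bet {1}bet_split.
rewrite ?(endo0, scaler0, zeroL).
lin_id.
Qed.
End Rank2.
End Step.

Section Commutation.
Variables (F : fieldType) (v : F) (V : vectType F).
Implicit Types s e f k l : endo V.

Definition comm s e := forall x, s (e x) = e (s x).

Lemma comm_sym s e : comm s e -> comm e s.
Proof. by move=> h x; rewrite h. Qed.
Lemma comm_bet s e l : comm s e -> comm s l -> comm s (bet e l).
Proof. by move=> se sl x; rewrite !betE ?endoL !(se, sl). Qed.
Lemma comm_del s l f : comm s l -> comm s f -> comm s (del l f).
Proof. by move=> sl sf x; rewrite !delE ?endoL !(sf, sl). Qed.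
Lemma comm_gam s k l f : comm s k -> comm s l -> comm s f -> comm s (gam v k l f).
Proof. by move=> sk sl sf x; rewrite !gamE ?endoL sk (comm_del sl sf). Qed.
Lemma comm_nxt s e f k l : comm s e -> comm s f -> comm s k -> comm s l ->
  comm s (nxt v e f k l).
Proof.
move=> se sf sk sl x; rewrite !nxtE ?endoL sl.
by rewrite !(comm_bet se sl, comm_gam sk sl sf).
Qed.

End Commutation.

(** * The commuting projections *)

Section Sequence.
Variables (F : fieldType) (v : F) (V : vectType F) (m : nat).
Hypotheses (v0 : v != 0) (v1 : v ^+ 2 - 1 != 0) (v2 : v ^+ 2 + 1 != 0).
Implicit Types (x : V).
Ltac lin_id := linear_identity F; field; rewrite -?expr2 ?v0 ?v1 ?v2 //.

Fixpoint ell (e f k : nat -> endo V) (l : endo V) (i : nat) : endo V :=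
  if i is j.+1 then nxt v (e j) (f j) (k j) (ell e f k l j) else l.

Section E.
Variables (e f k ki : nat -> endo V) (l : endo V).
Hypotheses (U : Urel v m e f k ki) (L : Lrel v m e f k 0 l).

Local Notation l_ := (ell e f k l).
Local Notation b i := (bet (e i) (l_ i)).

Lemma Lrel_ell i : (i <= m)%N -> Lrel v m e f k i (l_ i).
Proof. by elim: i => //= i IH im; apply: (Lrel_nxt v0 v1 v2 U) => //; apply/IH/ltnW. Qed.

Lemma tr_ell i : (i <= m)%N -> tr_endo (l_ i) =
  ell (fun i => tr_endo (f i)) (fun i => tr_endo (e i)) (fun i => tr_endo (k i))
    (tr_endo l) i.
Proof.
elim: i => //= i IH im; rewrite -IH ?(ltnW im) //.
by apply: (tr_nxt v0 U) => //; apply: Lrel_ell; apply: ltnW.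
Qed.

(** The first case, [i = j.+2], is the rank two statement [ep_nxt2]; from there on every generator
    entering [nxt] has an index far from [j]. *)
Lemma e_ell_low i j : (j.+1 < i)%N -> (i <= m)%N -> comm (e j) (l_ i).
Proof.
elim: i => //= i IH; rewrite ltnS leq_eqVlt => /predU1P[<-|ji] im x.
  by rewrite (ep_nxt2 v0 v1 v2 U) //; apply: Lrel_ell; lia.
have fij : far j i by rewrite /far ji.
apply: comm_nxt => // y.
- by rewrite (eeP U) //; lia.
- by rewrite (ef0P U) //; lia.
- by rewrite (ke0P U) // 1?far_sym //; lia.
- by apply: IH => //; lia.
Qed.

Lemma e_ell_high i j : (i < j)%N -> (j < m)%N -> comm (e j) (l_ i).
Proof. by move=> ij jm x; rewrite (l_eP (Lrel_ell _)) //; lia. Qed.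

Lemma f_ell_high i j : (i < j)%N -> (j < m)%N -> comm (f j) (l_ i).
Proof. by move=> ij jm x; rewrite (l_fP (Lrel_ell _)) //; lia. Qed.

Lemma k_ell i j : (i <= m)%N -> (j < m)%N -> comm (k j) (l_ i).
Proof. by move=> im jm x; rewrite (lkP (Lrel_ell im)). Qed.

Lemma ell_lt i j : (i < j)%N -> (j <= m)%N -> comm (l_ i) (l_ j).
Proof.
elim: j => //= j IH; rewrite ltnS leq_eqVlt => /predU1P[->|ij] jm x.
  by rewrite (l_nxt (Lrel_ell _)) ?(nxt_l (Lrel_ell _)) //; lia.
apply: comm_nxt => //.
- by apply/comm_sym/e_ell_high.
- by apply/comm_sym/f_ell_high.
- by apply/comm_sym/k_ell => //; lia.
- by apply: IH => //; lia.
Qed.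

Lemma ell_comm i j : (i <= m)%N -> (j <= m)%N -> comm (l_ i) (l_ j).
Proof.
move=> im jm; have [ij|ij|->//] := ltngtP i j; first exact: ell_lt.
by apply/comm_sym/ell_lt.
Qed.

Lemma e_ell i j : (i <= m)%N -> (j < m)%N -> i != j -> i != j.+1 -> comm (e j) (l_ i).
Proof.
move=> im jm ij ij1; have [h|h] := ltnP i j; first exact: e_ell_high.
by apply: e_ell_low => //; lia.
Qed.

Lemma bet_ell i j : (i <= m)%N -> (j < m)%N -> i != j -> i != j.+1 -> comm (b j) (l_ i).
Proof.
move=> im jm ij ij1; apply/comm_sym/comm_bet; first by apply/comm_sym/e_ell.
by apply: ell_comm => //; lia.
Qed.

Lemma bet_far i j : (i < m)%N -> (j < m)%N -> far i j -> comm (e j) (b i).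
Proof.
move=> im jm ij; apply: comm_bet; first by move=> x; rewrite (eeP U) // far_sym.
by apply: e_ell => //; rewrite /far in ij; lia.
Qed.

Lemma bet_bet_far i j : (i < m)%N -> (j < m)%N -> far i j -> comm (b j) (b i).
Proof.
move=> im jm ij; apply/comm_sym/comm_bet; first by apply/comm_sym/bet_far.
by apply: bet_ell => //; rewrite /far in ij; lia.
Qed.

Local Notation E j := (e j - b j).

Lemma EE j x : E j x = e j x - b j x.
Proof. by rewrite add_lfunE opp_lfunE. Qed.

(** At [i = j] this holds because [E j] is block diagonal for [l_ j], and at [i = j.+1] it is
    [e_nxt]; for all other [i], [e j] and [b j] commute with [l_ i] separately. *)
Lemma E_ell i j : (i <= m)%N -> (j < m)%N -> comm (E j) (l_ i).
Proof.
move=> im jm x; rewrite !EE ?endoL; have [ij|ij] := eqVneq i j.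
  have Lj := Lrel_ell (ltnW jm).
  by rewrite ij (e_l e j) (bet_l Lj) // (l_bet Lj) // addrK subr0.
have [ij1|ij1] := eqVneq i j.+1; last by rewrite e_ell // bet_ell.
have Lj := Lrel_ell (ltnW jm).
rewrite ij1 /= (e_nxt v0 v1 v2 U Lj) // (bet_nxt v0 v1 v2 U Lj) // (nxt_bet v0 v1 v2 U Lj) //.
by rewrite subr0.
Qed.

Lemma E_bet i j x : (i < m)%N -> (j < m)%N ->
  E j (b i x) = awt v i j *: b i (E j x).
Proof.
move=> im jm; rewrite !EE ?endoL; have [<-|[ij _]|[ij _]] := index_cases i j.
- have Li := Lrel_ell (ltnW im).
  by rewrite (e_bet v0 Li) // (bet_bet Li) // !subr0 awt_diag.
- rewrite (awt_adj v0 v1 v2) //; case/orP: ij => /eqP ij; rewrite -?ij in im jm *.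
    have Li := Lrel_ell (ltnW im).
    by rewrite (eq_bet v0 v1 v2 U Li) //=; lin_id.
  have Lj := Lrel_ell (ltnW jm).
  by rewrite (ep_bet_next v0 v1 v2 U Lj) //=; lin_id.
- by rewrite (awt_far v0 v1 v2) // scale1r bet_far // bet_bet_far.
Qed.

End E.

Section EF.
Variables (e f k ki : nat -> endo V) (l : endo V).
Hypotheses (U : Urel v m e f k ki) (L : Lrel v m e f k 0 l).

Local Notation l_ := (ell e f k l).
Local Notation b i := (bet (e i) (l_ i)).
Local Notation g i := (gam v (k i) (l_ i) (f i)).
Let U' := Urel_tr U.
Let L' := Lrel_tr L.
Let tl i := tr_ell U L (i := i).

Lemma f_ell i j : (i <= m)%N -> (j < m)%N -> i != j -> i != j.+1 -> comm (f j) (l_ i).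
Proof.
move=> im jm ij ij1 x; apply: dotv_inj => y.
have := e_ell U' L' im jm ij ij1 y; rewrite -tl // => /(congr1 (fun z => dotv z x)).
by rewrite -!dotv_tr !tr_endoK.
Qed.

Lemma gam_ell i j : (i <= m)%N -> (j < m)%N -> i != j -> i != j.+1 -> comm (g j) (l_ i).
Proof.
move=> im jm ij ij1; apply/comm_sym/comm_gam; first by apply/comm_sym/(k_ell U L).
  by apply: (ell_comm U L) => //; lia.
exact/comm_sym/f_ell.
Qed.

Lemma e_gam_far i j : (i < m)%N -> (j < m)%N -> far i j -> comm (e j) (g i).
Proof.
move=> im jm ij; apply: comm_gam; first by move=> y; rewrite (ke0P U).
  by apply: (e_ell U L) => //; rewrite /far in ij; lia.
by move=> y; rewrite (ef0P U) //; rewrite /far in ij; lia.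
Qed.

Lemma bet_gam_far i j : (i < m)%N -> (j < m)%N -> far i j -> comm (b j) (g i).
Proof.
move=> im jm ij; apply/comm_sym/comm_bet; first exact/comm_sym/e_gam_far.
by apply: gam_ell => //; rewrite /far in ij; lia.
Qed.

Lemma gam_gam_far i j : (i < m)%N -> (j < m)%N -> far i j -> comm (g j) (g i).
Proof.
move=> im jm ij.
have hij := ij; rewrite /far in hij.
apply: comm_gam.
- apply/comm_sym/comm_gam.
  + by move=> y; rewrite (kkP U).
  + by apply: (k_ell U L) => //; lia.
  + by move=> y; rewrite (kf0P U).
- by apply: gam_ell => //; lia.
- apply/comm_sym/comm_gam.
  + by move=> y; rewrite (kf0P U) // far_sym.
  + by apply: f_ell => //; lia.
  + by move=> y; rewrite (ffP U).
Qed.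

Local Notation E j := (e j - b j).

Lemma E_gam i j x : (i < m)%N -> (j < m)%N ->
  E j (g i x) = (awt v i j)^-1 *: g i (E j x).
Proof.
move=> im jm; rewrite !EE ?endoL; have [<-|[ij _]|[ij ji]] := index_cases i j.
- have Li := Lrel_ell U L (ltnW im).
  by rewrite (e_gam v0 U Li) // awt_diag; lin_id.
- rewrite (awt_adj v0 v1 v2) // invrK; case/orP: ij => /eqP ij; rewrite -?ij in im jm *.
    have Li := Lrel_ell U L (ltnW im).
    rewrite (eq_gam v0 v1 v2 U Li) // (bet_next_gam v0 v1 v2 U Li) //.
    by rewrite (gam_bet_next v0 v1 v2 U Li) // !subr0.
  have Lj := Lrel_ell U L (ltnW jm).
  rewrite (ep_gam_next v0 v1 v2 U Lj) // (bet_gam_next v0 v1 v2 U Lj) //.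
  by rewrite (gam_next_bet v0 v1 v2 U Lj) // !subr0.
- by rewrite (awt_far v0 v1 v2) // invr1 scale1r e_gam_far // bet_gam_far.
Qed.
End EF.

Section DualF.
Variables (e f k ki : nat -> endo V) (l : endo V).
Hypotheses (U : Urel v m e f k ki) (L : Lrel v m e f k 0 l).

Local Notation l_ := (ell e f k l).
Local Notation b i := (bet (e i) (l_ i)).
Local Notation c i := (del (l_ i) (f i)).
Local Notation g i := (gam v (k i) (l_ i) (f i)).
Let U' := Urel_tr U.
Let L' := Lrel_tr L.
Local Notation Fh j := (f j - c j).

Let tl i : (i <= m)%N ->
  ell (fun i => tr_endo (f i)) (fun i => tr_endo (e i)) (fun i => tr_endo (k i))
    (tr_endo l) i = tr_endo (l_ i).
Proof. by move=> im; rewrite (tr_ell U L). Qed.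
Let tE j : (j < m)%N ->
  tr_endo (f j) - bet (tr_endo (f j)) (tr_endo (l_ j)) = tr_endo (Fh j).
Proof. by move=> jm; rewrite tr_endoB tr_del. Qed.

Lemma FE j x : Fh j x = f j x - c j x.
Proof. by rewrite add_lfunE opp_lfunE. Qed.

Lemma F_ell i j : (i <= m)%N -> (j < m)%N -> comm (Fh j) (l_ i).
Proof.
move=> im jm x; apply: dotv_inj => y.
have := E_ell U' L' im jm y; rewrite !tl ?(ltnW jm) // tE // => /(congr1 (fun z => dotv z x)).
by rewrite -!dotv_tr !tr_endoK.
Qed.

Lemma del_F i j x : (i < m)%N -> (j < m)%N ->
  c i (Fh j x) = awt v i j *: Fh j (c i x).
Proof.
move=> im jm; apply: dotv_inj => y.
have := E_bet U' L' y im jm; rewrite !tl ?(ltnW im) ?(ltnW jm) // tE //.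
rewrite -tr_del => /(congr1 (fun z => dotv z x)).
by rewrite dotvZl -!dotv_tr !tr_endoK dotvZr.
Qed.

Lemma k_F i j x : (i < m)%N -> (j < m)%N ->
  k i (Fh j x) = (awt v i j)^-1 *: Fh j (k i x).
Proof.
move=> im jm; rewrite !FE ?endoL.
rewrite (k_f v0 v1 v2 U) // (k_del' v0 v1 v2 U (Lrel_ell U L (ltnW jm))) //.
lin_id.
Qed.

Lemma F_gam i j : (i < m)%N -> (j < m)%N -> comm (Fh j) (g i).
Proof.
move=> im jm x; rewrite !gamE ?endoL del_F // endoZ k_F //.
by rewrite !scalerA mulfK ?awt_neq0.
Qed.

Lemma F_bet i j : (i < m)%N -> (j < m)%N -> comm (Fh j) (b i).
Proof.
move=> im jm x; apply: dotv_inj => y.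
have := E_gam U' L' y im jm; rewrite !tl ?(ltnW im) ?(ltnW jm) // tE //.
(* The transpose of the dual [g i] is [b i] preceded by [k i]; pairing with [ki i x] removes this
   [k i]. *)
rewrite !gamE -tr_bet => /(congr1 (fun z => dotv z (ki i x))).
rewrite ?endoL !dotvZl -!dotv_tr !tr_endoK k_F // (kkiP U) // endoZ dotvZr.
have va0 : v * (awt v i j)^-1 != 0 by rewrite mulf_neq0 ?invr_eq0 ?awt_neq0.
by rewrite mulrA [in RHS]mulrA [(_ ^-1) * v in RHS]mulrC => /(mulfI va0).
Qed.
End DualF.
End Sequence.

(** * Joint eigenvectors of the projections, and depth *)

Section Vectors.
Variables (F : fieldType) (v : F) (V : vectType F) (m : nat).
Hypotheses (v0 : v != 0) (v1 : v ^+ 2 - 1 != 0) (v2 : v ^+ 2 + 1 != 0).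
Variables (e f k ki : nat -> endo V) (l : endo V).
Hypotheses (U : Urel v m e f k ki) (L : Lrel v m e f k 0 l).

Local Notation l_ := (ell v e f k l).
Local Notation b i := (bet (e i) (l_ i)).
Local Notation g i := (gam v (k i) (l_ i) (f i)).
Let Li i (im : (i < m)%N) : Lrel v m e f k i (l_ i) :=
  Lrel_ell v0 v1 v2 U L (ltnW im).

Lemma bet_vanish0 i y : (i < m)%N -> l_ i y = 0 -> b i y = 0.
Proof. by move=> im y0; rewrite -(bet_l (Li im)) // y0 endo0. Qed.

Lemma gam_vanish1 i y : (i < m)%N -> l_ i y = y -> g i y = 0.
Proof. by move=> im y1; rewrite -y1 (gam_l (Li im)). Qed.

Lemma bet_gamK i y : (i < m)%N -> l_ i y = 0 -> l_ i.+1 y = y ->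
  b i (g i y) = y.
Proof.
move=> im y0 y1; rewrite -[RHS]y1 /= nxtE y0 (bet_vanish0 im y0) endo0.
by rewrite add0r subr0.
Qed.

Lemma gam_betK i y : (i < m)%N -> l_ i y = y -> l_ i.+1 y = 0 ->
  g i (b i y) = y.
Proof.
move=> im y1 /=; rewrite nxtE y1 (gam_vanish1 im y1) endo0 addr0.
by move/eqP; rewrite subr_eq0 => /eqP.
Qed.

Lemma bet_vanish1 i y : (i < m)%N -> l_ i y = y -> l_ i.+1 y = y -> b i y = 0.
Proof.
move=> im y1 /= /esym/eqP; rewrite nxtE y1 (gam_vanish1 im y1) endo0 addr0.
rewrite -subr_eq0 opprD addNKr opprK => /eqP gb.
by rewrite -(bet_gam_bet v0 v1 v2 U (Li im)) // gb endo0.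
Qed.

Lemma gam_vanish0 i y : (i < m)%N -> l_ i y = 0 -> l_ i.+1 y = 0 -> g i y = 0.
Proof.
move=> im y0 /=; rewrite nxtE y0 (bet_vanish0 im y0) endo0 add0r subr0 => bg.
by rewrite -(gam_bet_gam v0 v1 v2 U (Li im)) // bg endo0.
Qed.

(* f_p (f_{p+1} (... (f_{p+j-1} x))) *)
Fixpoint fword p j x := if j is j'.+1 then f p (fword p.+1 j' x) else x.

Lemma l_fword p q j x : (p < q)%N -> (q + j <= m)%N -> l_ p (fword q j x) = fword q j (l_ p x).
Proof.
elim: j q => //= j IH q pq qjm; have qm : (q < m)%N by lia.
have pm := ltn_trans pq qm.
rewrite (l_fP (Li pm)) // IH //; lia.
Qed.

Lemma fword0 p j : fword p j 0 = 0.
Proof. by elim: j p => //= j IH p; rewrite IH endo0. Qed.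

(** On the kernel of [l_ p], the operator [l_ p.+1] acts as b g, while [l_ p (f p w)] is [g p w] up
    to an invertible operator. As g b g = g, one of the two vanishes exactly when the other does. *)
Lemma l_f_next p w : (p < m)%N -> l_ p w = 0 -> l_ p (f p w) = 0 <-> l_ p.+1 w = 0.
Proof.
move=> pm w0; have dE : del (l_ p) (f p) w = l_ p (f p w).
  by rewrite delE w0 endo0 subr0.
split=> [lf|/(gam_vanish0 pm w0)].
  by rewrite /= nxtE w0 (bet_vanish0 pm w0) gamE dE lf !(endo0, scaler0, addr0, subr0).
rewrite gamE dE => /eqP; rewrite scaler_eq0 (negPf v0) /= => /eqP H.
by rewrite -[LHS](kikP U _ pm) H endo0.
Qed.

(** Stripping the outermost letter [f p] trades [l_ p] for [l_ p.+1] by [l_f_next], whose hypothesis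
    holds since the rest of the word has indices above [p] and commutes with [l_ p]. *)
Lemma depthP t p x : (p + t <= m.+1)%N ->
  (forall j, (j < t)%N -> l_ p (fword p j x) = 0) <->
  (forall i, (i < t)%N -> l_ (p + i) x = 0).
Proof.
elim: t p => [|t IH] p ptm; first by split.
have key : l_ p x = 0 -> forall j, (j < t)%N ->
    l_ p (fword p j.+1 x) = 0 <-> l_ p.+1 (fword p.+1 j x) = 0.
  move=> x0 j jt; apply: l_f_next; first by lia.
  by rewrite l_fword ?x0 ?fword0 //; lia.
split=> H.
  have x0 : l_ p x = 0 by exact: (H 0%N).
  have /IH H' : forall j, (j < t)%N -> l_ p.+1 (fword p.+1 j x) = 0.
    by move=> j jt; apply/(key x0 j jt)/H.
  by case=> [|i] it; [rewrite addn0|rewrite addnS -addSn; apply: H' => //; lia].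
have x0 : l_ p x = 0 by rewrite -[p]addn0; apply: H.
case=> [//|j] jt; apply/(key x0) => //.
have ptm' : (p.+1 + t <= m.+1)%N by lia.
have [_ H2] := IH p.+1 ptm'; apply: H2 => //.
by move=> i it; rewrite addSn -addnS; apply: H.
Qed.

End Vectors.

Section Convert.
Variables (F : fieldType) (v : F) (n : nat) (V : vectType F) (v0 : v != 0).

(** The value 0 outside the range is a mere default: the relations are only asserted for indices
    below [n.-1]. *)
Definition fam (a : 'I_n.-1 -> endo V) (i : nat) : endo V :=
  if insub i is Some o then a o else 0.

Lemma famE a (i : 'I_n.-1) : fam a i = a i.
Proof. by rewrite /fam valK. Qed.

Variables (e f k ki : 'I_n.-1 -> endo V) (l : endo V).
Hypothesis h : MU_relations v e f k ki l.

Lemma Urel_of : Urel v n.-1 (fam e) (fam f) (fam k) (fam ki).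
Proof.
have app (a b : endo V) x : a = b -> a x = b x by move->.
have o2 (P : nat -> nat -> V -> Prop) : (forall (i j : 'I_n.-1) x, P i j x) ->
    forall i j x, (i < n.-1)%N -> (j < n.-1)%N -> P i j x.
  by move=> H i j x im jm; apply: (H (Ordinal im) (Ordinal jm)).
have o1 (P : nat -> V -> Prop) : (forall (i : 'I_n.-1) x, P i x) ->
    forall i x, (i < n.-1)%N -> P i x.
  by move=> H i x im; apply: (H (Ordinal im)).
have ke i j x : k i (e j x) = v ^ cartan i j *: e j (k i x).
  by rewrite -!endoM (rel_kMe h) scale_lfunE.
have kf i j x : k i (f j x) = v ^ (- cartan i j) *: f j (k i x).
  by rewrite -!endoM (rel_kMf h) scale_lfunE.
have farE (i j : 'I_n.-1) : far i j -> i != j /\ ~~ adj i j.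
  by rewrite /far /adj -val_eqE /=; lia.
split.
- by apply: o1 => i x; rewrite !famE -!endoM (rel_kki h) endo1.
- by apply: o1 => i x; rewrite !famE -!endoM (rel_kik h) endo1.
- by apply: o2 => i j x; rewrite !famE -!endoM (rel_kk h).
- by apply: o1 => i x; rewrite !famE ke cartan_diag.
- by apply: o1 => i x; rewrite !famE kf cartan_diag scalerA mulfV ?scale1r // expf_neq0.
- apply: o2 => i j x ij; rewrite !famE ke cartan_adj // scalerA mulfV //.
  by rewrite scale1r.
- by apply: o2 => i j x ij; rewrite !famE kf cartan_adj // opprK.
- by apply: o2 => i j x /farE[ij nij]; rewrite !famE ke cartan_far // scale1r.
- by apply: o2 => i j x /farE[ij nij]; rewrite !famE kf cartan_far // scale1r.
- apply: o1 => i x; rewrite !famE.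
  have /app := rel_ef h i i; rewrite eqxx scale1r => /(_ x) H.
  rewrite add_lfunE opp_lfunE scale_lfunE !endoM add_lfunE opp_lfunE in H.
  by rewrite -H addrC subrK.
- apply: o2 => i j x ij; rewrite !famE.
  have /app := rel_ef h i j; rewrite val_eqE in ij; rewrite (negPf ij) scale0r => /(_ x) H.
  rewrite add_lfunE opp_lfunE !endoM zero_lfunE in H.
  by apply/eqP; rewrite -subr_eq0 H.
- by apply: o2 => i j x /farE[ij nij]; rewrite !famE -!endoM (rel_ee h).
- by apply: o2 => i j x /farE[ij nij]; rewrite !famE -!endoM (rel_ff h).
- apply: o2 => i j x ij; rewrite !famE.
  have /app := rel_eee h ij => /(_ x).
  by rewrite !expr2 scale_lfunE add_lfunE !endoM.
- apply: o2 => i j x ij; rewrite !famE.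
  have /app := rel_fff h ij => /(_ x).
  by rewrite !expr2 scale_lfunE add_lfunE !endoM.
Qed.

Lemma Lrel_of : Lrel v n.-1 (fam e) (fam f) (fam k) 0 l.
Proof.
have app (a b : endo V) x : a = b -> a x = b x by move->.
split.
- by move=> x; rewrite -endoM -expr2 (rel_ll h).
- by move=> i x im; rewrite -[ i ]/(nat_of_ord (Ordinal im)) famE -!endoM (rel_kl h).
- by move=> i x i0 im; rewrite -[ i ]/(nat_of_ord (Ordinal im)) famE -!endoM (rel_le h).
- by move=> i x i0 im; rewrite -[ i ]/(nat_of_ord (Ordinal im)) famE -!endoM (rel_lf h).
- by move=> x im; rewrite -[0%N]/(nat_of_ord (Ordinal im)) famE -!endoM (rel_lel h).
- by move=> x im; rewrite -[0%N]/(nat_of_ord (Ordinal im)) famE -!endoM (rel_lfl h).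
- move=> x im; rewrite -[0%N]/(nat_of_ord (Ordinal im)) famE.
  have /app := rel_ele h (erefl (nat_of_ord (Ordinal im))) => /(_ x).
  by rewrite !expr2 !(add_lfunE, scale_lfunE, endoM).
- move=> x im; rewrite -[0%N]/(nat_of_ord (Ordinal im)) famE.
  have /app := rel_flf h (erefl (nat_of_ord (Ordinal im))) => /(_ x).
  by rewrite !expr2 !(add_lfunE, scale_lfunE, endoM).
Qed.
End Convert.

Section Swap.
Variable n : nat.
Implicit Types (I : {set 'I_n}) (j : 'I_n.-1).

Definition swap_down j I := lo j |: (I :\ hi j).
Definition swap_up j I := hi j |: (I :\ lo j).

Lemma lo_neq_hi j : (lo j == hi j) = false.
Proof. by rewrite -val_eqE /=; lia. Qed.
Lemma hi_eq_lo j : (hi j == lo j) = false.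
Proof. by rewrite eq_sym lo_neq_hi. Qed.

Lemma swap_downE j I (i : 'I_n) : (i \in swap_down j I) =
  (i == lo j) || (i != hi j) && (i \in I).
Proof. by rewrite !inE. Qed.
Lemma swap_upE j I (i : 'I_n) : (i \in swap_up j I) =
  (i == hi j) || (i != lo j) && (i \in I).
Proof. by rewrite !inE. Qed.

Lemma swap_upK j I : hi j \in I -> lo j \notin I -> swap_up j (swap_down j I) = I.
Proof.
move=> hI lI; apply/setP => i; rewrite swap_upE swap_downE.
have [->|ih] := eqVneq i (hi j); first by rewrite hI.
by have [->|//] := eqVneq i (lo j); rewrite (negPf lI).
Qed.

Lemma swap_downK j I : lo j \in I -> hi j \notin I -> swap_down j (swap_up j I) = I.
Proof.
move=> lI hI; apply/setP => i; rewrite swap_downE swap_upE.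
have [->|ih] := eqVneq i (lo j); first by rewrite lI.
by have [->|//] := eqVneq i (hi j); rewrite (negPf hI).
Qed.

End Swap.

(** * The model W_r *)

Section WedgeValues.
Variables (F : fieldType) (v : F) (n r : nat) (v0 : v != 0).
Local Notation u := (@uvec F n r).
Local Notation lW := (ell v (fam (@wedge_e F n r)) (fam (@wedge_f F n r))
  (fam (@wedge_k F v n r)) (@wedge_l F n r)).
Local Notation bW j := (bet (fam (@wedge_e F n r) j) (lW j)).
Local Notation gW j := (gam v (fam (@wedge_k F v n r) j) (lW j) (fam (@wedge_f F n r) j)).
Implicit Types (I : {set 'I_n}) (j : 'I_n.-1).

Lemma wedge_eE j I : wedge_e F r j (u I) =
  if (hi j \in I) && (lo j \notin I) then u (swap_down j I) else 0.
Proof. exact: slideE. Qed.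

Lemma wedge_fE j I : wedge_f F r j (u I) =
  if (lo j \in I) && (hi j \notin I) then u (swap_up j I) else 0.
Proof. exact: slideE. Qed.

Section AtStep.
Variable j : 'I_n.-1.
Hypothesis lWj : forall I, lW j (u I) = if lo j \in I then 0 else u I.

Lemma bW_step : bW j = wedge_e F r j.
Proof.
apply: wedge_ext => I _; rewrite betE famE lWj !wedge_eE.
case: (boolP (lo j \in I)) => lI; first by rewrite andbF !endo0 subr0.
rewrite wedge_eE lI andbT; case: ifP => hI; last by rewrite !endo0 subr0.
by rewrite lWj swap_downE eqxx subr0.
Qed.

Lemma gW_step : gW j = wedge_f F r j.
Proof.
apply: wedge_ext => I _; rewrite gamE delE !famE lWj !wedge_fE.
case: (boolP (lo j \in I)) => lI /=.
  rewrite endo0 subr0; case: ifP => hI; last by rewrite !(endo0, scaler0).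
  (* The vector of [swap_up j I] has [k j]-eigenvalue v^-1, which cancels the factor [v] in
     [gam]. *)
  rewrite lWj swap_upE lo_neq_hi eqxx /= wedge_kE /wedge_wt !swap_upE lo_neq_hi !eqxx /=.
  by rewrite scalerA mulfV // scale1r.
by rewrite wedge_fE (negPf lI) !(endo0, subr0, scaler0).
Qed.

Lemma lW_step I : lW j.+1 (u I) = if hi j \in I then 0 else u I.
Proof.
rewrite /= nxtE bW_step gW_step lWj wedge_fE wedge_eE.
case: (boolP (lo j \in I)) => lI; case: (boolP (hi j \in I)) => hI /=;
  rewrite !(endo0, subr0, add0r, addr0, oppr0) //.
- by rewrite wedge_eE !swap_upE lo_neq_hi !eqxx /= -/(swap_down j (swap_up j I)) swap_downK.
- by rewrite wedge_fE !swap_downE lo_neq_hi !eqxx hi_eq_lo /= swap_upK // subrr.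
Qed.
End AtStep.

Lemma lW_uvec (i : 'I_n) I : lW i (u I) = if i \in I then 0 else u I.
Proof.
case: i => i; elim: i I => [|i IH] I im.
  rewrite [ell _ _ _ _ _ _]/= wedge_lE; case: existsP => [[j /andP[jI /eqP j0]]|H].
    by rewrite (_ : Ordinal im = j) ?jI //; apply/val_inj.
  by case: ifP => // iI; case: H; exists (Ordinal im); rewrite iI /=.
have jm : (i < n.-1)%N by lia.
rewrite -[i.+1]/(nat_of_ord (Ordinal jm)).+1 lW_step.
  by rewrite (_ : hi _ = Ordinal im) //; apply/val_inj.
have -> : lo (Ordinal jm) = Ordinal (ltnW im) by apply/val_inj.
by move=> J; apply: IH.
Qed.

Lemma bWE (j : 'I_n.-1) : bW j = wedge_e F r j.
Proof. by apply: bW_step => I; rewrite -(lW_uvec (lo j)). Qed.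

Lemma gWE (j : 'I_n.-1) : gW j = wedge_f F r j.
Proof. by apply: gW_step => I; rewrite -(lW_uvec (lo j)). Qed.

End WedgeValues.

(** * Subsets under lowering swaps *)

Section Subsets.
Variable n : nat.
Implicit Types (I J : {set 'I_n}) (j : 'I_n.-1).

Definition top r : {set 'I_n} := [set i : 'I_n | (i < r)%N].
Definition bottom r : {set 'I_n} := [set i : 'I_n | (n - r <= i)%N].
Definition weightsum I : nat := \sum_(i in I) i.

Lemma card_down j I : hi j \in I -> lo j \notin I -> #|swap_down j I| = #|I|.
Proof.
move=> hI lI; rewrite cardsU1 !inE (negPf lI) andbF (cardsD1 (hi j) I) hI //.
Qed.

Lemma weightsum_down j I : hi j \in I -> lo j \notin I ->
  (weightsum (swap_down j I)).+1 = weightsum I.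
Proof.
move=> hI lI; have lD : lo j \notin I :\ hi j by rewrite inE (negPf lI) andbF.
by rewrite /weightsum [in RHS](big_setD1 (hi j)) //= big_setU1.
Qed.

Lemma top_card r : (r <= n)%N -> #|top r| = r.
Proof.
move=> rn; have widen_inj : injective (widen_ord rn) by move=> i j /(congr1 val) /= /val_inj.
rewrite -[RHS]card_ord -(card_image widen_inj).
apply: eq_card => i; rewrite inE; apply/idP/imageP => [ir|[j _ ->]]; last exact: (ltn_ord j).
by exists (Ordinal ir) => //; apply/val_inj.
Qed.

Lemma bottom_card r : (r <= n)%N -> #|bottom r| = r.
Proof.
move=> rn; have -> : bottom r = ~: top (n - r) by apply/setP => i; rewrite !inE -leqNgt.
by have := cardsC (top (n - r)); rewrite top_card ?leq_subr // card_ord; lia.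
Qed.

Lemma no_descent_top I : (forall j, hi j \in I -> lo j \in I) -> I = top #|I|.
Proof.
move=> H; have dc (i i' : 'I_n) : (i' <= i)%N -> i \in I -> i' \in I.
  case: i => i; elim: i => [|i IH] im /= i'i iI.
    by rewrite (_ : i' = Ordinal im) //; apply/val_inj => /=; lia.
  have jm : (i < n.-1)%N by lia.
  have [e|lt] := eqVneq (i' : nat) i.+1; first by rewrite (_ : i' = Ordinal im) //; apply/val_inj.
  have := H (Ordinal jm); rewrite (_ : hi _ = Ordinal im); last exact/val_inj.
  move=> /(_ iI); rewrite (_ : lo _ = Ordinal (ltnW im)); last exact/val_inj.
  by apply: IH => /=; lia.
have sub (i : 'I_n) : i \in I -> top i.+1 \subset I.
  by move=> iI; apply/subsetP => i'; rewrite inE ltnS => /dc; apply.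
apply/setP => i; rewrite inE; apply/idP/idP => [iI|iI].
  by have := subset_leq_card (sub i iI); rewrite top_card.
apply: contraLR iI => iI; rewrite -leqNgt -[leqRHS]top_card; last exact: ltnW.
apply/subset_leq_card/subsetP => i' i'I; rewrite inE ltnNge.
by apply: contra iI => /dc; apply.
Qed.

(** A lowering swap decreases [weightsum], and [top #|I|] is the only set of its cardinality that
    admits none. *)
Lemma set_connect (P : {set 'I_n} -> Prop) :
    (forall j I, hi j \in I -> lo j \notin I -> P I -> P (swap_down j I)) ->
  forall I, P I -> P (top #|I|).
Proof.
move=> H I; have [k] := ubnP (weightsum I); elim: k I => // k IH I Ik PI.
have [/forallP /= noD|] := boolP [forall j, (hi j \in I) ==> (lo j \in I)].
  by rewrite -no_descent_top // => j hI; apply: (implyP (noD j)).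
case/forallPn => j; rewrite negb_imply => /andP[hI lI].
rewrite -(card_down hI lI); apply: IH; last exact: H.
by have := weightsum_down hI lI; lia.
Qed.

End Subsets.

(** * q-commutation and joint eigenvectors in a module *)

Section QCommutation.
Variables (F : fieldType) (v : F) (n : nat).
Hypotheses (v0 : v != 0) (v1 : v ^+ 2 - 1 != 0) (v2 : v ^+ 2 + 1 != 0).

Lemma awt_sym i j : awt v i j = awt v j i.
Proof. by rewrite /awt eq_sym nadj_sym. Qed.

(* The q-commutation, with a factor [a], of an operator [s] with [k], [e - b] and
   [f - c] suffices for stability under the adjoint action. *)
Definition qcomm (V : vectType F) (e f k b c s : endo V) (a : F) : Prop :=
  [/\ forall x, k (s x) = a *: s (k x),
      forall x, (e - b) (s x) = a *: s ((e - b) x)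
    & forall x, (f - c) (s x) = s ((f - c) x)].

Variables (V : vectType F) (e f k ki : 'I_n.-1 -> endo V) (l : endo V).
Hypothesis h : MU_relations v e f k ki l.

Definition ellM i := ell v (fam e) (fam f) (fam k) l i.
Definition betM i := bet (fam e i) (ellM i).
Definition gamM i := gam v (fam k i) (ellM i) (fam f i).
Definition delM i := del (ellM i) (fam f i).

Let U := Urel_of v0 h.
Let L := Lrel_of h.

Lemma Lrel_ellM i : (i <= n.-1)%N -> Lrel v n.-1 (fam e) (fam f) (fam k) i (ellM i).
Proof. exact: (Lrel_ell v0 v1 v2 U L). Qed.

Lemma qcomm_ell (i : nat) (j : 'I_n.-1) : (i <= n.-1)%N ->
  qcomm (e j) (f j) (k j) (betM j) (delM j) (ellM i) 1.
Proof.
move=> im; have jm := ltn_ord j.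
split=> x; rewrite ?scale1r -?(famE e) -?(famE f) -?(famE k).
- exact: (k_ell v0 v1 v2 U L).
- exact: (E_ell v0 v1 v2 U L).
- exact: (F_ell v0 v1 v2 U L).
Qed.

Lemma qcomm_bet (i j : 'I_n.-1) :
  qcomm (e j) (f j) (k j) (betM j) (delM j) (betM i) (awt v i j).
Proof.
have im := ltn_ord i; have jm := ltn_ord j.
split=> x; rewrite -?(famE e) -?(famE f) -?(famE k).
- by rewrite (k_bet' v0 v1 v2 U (Lrel_ellM (ltnW im))) // awt_sym.
- exact: (E_bet v0 v1 v2 U L).
- exact: (F_bet v0 v1 v2 U L).
Qed.

Lemma qcomm_gam (i j : 'I_n.-1) :
  qcomm (e j) (f j) (k j) (betM j) (delM j) (gamM i) (awt v i j)^-1.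
Proof.
have im := ltn_ord i; have jm := ltn_ord j.
split=> x; rewrite -?(famE e) -?(famE f) -?(famE k).
- by rewrite (k_gam v0 v1 v2 U (Lrel_ellM (ltnW im))) // awt_sym.
- exact: (E_gam v0 v1 v2 U L).
- exact: (F_gam v0 v1 v2 U L).
Qed.

(* [y] transforms under the l_i as the basis vector u_I of W_r does. *)
Definition inM (I : {set 'I_n}) (y : V) : Prop :=
  forall i : 'I_n, ellM i y = if i \in I then 0 else y.

Lemma inM_le (i : 'I_n) : (i <= n.-1)%N. Proof. by have := ltn_ord i; lia. Qed.
Hint Resolve inM_le : core.

Lemma betM_down I (j : 'I_n.-1) y : inM I y -> hi j \in I -> lo j \notin I ->
  inM (swap_down j I) (betM j y) /\ gamM j (betM j y) = y.
Proof.
move=> Iy hI lI; have jm := ltn_ord j; have Lj := Lrel_ellM (ltnW jm).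
have yl : ellM j y = y by rewrite -[ellM j]/(ellM (lo j)) Iy (negPf lI).
have yh : ellM j.+1 y = 0 by rewrite -[ellM j.+1]/(ellM (hi j)) Iy hI.
split; last exact: (gam_betK v0 v1 v2 U L).
move=> i; rewrite swap_downE; have [->|il] := eqVneq i (lo j); first exact: (l_bet Lj).
have [->|ih] := eqVneq i (hi j); first exact: (nxt_bet v0 v1 v2 U Lj).
rewrite -(bet_ell v0 v1 v2 U L) // Iy; case: ifP => _; first exact: endo0.
by [].
Qed.

Lemma gamM_up I (j : 'I_n.-1) y : inM I y -> lo j \in I -> hi j \notin I ->
  inM (swap_up j I) (gamM j y) /\ betM j (gamM j y) = y.
Proof.
move=> Iy lI hI; have jm := ltn_ord j; have Lj := Lrel_ellM (ltnW jm).
have yl : ellM j y = 0 by rewrite -[ellM j]/(ellM (lo j)) Iy lI.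
have yh : ellM j.+1 y = y by rewrite -[ellM j.+1]/(ellM (hi j)) Iy (negPf hI).
split; last exact: (bet_gamK v0 v1 v2 U L).
move=> i; rewrite swap_upE; have [->|ih] := eqVneq i (hi j); first exact: (nxt_gam v0 v1 v2 U Lj).
have [->|il] := eqVneq i (lo j); first exact: (l_gam Lj).
rewrite -(gam_ell v0 v1 v2 U L) // Iy; case: ifP => _; first exact: endo0.
by [].
Qed.

Lemma betM0 I (j : 'I_n.-1) y : inM I y ->
  (hi j \in I) && (lo j \notin I) = false -> betM j y = 0.
Proof.
move=> Iy; have jm := ltn_ord j.
have := Iy (lo j); have := Iy (hi j).
case: (lo j \in I); case: (hi j \in I) => //= yh yl _.
- exact: (bet_vanish0 v0 v1 v2 U L).
- exact: (bet_vanish0 v0 v1 v2 U L).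
- exact: (bet_vanish1 v0 v1 v2 U L).
Qed.

Lemma gamM0 I (j : 'I_n.-1) y : inM I y ->
  (lo j \in I) && (hi j \notin I) = false -> gamM j y = 0.
Proof.
move=> Iy; have jm := ltn_ord j.
have := Iy (lo j); have := Iy (hi j).
case: (lo j \in I); case: (hi j \in I) => //= yh yl _.
- exact: (gam_vanish0 v0 v1 v2 U L).
- exact: (gam_vanish1 v0 v1 v2 U L).
- exact: (gam_vanish1 v0 v1 v2 U L).
Qed.

Lemma ellM_comm (i j : 'I_n) x : ellM i (ellM j x) = ellM j (ellM i x).
Proof. exact: (ell_comm v0 v1 v2 U L). Qed.

Lemma ellM_idem (i : 'I_n) x : ellM i (ellM i x) = ellM i x.
Proof. exact: (llP (Lrel_ellM (inM_le i))). Qed.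

(** The [ellM i] are commuting idempotents, so applying each of them in turn, unless it kills the
    vector, keeps the eigenvalues already obtained. [P] stands for the properties that have to
    survive, such as the weight. *)
Lemma inM_component (P : V -> Prop) x :
    (forall (i : 'I_n) y, P y -> P (ellM i y)) -> P x -> x != 0 ->
  exists z I, [/\ P z, z != 0 & inM I z].
Proof.
move=> Pl Px x0.
have /(_ n (leqnn n))[z [Pz z0 zt]] : forall t, (t <= n)%N ->
    exists z, [/\ P z, z != 0 &
      forall i : 'I_n, (i < t)%N -> ellM i z = 0 \/ ellM i z = z].
  elim=> [|t IH] tn; first by exists x.
  have [z [Pz z0 zt]] := IH (ltnW tn); pose o := Ordinal tn.
  have [lz0|lz0] := eqVneq (ellM o z) 0.
    exists z; split=> // i; rewrite ltnS leq_eqVlt => /predU1P[it|/zt//].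
    by left; rewrite (_ : i = o) //; apply/val_inj.
  exists (ellM o z); split=> //; first exact: Pl.
  move=> i; rewrite ltnS leq_eqVlt => /predU1P[it|/zt].
    by right; rewrite (_ : i = o) ?ellM_idem //; apply/val_inj.
  by rewrite ellM_comm => -[->|->]; [left; rewrite endo0|right].
exists z, [set i : 'I_n | ellM i z == 0]; split=> // i; rewrite inE.
by case: eqVneq => [//|iz]; have [iz'|//] := zt i (ltn_ord i); rewrite iz' eqxx in iz.
Qed.

End QCommutation.

Section WedgeHom.
Variables (F : fieldType) (n r : nat) (V : vectType F).
Local Notation W := (wedge F n r).
Local Notation u := (@uvec F n r).

Lemma wedge_hom_ext (p q : 'Hom(W, V)) :
  (forall I : {set 'I_n}, #|I| = r -> p (u I) = q (u I)) -> p = q.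
Proof.
move=> pq; apply/lfunP => w; rewrite (wedge_sum w) !linear_sum /=.
by apply: eq_bigr => I _; rewrite !linearZ /= pq //; apply/eqP/(valP I).
Qed.

Lemma wedge_hom_exists (Y : {set 'I_n} -> V) :
  exists p : 'Hom(W, V), forall I : {set 'I_n}, #|I| = r -> p (u I) = Y I.
Proof.
pose q (w : W) := \sum_(I : rsubset n r) (w I : F) *: Y (val I).
have ql : linear q.
  move=> a w w'; rewrite /q scaler_sumr -big_split /=; apply: eq_bigr => J _.
  by rewrite !ffunE scalerDl scalerA.
pose qm := GRing.isLinear.Build F W V _ _ ql.
exists (linfun (HB.pack q qm : {linear W -> V})) => I Ir; rewrite lfunE /= /q.
have IrP : #|I| == r by apply/eqP.
rewrite (bigD1 (Sub I IrP)) //= big1 => [|J JI]; rewrite ffunE.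
  by rewrite SubK eqxx scale1r addr0.
have /negPf-> : val J != I.
  by apply: contraNneq JI => JI; rewrite -val_eqE SubK JI.
by rewrite scale0r.
Qed.

End WedgeHom.

Section HMap.
Variables (F : fieldType) (W V : vectType F).
Local Notation H := 'Hom(W, V).

Section Def.
Variables (a : endo V) (b : endo W).
Definition hmap_fun (p : H) : H := (a \o p \o b)%VF.
Fact hmap_linear : linear hmap_fun.
Proof.
move=> c p q; apply/lfunP => w; rewrite /hmap_fun.
by rewrite !(comp_lfunE, add_lfunE, scale_lfunE) endoD endoZ.
Qed.
HB.instance Definition _ := GRing.isLinear.Build F H H _ hmap_fun hmap_linear.
Definition hmap : endo H := linfun hmap_fun.
End Def.

Lemma hmapE (a : endo V) (b : endo W) (p : H) w : hmap a b p w = a (p (b w)).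
Proof. by rewrite lfunE /= /hmap_fun !comp_lfunE. Qed.

Definition intertwines (a : endo V) (b : endo W) : {vspace H} :=
  lker (hmap a 1 - hmap 1 b).

Lemma intertwinesP (a : endo V) (b : endo W) (p : H) :
  reflect (forall w, a (p w) = p (b w)) (p \in intertwines a b).
Proof.
rewrite memv_ker add_lfunE opp_lfunE subr_eq0; apply: (iffP eqP) => [pE w|pE].
  by have /lfunP/(_ w) := pE; rewrite !hmapE !endo1.
by apply/lfunP => w; rewrite !hmapE !endo1.
Qed.

End HMap.

Section Family.
Variables (F : fieldType) (v : F) (n : nat).
Hypotheses (v0 : v != 0) (v1 : v ^+ 2 - 1 != 0) (v2 : v ^+ 2 + 1 != 0).
Variables (V : vectType F) (e f k ki : 'I_n.-1 -> endo V) (l : endo V).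
Hypothesis h : MU_relations v e f k ki l.
Local Notation gM := (gamM v e f k l).
Local Notation inM := (inM v e f k l).
Implicit Types I : {set 'I_n}.

(** Adjacent descents would share a vertex, which one of them puts in [I] and the other outside.
    Hence two ways down from [I] only involve swaps, and operators [gM], that commute. *)
Lemma descents_far I (i j : 'I_n.-1) : hi i \in I -> lo i \notin I ->
  hi j \in I -> lo j \notin I -> i != j -> far i j.
Proof.
move=> hi_i lo_i hi_j lo_j ij.
have h1 : i.+1 != j :> nat.
  by apply: contraNneq lo_j => e1; rewrite (_ : lo j = hi i) //; apply/val_inj.
have h2 : j.+1 != i :> nat.
  by apply: contraNneq lo_i => e1; rewrite (_ : lo i = hi j) //; apply/val_inj.
by rewrite -val_eqE /= in ij; rewrite /far; lia.
Qed.

Lemma down_far I (i j : 'I_n.-1) : far i j ->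
  (((hi j \in swap_down i I) = (hi j \in I)) * ((lo j \in swap_down i I) = (lo j \in I)))%type.
Proof.
by rewrite /far !swap_downE -!val_eqE /= => ij; split;
   repeat (case: eqVneq => [?|?] //=); lia.
Qed.

Lemma down_comm I (i j : 'I_n.-1) : far i j -> swap_down i (swap_down j I) = swap_down j (swap_down i I).
Proof.
rewrite /far => ij; apply/setP => x; rewrite !swap_downE -!val_eqE /=.
by repeat (case: eqVneq => [?|?] //=); lia.
Qed.

(* The vector attached to I is obtained from the one at {1, ..., r} along a chain
   of lowering swaps of I; independence of the chain reduces to commuting swaps. *)
Lemma swap_family r y : (r <= n)%N -> inM (top n r) y ->
  exists Y : {set 'I_n} -> V, Y (top n r) = y /\ forall I : {set 'I_n}, #|I| = r ->
    inM I (Y I) /\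
    forall j : 'I_n.-1, hi j \in I -> lo j \notin I -> Y I = gM j (Y (swap_down j I)).
Proof.
move=> rn y_top.
pose desc I (j : 'I_n.-1) := (hi j \in I) && (lo j \notin I).
(* The last clause fixes the value at [top n r], the only r-subset without descents. *)
pose good N (Y : {set 'I_n} -> V) := forall I : {set 'I_n}, #|I| = r -> (weightsum I < N)%N ->
  [/\ inM I (Y I), forall j, desc I j -> Y I = gM j (Y (swap_down j I))
    & (forall j, ~~ desc I j) -> Y I = y].
have [Y gY] : exists Y, good (\max_(I : {set 'I_n}) weightsum I).+1 Y.
  elim: _.+1 => [|N [Y gY]]; first by exists (fun=> y).
  exists (fun I => if (weightsum I < N)%N then Y I else
    if [pick j | desc I j] is Some j then gM j (Y (swap_down j I)) else y).
  move=> I Ir; rewrite ltnS leq_eqVlt => /predU1P[IN|IN]; last first.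
    have [Y1 Y2 Y3] := gY I Ir IN; rewrite IN; split=> // j dj.
    have /andP[hI lI] := dj.
    by have := weightsum_down hI lI => wj; rewrite (Y2 j dj) ifT //; lia.
  rewrite IN ltnn.
  have wdown j : desc I j -> (weightsum (swap_down j I) < N)%N.
    by case/andP=> hI lI; have := weightsum_down hI lI; lia.
  have cdown j : desc I j -> #|swap_down j I| = r.
    by case/andP=> hI lI; rewrite card_down.
  case: pickP => [i di|nod]; last first.
    split=> [|j|//]; last by rewrite nod.
    by rewrite (no_descent_top (I := I)) ?Ir // => j hI; have /negbT := nod j; rewrite negb_and hI negbK.
  split; last by move=> /(_ i); rewrite di.
    have /andP[hI lI] := di; have [Yi _ _] := gY _ (cdown i di) (wdown i di).
    rewrite -{1}(swap_upK hI lI).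
    apply: (gamM_up v0 v1 v2 h Yi _ _).1; rewrite swap_downE ?eqxx //.
    by rewrite hi_eq_lo.
  (* For a second descent [j], both candidates for the value at [I] are [gM i] and [gM j] applied,
     in either order, to the vector of the doubly swapped set. *)
  move=> j dj; rewrite wdown //.
  have [<-//|ij] := eqVneq i j.
  have /andP[hi_i lo_i] := di; have /andP[hi_j lo_j] := dj.
  have fij := descents_far hi_i lo_i hi_j lo_j ij.
  have fji : far j i by rewrite far_sym.
  have dij : desc (swap_down i I) j by rewrite /desc !(down_far _ fij).
  have dji : desc (swap_down j I) i by rewrite /desc !(down_far _ fji).
  have [_ /(_ j dij)-> _] := gY _ (cdown i di) (wdown i di).
  have [_ /(_ i dji)-> _] := gY _ (cdown j dj) (wdown j dj).
  rewrite (down_comm I fij).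
  exact: (gam_gam_far v0 v1 v2 (Urel_of v0 h) (Lrel_of h)).
have wI I : (weightsum I < (\max_(I : {set 'I_n}) weightsum I).+1)%N.
  by rewrite ltnS (leq_bigmax I).
exists Y; split=> [|I Ir].
  have [_ _ Y3] := gY _ (top_card rn) (wI _); apply: Y3 => j.
  by rewrite /desc !inE /=; lia.
have [Y1 Y2 _] := gY _ Ir (wI _); split=> // j hI lI.
by apply: Y2; rewrite /desc hI.
Qed.

End Family.

Section EndoApp.
Variables (F : fieldType) (V : vectType F).
Implicit Types a b : endo V.
Lemma endo_addE a b x : (a + b) x = a x + b x. Proof. exact: add_lfunE. Qed.
Lemma endo_oppE a x : (- a) x = - a x. Proof. exact: opp_lfunE. Qed.
Lemma endo_scaleE c a x : (c *: a) x = c *: a x. Proof. exact: scale_lfunE. Qed.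
End EndoApp.

(** * The multiplicity space *)

(* The operators [se], ... on [L] are determined by their conjugates under two
   injective maps into [V], evaluation at the highest ([ev true]) and at the
   lowest ([ev false]) basis vector of W_r: at the former the adjoint action of
   e_j is a multiple of e_j, at the latter that of f_j is f_j. *)
Section EvalRelations.
Variables (F : fieldType) (v : F) (n : nat) (V L : vectType F).
Variables (e f k ki : 'I_n.-1 -> endo V) (se sf sk ski : 'I_n.-1 -> endo L).
Hypothesis hV : U_relations v e f k ki.
Variables (ev : bool -> L -> V) (a : bool -> 'I_n.-1 -> F).
Hypotheses (evD : forall t x y, ev t (x + y) = ev t x + ev t y)
  (evZ : forall t c x, ev t (c *: x) = c *: ev t x)
  (ev_inj : forall t, injective (ev t)) (a0 : forall t j, a t j != 0)
  (ev_e : forall j x, ev true (se j x) = (a true j)^-1 *: e j (ev true x))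
  (ev_f : forall j x, ev false (sf j x) = f j (ev false x))
  (ev_k : forall t j x, ev t (sk j x) = (a t j)^-1 *: k j (ev t x))
  (ev_ki : forall t j x, ev t (ski j x) = a t j *: ki j (ev t x))
  (evE : 'I_n.-1 -> L -> V)
  (ev_e_false : forall i x,
     ev false (se i x) = (a false i)^-1 *: (e i (ev false x) - evE i x))
  (evE_f : forall i j x, evE i (sf j x) = f j (evE i x) +
     ((i == j)%:R * ((v - v^-1)^-1 * (a false i ^+ 2 - 1))) *: ki i (ev false x)).

Lemma eval_opp t x : ev t (- x) = - ev t x.
Proof. by rewrite -scaleN1r evZ scaleN1r. Qed.

(** This relation mixes both kinds of generators, so neither evaluation makes it immediate. At the
    lowest vector the action of e_i has a correction [evE i], and the extra term in [evE_f] is what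
    turns the commutator computed in [V] into the one with the rescaled [sk] and [ski]. *)
Lemma eval_ef i j x : se i (sf j x) - sf j (se i x) =
  (i == j)%:R *: ((v - v^-1)^-1 *: (sk i x - ski i x)).
Proof.
apply: (ev_inj (t := false)).
rewrite evD eval_opp ev_f !ev_e_false !evZ evD eval_opp ev_k ev_ki evE_f ev_f ?endoL.
have /lfunP/(_ (ev false x)) := rel_ef hV i j.
rewrite !(endo_addE, endo_oppE, endo_scaleE) !endoM; move: (_^-1) => s E.
apply: (lincomb (c := (a false i)^-1) E).
by linear_identity F; field; rewrite a0.
Qed.

Lemma eval_U_relations : U_relations v se sf sk ski.
Proof.
split.
- move=> j; apply/lfunP => x; apply: (ev_inj (t := true)).
  rewrite endoM endo1 ev_k ev_ki endoZ.
  by rewrite -[k j _]endoM (rel_kki hV) endo1 scalerA mulVf ?scale1r.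
- move=> j; apply/lfunP => x; apply: (ev_inj (t := true)).
  rewrite endoM endo1 ev_ki ev_k endoZ.
  by rewrite -[ki j _]endoM (rel_kik hV) endo1 scalerA mulfV ?scale1r.
- move=> i j; apply/lfunP => x; apply: (ev_inj (t := true)); rewrite !endoM !ev_k !endoZ.
  have /lfunP/(_ (ev true x)) := rel_kk hV i j; rewrite !endoM => ->.
  by rewrite !scalerA; congr (_ *: _); apply: mulrC.
- move=> i j; apply/lfunP => x; apply: (ev_inj (t := true)).
  rewrite scale_lfunE !endoM evZ ev_k !ev_e ev_ki !endoZ.
  have /lfunP/(_ (ev true x)) := rel_ke hV i j; rewrite !endoM scale_lfunE => ->.
  rewrite !scalerA; congr (_ *: _); field; by rewrite !a0.
- move=> i j; apply/lfunP => x; apply: (ev_inj (t := false)).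
  rewrite scale_lfunE !endoM evZ ev_k !ev_f ev_ki !endoZ.
  have /lfunP/(_ (ev false x)) := rel_kf hV i j; rewrite !endoM scale_lfunE => ->.
  by rewrite !scalerA mulVf ?mul1r.
- move=> i j; apply/lfunP => x; rewrite add_lfunE opp_lfunE !endoM eval_ef.
  by rewrite !scale_lfunE add_lfunE opp_lfunE.
- move=> i j ij; apply/lfunP => x; apply: (ev_inj (t := true)); rewrite !endoM !ev_e !endoZ.
  have /lfunP/(_ (ev true x)) := rel_ee hV ij; rewrite !endoM => ->.
  by rewrite !scalerA; congr (_ *: _); apply: mulrC.
- move=> i j ij; apply/lfunP => x; apply: (ev_inj (t := false)); rewrite !endoM !ev_f.
  by have /lfunP/(_ (ev false x)) := rel_ff hV ij; rewrite !endoM.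
- move=> i j ij; apply/lfunP => x; apply: (ev_inj (t := true)).
  rewrite !expr2 scale_lfunE add_lfunE !endoM evZ evD !ev_e !endoZ.
  have /lfunP/(_ (ev true x)) := rel_eee hV ij.
  rewrite !expr2 !(endoM, endo_scaleE, endo_addE) => E.
  apply: (lincomb (c := (a true i)^-1 ^+ 2 * (a true j)^-1) E).
  by linear_identity F; field; rewrite !a0.
- move=> i j ij; apply/lfunP => x; apply: (ev_inj (t := false)).
  rewrite !expr2 scale_lfunE add_lfunE !endoM evZ evD !ev_f.
  have /lfunP/(_ (ev false x)) := rel_fff hV ij.
  by rewrite !expr2 !(endoM, scale_lfunE, add_lfunE).
Qed.

End EvalRelations.

Section Multiplicity.
Variables (F : fieldType) (v : F) (n r : nat).
Hypotheses (v0 : v != 0) (v1 : v ^+ 2 - 1 != 0) (v2 : v ^+ 2 + 1 != 0).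
Hypothesis rn : (r <= n)%N.
Variables (V : vectType F) (e f k ki : 'I_n.-1 -> endo V) (l : endo V).
Hypothesis h : MU_relations v e f k ki l.
Implicit Types (I : {set 'I_n}) (j : 'I_n.-1).

Local Notation W := (wedge F n r).
Local Notation u := (@uvec F n r).
Local Notation H := 'Hom(W, V).
Local Notation eW := (@wedge_e F n r).
Local Notation fW := (@wedge_f F n r).
Local Notation kW := (@wedge_k F v n r).
Local Notation kiW := (@wedge_ki F v n r).
Local Notation lW := (@wedge_l F n r).
Let v1' : v ^+ 2 != 1. Proof. by rewrite -subr_eq0. Qed.
Let hW : MU_relations v eW fW kW kiW lW := wedge_MU_relations n r v0 v1'.
Local Notation ellV := (ellM v e f k l).
Local Notation betV := (betM v e f k l).
Local Notation gamV := (gamM v e f k l).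
Local Notation inV := (inM v e f k l).
Local Notation ellW := (ellM v eW fW kW lW).

Lemma ellW_uvec (i : 'I_n) I : ellW i (u I) = if i \in I then 0 else u I.
Proof. exact: lW_uvec. Qed.
Lemma betWE j : betM v eW fW kW lW j = eW j.
Proof. exact: bWE. Qed.
Lemma gamWE j : gamM v eW fW kW lW j = fW j.
Proof. exact: gWE. Qed.

Definition mult_space : {vspace H} :=
  ((\bigcap_(i < n) intertwines (ellV i) (ellW i)) :&:
   (\bigcap_(j < n.-1) (intertwines (betV j) (eW j) :&: intertwines (gamV j) (fW j))))%VS.
Local Notation X := mult_space.

Lemma mult_spaceP (p : H) : reflect
  [/\ forall (i : 'I_n) w, ellV i (p w) = p (ellW i w),
      forall j w, betV j (p w) = p (eW j w)
    & forall j w, gamV j (p w) = p (fW j w)] (p \in X).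
Proof.
rewrite memv_cap !memvE; apply: (iffP andP).
  case=> /subv_bigcapP H1 /subv_bigcapP H2; split=> [i|j|j].
  - by apply/intertwinesP; rewrite memvE H1.
  - by have := H2 j isT; rewrite -memvE memv_cap => /andP[/intertwinesP].
  - by have := H2 j isT; rewrite -memvE memv_cap => /andP[_ /intertwinesP].
case=> H1 H2 H3; split; apply/subv_bigcapP => i _; rewrite -memvE.
  exact/intertwinesP/H1.
by rewrite memv_cap; apply/andP; split; apply/intertwinesP.
Qed.

Lemma mult_inM p I : p \in X -> inV I (p (u I)).
Proof.
by case/mult_spaceP=> pl _ _ i; rewrite pl ellW_uvec; case: ifP; rewrite ?linear0.
Qed.

(** The family of [swap_family] is compatible with the [gamV j] by construction. Compatibility with
    the [betV j] follows because [betV j] and [gamV j] are inverse to each other between joint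
    eigenspaces of the projections. *)
Lemma mult_extend y : inV (top n r) y -> exists2 p, p \in X & p (u (top n r)) = y.
Proof.
move=> y_top; have [Y [Yy HY]] := swap_family v0 v1 v2 h rn y_top.
have [p pY] := wedge_hom_exists r Y.
exists p; last by rewrite pY ?top_card.
have lift (a : endo V) (b : endo W) :
    (forall I, #|I| = r -> a (p (u I)) = p (b (u I))) -> forall w, a (p w) = p (b w).
  move=> ab w; have /wedge_hom_ext/lfunP/(_ w) : forall I : {set 'I_n}, #|I| = r ->
      (a \o p)%VF (u I) = (p \o b)%VF (u I) by move=> I Ir; rewrite !comp_lfunE ab.
  by rewrite !comp_lfunE.
apply/mult_spaceP; split=> [i|j|j]; apply: lift => I Ir; have [YI Yd] := HY I Ir.
- by rewrite ellW_uvec pY // YI; case: ifP => _; rewrite ?linear0 // pY.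
- rewrite wedge_eE pY //; case: ifP => [/andP[hI lI]|dj]; last first.
    by rewrite linear0 (betM0 v0 v1 v2 h YI dj).
  rewrite pY ?card_down // (Yd _ hI lI).
  have [Y2 _] := HY _ (etrans (card_down hI lI) Ir).
  by apply: (gamM_up v0 v1 v2 h Y2 _ _).2; rewrite swap_downE ?eqxx // hi_eq_lo.
- rewrite wedge_fE pY //; case: ifP => [/andP[lI hI]|dj]; last first.
    by rewrite linear0 (gamM0 v0 v1 v2 h YI dj).
  have hU : hi j \in swap_up j I by rewrite swap_upE eqxx.
  have lU : lo j \notin swap_up j I by rewrite swap_upE lo_neq_hi eqxx.
  have cU : #|swap_up j I| = r by rewrite -(card_down hU lU) swap_downK.
  by have [_ Yd2] := HY _ cU; rewrite pY // (Yd2 j) // swap_downK.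
Qed.

(** A zero value is carried down to [top n r] by the [eW j]. So is a nonzero value elsewhere, since
    [fW j] undoes each lowering swap; the two cannot coexist. *)
Lemma mult_inj0 p I : p \in X -> #|I| = r -> p (u I) = 0 -> p = 0.
Proof.
case/mult_spaceP=> _ pe pf Ir pI; apply: wedge_hom_ext => J Jr; rewrite zero_lfunE.
have ptop : p (u (top n r)) = 0.
  have : p (u (top n #|I|)) = 0; last by rewrite Ir.
  apply: (@set_connect n (fun I => p (u I) = 0)) => // j K hJ lJ pJ.
  by have := pe j (u K); rewrite pJ endo0 wedge_eE hJ lJ.
apply/eqP/contraT => pJ.
have /eqP[] : p (u (top n #|J|)) != 0; last by rewrite Jr.
apply: (@set_connect n (fun J => p (u J) != 0)) => // j K hJ lJ.
apply: contra => /eqP pd; have := pf j (u (swap_down j K)).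
by rewrite pd endo0 wedge_fE !swap_downE lo_neq_hi hi_eq_lo !eqxx /= swap_upK // => <-.
Qed.

Lemma mult_inj p q I : p \in X -> q \in X -> #|I| = r -> p (u I) = q (u I) -> p = q.
Proof.
move=> pX qX Ir pq; apply/eqP; rewrite -subr_eq0; apply/eqP.
apply: (mult_inj0 (I := I)) => //; first exact: rpredB.
by rewrite add_lfunE opp_lfunE pq subrr.
Qed.

(* The adjoint action: e p = (e p - p e) k^{-1}, f p = f p - k^{-1} p k f,
   k p = k p k^{-1}. *)
Definition mult_e j : endo H := hmap (e j) (kiW j) - hmap 1 (eW j * kiW j).
Definition mult_f j : endo H := hmap (f j) 1 - hmap (ki j) (kW j * fW j).
Definition mult_k j : endo H := hmap (k j) (kiW j).
Definition mult_ki j : endo H := hmap (ki j) (kW j).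

Lemma mult_eE j p w : mult_e j p w = e j (p (kiW j w)) - p (eW j (kiW j w)).
Proof. by rewrite !(add_lfunE, opp_lfunE) !hmapE endo1 endoM. Qed.
Lemma mult_fE j p w : mult_f j p w = f j (p w) - ki j (p (kW j (fW j w))).
Proof. by rewrite !(add_lfunE, opp_lfunE) !hmapE endo1 endoM. Qed.
Lemma mult_kE j p w : mult_k j p w = k j (p (kiW j w)). Proof. exact: hmapE. Qed.
Lemma mult_kiE j p w : mult_ki j p w = ki j (p (kW j w)). Proof. exact: hmapE. Qed.

Section KSwitch.
Variables (V' : vectType F) (k' ki' s : endo V') (a : F).
Hypotheses (a0 : a != 0) (kki' : k' * ki' = 1) (kik' : ki' * k' = 1).
Hypothesis ks : forall x, k' (s x) = a *: s (k' x).

Lemma s_ki x : s (ki' x) = a *: ki' (s x).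
Proof.
by rewrite -[LHS]endo1 -kik' endoM ks endoZ -[k' (ki' x)]endoM kki' endo1.
Qed.

Lemma s_k x : s (k' x) = a^-1 *: k' (s x).
Proof. by rewrite ks scalerA mulVf // scale1r. Qed.
End KSwitch.

Lemma homZ (p : H) a w : p (a *: w) = a *: p w. Proof. exact: linearZ. Qed.

Lemma kW_fW j w : kW j (fW j w) = v^-1 *: fW j w.
Proof.
have /lfunP/(_ w) : kW j * fW j = v^-1 *: fW j.
  apply: wedge_ext => I _; rewrite endoM scale_lfunE wedge_fE.
  case: ifP => [/andP[lI hI]|_]; last by rewrite linear0 scaler0.
  by rewrite wedge_kE /wedge_wt !swap_upE lo_neq_hi !eqxx.
by rewrite endoM scale_lfunE.
Qed.

(** On [X] the subtracted term of the adjoint action can be moved outside [p], where it becomes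
    [betV j], or [delM] in [mult_f_diff]. The action is thus composition with the diagonal parts, to
    which the q-commutation rules apply. *)
Lemma mult_e_diff j p w : p \in X -> mult_e j p w = (e j - betV j) (p (kiW j w)).
Proof. by case/mult_spaceP=> _ pe _; rewrite mult_eE add_lfunE opp_lfunE pe. Qed.

Lemma mult_f_diff j p w : p \in X -> mult_f j p w = (f j - delM v e f k l j) (p w).
Proof.
case/mult_spaceP=> _ _ pf; rewrite mult_fE add_lfunE opp_lfunE.
rewrite kW_fW homZ -pf /gamM gamE famE -!endoZ scalerA mulVf // scale1r.
by rewrite -[ki j _]endoM (rel_kik h) endo1.
Qed.

Section Intertwine.
Variables (j : 'I_n.-1) (sV : endo V) (sW : endo W) (a : F) (a0 : a != 0) (p : H).
Hypothesis sVa : qcomm (e j) (f j) (k j) (betV j) (delM v e f k l j) sV a.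
Hypothesis sWa : qcomm (eW j) (fW j) (kW j) (betM v eW fW kW lW j)
  (delM v eW fW kW lW j) sW a.
Hypotheses (pX : p \in X) (ps : forall w, sV (p w) = p (sW w)).

Let ksV x : k j (sV x) = a *: sV (k j x). Proof. by case: sVa. Qed.
Let ksW x : kW j (sW x) = a *: sW (kW j x). Proof. by case: sWa. Qed.
Let skiV := s_ki (rel_kki h j) (rel_kik h j) ksV.
Let skiW := s_ki (rel_kki hW j) (rel_kik hW j) ksW.
Let skV := s_k a0 ksV.
Let skW := s_k a0 ksW.

Lemma k_intertwine w : sV (mult_k j p w) = mult_k j p (sW w).
Proof. by rewrite !mult_kE skV ps skiW homZ endoZ scalerA mulVf // scale1r. Qed.

Lemma ki_intertwine w : sV (mult_ki j p w) = mult_ki j p (sW w).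
Proof. by rewrite !mult_kiE skiV ps skW homZ endoZ scalerA mulfV // scale1r. Qed.

Lemma e_intertwine w : sV (mult_e j p w) = mult_e j p (sW w).
Proof.
have [_ Es _] := sVa; rewrite !mult_e_diff //.
have sE x : sV ((e j - betV j) x) = a^-1 *: (e j - betV j) (sV x).
  by rewrite Es scalerA mulVf // scale1r.
by rewrite sE ps skiW homZ endoZ scalerA mulVf // scale1r.
Qed.

Lemma f_intertwine w : sV (mult_f j p w) = mult_f j p (sW w).
Proof. by have [_ _ Fs] := sVa; rewrite !mult_f_diff // -Fs ps. Qed.

End Intertwine.

(** The q-commutation scalars are the same on [V] and on W_r, so they cancel. *)
Lemma mult_stable j p : p \in X ->
  [/\ mult_e j p \in X, mult_f j p \in X, mult_k j p \in X & mult_ki j p \in X].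
Proof.
move=> pX; have [pl pe pf] := mult_spaceP p pX.
have inle (i : 'I_n) : (i <= n.-1)%N by have := ltn_ord i; lia.
have Wbet (i : 'I_n.-1) := qcomm_bet v0 v1 v2 hW i j.
have Wgam (i : 'I_n.-1) := qcomm_gam v0 v1 v2 hW i j.
have a1 : (1 : F) != 0 by exact: oner_neq0.
have pe' (i : 'I_n.-1) w : betV i (p w) = p (betM v eW fW kW lW i w) by rewrite pe betWE.
have pf' (i : 'I_n.-1) w : gamV i (p w) = p (gamM v eW fW kW lW i w) by rewrite pf gamWE.
have aa (i : 'I_n.-1) : awt v i j != 0 by exact: awt_neq0.
have ai (i : 'I_n.-1) : (awt v i j)^-1 != 0 by rewrite invr_eq0.
split; apply/mult_spaceP; split=> i w; rewrite -?betWE -?gamWE.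
- exact: (e_intertwine a1 (qcomm_ell v0 v1 v2 h j (inle i)) (qcomm_ell v0 v1 v2 hW j (inle i)) pX (pl i)).
- exact: (e_intertwine (aa i) (qcomm_bet v0 v1 v2 h i j) (Wbet i) pX (pe' i)).
- exact: (e_intertwine (ai i) (qcomm_gam v0 v1 v2 h i j) (Wgam i) pX (pf' i)).
- exact: (f_intertwine (qcomm_ell v0 v1 v2 h j (inle i)) pX (pl i)).
- exact: (f_intertwine (qcomm_bet v0 v1 v2 h i j) pX (pe' i)).
- exact: (f_intertwine (qcomm_gam v0 v1 v2 h i j) pX (pf' i)).
- exact: (k_intertwine a1 (qcomm_ell v0 v1 v2 h j (inle i)) (qcomm_ell v0 v1 v2 hW j (inle i)) (pl i)).
- exact: (k_intertwine (aa i) (qcomm_bet v0 v1 v2 h i j) (Wbet i) (pe' i)).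
- exact: (k_intertwine (ai i) (qcomm_gam v0 v1 v2 h i j) (Wgam i) (pf' i)).
- exact: (ki_intertwine a1 (qcomm_ell v0 v1 v2 h j (inle i)) (qcomm_ell v0 v1 v2 hW j (inle i)) (pl i)).
- exact: (ki_intertwine (aa i) (qcomm_bet v0 v1 v2 h i j) (Wbet i) (pe' i)).
- exact: (ki_intertwine (ai i) (qcomm_gam v0 v1 v2 h i j) (Wgam i) (pf' i)).
Qed.

Local Notation utop := (u (top n r)).
Local Notation ubot := (u (bottom n r)).

Lemma eW_top j : eW j utop = 0.
Proof. by rewrite wedge_eE !inE /= ifF //; lia. Qed.
Lemma fW_bot j : fW j ubot = 0.
Proof. by rewrite wedge_fE !inE /= ifF //; lia. Qed.
Lemma kiW_uvec j I : kiW j (u I) = (wedge_wt v j I)^-1 *: u I.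
Proof. exact: wedge_kiE. Qed.
Lemma kW_uvec j I : kW j (u I) = wedge_wt v j I *: u I.
Proof. exact: wedge_kE. Qed.
Lemma wt_neq0 j I : wedge_wt v j I != 0.
Proof. exact: wedge_wt_neq0. Qed.

Section Submodule.
Variable S : {vspace H}.
Hypothesis SX : (S <= X)%VS.
Hypothesis Sst : forall j p, p \in S ->
  [/\ mult_e j p \in S, mult_f j p \in S, mult_k j p \in S & mult_ki j p \in S].
Local Notation L := (subvs_of S).

Definition restr (a : endo H) : endo L :=
  (linfun (vsproj S) \o a \o linfun vsval)%VF.

Lemma restrE (a : endo H) (x : L) : a (vsval x) \in S ->
  vsval (restr a x) = a (vsval x).
Proof. by move=> ax; rewrite /restr !comp_lfunE !lfunE /= vsprojK. Qed.

Definition sub_e j : endo L := restr (mult_e j).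
Definition sub_f j : endo L := restr (mult_f j).
Definition sub_k j : endo L := restr (mult_k j).
Definition sub_ki j : endo L := restr (mult_ki j).
Definition ev I (x : L) : V := (vsval x : H) (u I).

Lemma sub_eE j x : vsval (sub_e j x) = mult_e j (vsval x).
Proof. by apply: restrE; case: (Sst j (subvsP x)). Qed.
Lemma sub_fE j x : vsval (sub_f j x) = mult_f j (vsval x).
Proof. by apply: restrE; case: (Sst j (subvsP x)). Qed.
Lemma sub_kE j x : vsval (sub_k j x) = mult_k j (vsval x).
Proof. by apply: restrE; case: (Sst j (subvsP x)). Qed.
Lemma sub_kiE j x : vsval (sub_ki j x) = mult_ki j (vsval x).
Proof. by apply: restrE; case: (Sst j (subvsP x)). Qed.

Local Opaque sub_e sub_f sub_k sub_ki.

Lemma evD I x y : ev I (x + y) = ev I x + ev I y.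
Proof. by rewrite /ev linearD add_lfunE. Qed.
Lemma evZ I a x : ev I (a *: x) = a *: ev I x.
Proof. by rewrite /ev linearZ scale_lfunE. Qed.

Lemma ev_inj I x y : #|I| = r -> ev I x = ev I y -> x = y.
Proof.
move=> Ir xy; apply/val_inj/(mult_inj _ _ Ir xy); apply: (subvP SX); exact: subvsP.
Qed.

Lemma ev_e j x : ev (top n r) (sub_e j x) =
  (wedge_wt v j (top n r))^-1 *: e j (ev (top n r) x).
Proof.
by rewrite /ev sub_eE mult_eE kiW_uvec homZ !endoZ eW_top scaler0 linear0 subr0.
Qed.
Lemma ev_f j x : ev (bottom n r) (sub_f j x) = f j (ev (bottom n r) x).
Proof. by rewrite /ev sub_fE mult_fE fW_bot endo0 linear0 endo0 subr0. Qed.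
Lemma ev_k j I x : ev I (sub_k j x) = (wedge_wt v j I)^-1 *: k j (ev I x).
Proof. by rewrite /ev sub_kE mult_kE kiW_uvec homZ endoZ. Qed.
Lemma ev_ki j I x : ev I (sub_ki j x) = wedge_wt v j I *: ki j (ev I x).
Proof. by rewrite /ev sub_kiE mult_kiE kW_uvec homZ endoZ. Qed.

Lemma ev_bot_e i x : ev (bottom n r) (sub_e i x) =
  (wedge_wt v i (bottom n r))^-1 *: (e i (ev (bottom n r) x) - (vsval x : H) (eW i ubot)).
Proof.
by rewrite /ev sub_eE mult_eE kiW_uvec homZ !endoZ homZ scalerBr.
Qed.

(** Since [fW j] kills [ubot], this is minus the commutator of [eW i] and [fW j], which acts on
    [ubot] by a scalar. *)
Lemma fW_eW_bot i j : fW j (eW i ubot) =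
  - ((i == j)%:R * ((v - v^-1)^-1 * (wedge_wt v i (bottom n r) - (wedge_wt v i (bottom n r))^-1))) *: ubot.
Proof.
have /lfunP/(_ ubot) := rel_ef hW i j.
rewrite add_lfunE opp_lfunE !endoM fW_bot endo0 sub0r scale_lfunE.
rewrite scale_lfunE add_lfunE opp_lfunE kW_uvec kiW_uvec -scalerBl !scalerA.
by move=> E; apply: oppr_inj; rewrite E scaleNr opprK !mulrA.
Qed.

Lemma evE_f i j x : (vsval (sub_f j x) : H) (eW i ubot) =
  f j ((vsval x : H) (eW i ubot)) +
  ((i == j)%:R * ((v - v^-1)^-1 * (wedge_wt v i (bottom n r) ^+ 2 - 1))) *:
    ki i (ev (bottom n r) x).
Proof.
rewrite sub_fE mult_fE fW_eW_bot endoZ kW_uvec !homZ !endoZ scalerA -scaleNr /ev.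
congr (_ + _); have [->|ij] := eqVneq i j; last by rewrite !mul0r oppr0 mul0r oppr0 !scale0r.
congr (_ *: _); rewrite mulNr opprK; have := wt_neq0 j (bottom n r).
by move: (wedge_wt _ _ _) ((v - v^-1)^-1) => b s b0; field.
Qed.

Lemma sub_U_relations : U_relations v sub_e sub_f sub_k sub_ki.
Proof.
apply: (@eval_U_relations _ _ _ _ _ e f k ki _ _ _ _ h
  (fun t => ev (if t then top n r else bottom n r))
  (fun t j => wedge_wt v j (if t then top n r else bottom n r)) _ _ _ _ _ _ _ _
  (fun i x => (vsval x : H) (eW i ubot))).
- by move=> t x y; apply: evD.
- by move=> t c x; apply: evZ.
- by move=> t x y; apply: ev_inj; case: t; [apply: top_card|apply: bottom_card].
- by move=> t j; apply: wt_neq0.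
- by move=> j x; apply: ev_e.
- by move=> j x; apply: ev_f.
- by move=> t j x; apply: ev_k.
- by move=> t j x; apply: ev_ki.
- by move=> i x; apply: ev_bot_e.
- by move=> i j x; apply: evE_f.
Qed.

Lemma tens_wedge_sum (t : tens L W) : exists x : {set 'I_n} -> L,
  t = \sum_(I : rsubset n r) pure (x (val I)) (u (val I)).
Proof.
pose P (t : tens L W) := exists x : {set 'I_n} -> L,
  t = \sum_(I : rsubset n r) pure (x (val I)) (u (val I)).
have P0 : P 0.
  exists (fun=> 0); rewrite big1 // => I _.
  by rewrite -(scale0r (0 : L)) pureZl scale0r.
have PD t1 t2 : P t1 -> P t2 -> P (t1 + t2).
  move=> [x1 ->] [x2 ->]; exists (fun I => x1 I + x2 I); rewrite -big_split /=.
  by apply: eq_bigr => I _; rewrite pureDl.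
have Ppure x w : P (pure x w).
  pose y (I : {set 'I_n}) := (if insub I is Some J then (w : {ffun _ -> _}) J else 0) *: x.
  exists y; rewrite {1}(wedge_sum w).
  have puresum (s : seq (rsubset n r)) :
      pure x (\sum_(I <- s) (w I : F) *: u (val I)) =
      \sum_(I <- s) (w I : F) *: pure x (u (val I)).
    elim: s => [|I s IH]; last by rewrite !big_cons pureDr pureZr IH.
    by rewrite !big_nil -(scale0r (0 : W)) pureZr scale0r.
  rewrite puresum; apply: eq_bigr => I _; rewrite /y valK pureZl //.
have PZ c x w : P (c *: pure x w) by rewrite -pureZl.
have -> : t = \sum_i \sum_j (t : 'M_(_, _)) i j *:
    pure (r2v (delta_mx 0 i) : L) (r2v (delta_mx 0 j) : W).
  rewrite {1}(matrix_sum_delta t); apply: eq_bigr => i _; apply: eq_bigr => j _.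
  by rewrite -pure_delta.
by do 2![apply: (big_ind P) => // ? _].
Qed.

(* The product of these projections singles out the vectors in [inV J]. *)
Definition proj_step (J : {set 'I_n}) (i : 'I_n) : endo V :=
  if i \in J then 1 - ellV i else ellV i.
Definition inV_proj (J : {set 'I_n}) : endo V :=
  foldr (fun i a => proj_step J i * a) 1 (enum 'I_n).

Lemma inV_projE I J y : inV I y -> inV_proj J y = if I == J then y else 0.
Proof.
move=> Iy; have stepE i : proj_step J i y = if (i \in I) == (i \in J) then y else 0.
  rewrite /proj_step; have := Iy i.
  by case: (i \in J); case: (i \in I); rewrite ?(endo_addE, endo_oppE, endo1) => ->;
     rewrite ?subr0 ?subrr.
have H s : foldr (fun i a => proj_step J i * a) 1 s y =
    if all (fun i => (i \in I) == (i \in J)) s then y else 0.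
  elim: s => [|i s IH] /=; first exact: endo1.
  by rewrite endoM IH; case: all; rewrite ?andbF ?endo0 // andbT stepE.
rewrite /inV_proj H; congr (if _ then _ else _); apply/allP/eqP => [IJ|-> //].
by apply/setP => i; apply/eqP/IJ; rewrite mem_enum.
Qed.

Lemma mult_eval_exists : exists g : 'Hom(tens L W, V),
  forall x w, g (pure x w) = (vsval x : H) w.
Proof.
have [g [gE _]] : exists! g : 'Hom(tens L W, V), forall x w, g (pure x w) = (vsval x : H) w.
  apply: tens_universal => [w a x y|x a w1 w2]; last exact: linearP.
  by rewrite linearP add_lfunE scale_lfunE.
by exists g.
Qed.

Section EvalMap.
Variable g : 'Hom(tens L W, V).
Hypothesis gE : forall x w, g (pure x w) = (vsval x : H) w.

Lemma mult_eval_inj : injective g.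
Proof.
suff g0 t : g t = 0 -> t = 0.
  move=> t1 t2 eq12; apply/eqP; rewrite -subr_eq0; apply/eqP/g0.
  by rewrite linearB /= eq12 subrr.
have [x ->] := tens_wedge_sum t; rewrite linear_sum => gx.
apply: big1 => I _; have Ir : #|val I| = r by apply/eqP/(valP I).
suff -> : x (val I) = 0 by rewrite -(scale0r (0 : L)) pureZl scale0r.
have xX (J : {set 'I_n}) : vsval (x J) \in X by apply: (subvP SX); exact: subvsP.
apply: val_inj; rewrite [RHS]linear0; apply: (mult_inj0 (xX _) Ir).
have := congr1 (inV_proj (val I)) gx; rewrite linear0 linear_sum (bigD1 I) //= big1 => [|J JI].
  by rewrite addr0 gE (inV_projE (I := val I)) ?eqxx //; exact: mult_inM.
rewrite gE (inV_projE (I := val J)); last exact: mult_inM.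
by rewrite (inj_eq val_inj) (negPf JI).
Qed.

Let ext (a : endo (tens L W)) (b : endo V) :
  (forall x w, g (a (pure x w)) = b ((vsval x : H) w)) -> forall t, g (a t) = b (g t).
Proof.
move=> ab t; have /lfunP/(_ t) : (g \o a)%VF = (b \o g)%VF.
  by apply: tens_ext => x w; rewrite !comp_lfunE gE.
by rewrite !comp_lfunE.
Qed.

Lemma mult_eval_e j t : g (rho_e sub_e eW kW j t) = e j (g t).
Proof.
apply: ext => x w; rewrite endo_addE !tensmap_pure endo1 linearD /= !gE sub_eE mult_eE.
have kk : kiW j (kW j w) = w by rewrite -endoM (rel_kik hW) endo1.
by rewrite kk addrC subrK.
Qed.

Lemma mult_eval_f j t : g (rho_f sub_f sub_ki fW j t) = f j (g t).
Proof.
apply: ext => x w; rewrite endo_addE !tensmap_pure endo1 linearD /= !gE sub_fE sub_kiE.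
by rewrite mult_fE mult_kiE addrC subrK.
Qed.

Lemma mult_eval_k j t : g (rho_k sub_k kW j t) = k j (g t).
Proof.
apply: ext => x w; rewrite tensmap_pure gE sub_kE mult_kE.
by rewrite -[kiW j _]endoM (rel_kik hW) endo1.
Qed.

Lemma mult_eval_ki j t : g (rho_k sub_ki kiW j t) = ki j (g t).
Proof.
apply: ext => x w; rewrite tensmap_pure gE sub_kiE mult_kiE.
by rewrite -[kW j _]endoM (rel_kki hW) endo1.
Qed.

Hypothesis n0 : (0 < n)%N.
Lemma mult_eval_l t : g (rho_l L lW t) = l (g t).
Proof.
apply: ext => x w; rewrite tensmap_pure gE endo1.
have /mult_spaceP[xl _ _] : vsval x \in X by apply: (subvP SX); exact: subvsP.
exact: (esym (xl (Ordinal n0) w)).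
Qed.

End EvalMap.

End Submodule.
End Multiplicity.

(** * Weights *)

Section VparFacts.
Variable R : realType.
Local Notation v := (vpar R).

Lemma vpar_expn_neq1 m : (0 < m)%N -> v ^+ m != 1.
Proof.
move=> m0; rewrite /vpar -tofracXn -tofrac1 tofrac_eq.
apply/eqP => /(congr1 (size \o val)); rewrite /= size_polyXn size_poly1; lia.
Qed.

Lemma vpar_exp_inj : injective (fun a : int => v ^ a).
Proof.
have key (a b : int) : a < b -> v ^ a != v ^ b.
  move=> ab; apply/eqP => E.
  have : v ^ (b - a) = 1.
    by rewrite expfzDr ?vpar_neq0 // -E -expfzDr ?vpar_neq0 // subrr.
  have -> : b - a = `|b - a|%N :> int by lia.
  by move/eqP; apply/negP; apply: vpar_expn_neq1; lia.
move=> a b E; case: (ltgtP a b) => // ab; first by case/eqP: (key _ _ ab).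
by case/eqP: (key _ _ ab).
Qed.

Lemma vpar_sq_sub1 : v ^+ 2 - 1 != 0.
Proof. by rewrite subr_eq0 vpar_sq_neq1. Qed.

Lemma vpar_sq_add1 : v ^+ 2 + 1 != 0.
Proof.
rewrite addr_eq0; apply/eqP => E; have := @vpar_expn_neq1 4 isT.
by rewrite -[4%N]/(2 * 2)%N exprM E sqrrN expr1n eqxx.
Qed.

End VparFacts.

Section WeightTheory.
Variable n : nat.
Implicit Types (mu nu : weight n).

Lemma wt_diff_inj mu nu : (forall i, wt_diff mu i = wt_diff nu i) -> mu = nu.
Proof.
move=> E; rewrite -[mu]reprK -[nu]reprK; apply/eqP; rewrite eqmodE.
have [i0 _|no] := pickP 'I_n; last by apply/weight_equivP; exists 0 => i; have := no i.
pose c := repr mu (Ordinal (leq_ltn_trans (leq0n i0) (ltn_ord i0))) -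
          repr nu (Ordinal (leq_ltn_trans (leq0n i0) (ltn_ord i0))).
apply/weight_equivP; exists c; case=> i; elim: i => [|i IH] im.
  rewrite /c (bool_irrelevance im (leq_ltn_trans (leq0n i0) (ltn_ord i0))).
  by ring.
have jm : (i < n.-1)%N by lia.
have := E (Ordinal jm); rewrite /wt_diff.
have -> : hi (Ordinal jm) = Ordinal im by apply/val_inj.
have -> : lo (Ordinal jm) = Ordinal (ltnW im) by apply/val_inj.
by have := IH (ltnW im); lia.
Qed.

Definition alpha (j : 'I_n.-1) : {ffun 'I_n -> int} :=
  [ffun i => (i == lo j)%:R - (i == hi j)%:R].

Definition wt_add mu (a : {ffun 'I_n -> int}) : weight n :=
  (\pi_(weight n) [ffun i => repr mu i + a i])%qT.

Lemma wt_diff_add mu a i : wt_diff (wt_add mu a) i = wt_diff mu i + (a (lo i) - a (hi i)).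
Proof. by rewrite /wt_add wt_diff_pi !ffunE /wt_diff; ring. Qed.

Lemma alpha_diff i j : alpha j (lo i) - alpha j (hi i) = cartan i j.
Proof.
rewrite !ffunE -!val_eqE /= /cartan /adj -val_eqE /=.
by repeat case: eqVneq => ? /=; lia.
Qed.

(* The pairing with 2 rho, well defined on classes modulo (1, ..., 1). *)
Definition height mu : int := \sum_(i : 'I_n) (n%:Z - 1 - 2 * i%:Z) * repr mu i.

Lemma height_coef_sum : \sum_(i : 'I_n) (n%:Z - 1 - 2 * i%:Z) = 0.
Proof.
set S := \sum_i _; have : S = - S; last by lia.
rewrite {1}/S (reindex_inj rev_ord_inj) /= -sumrN; apply: eq_bigr => i _.
by have := ltn_ord i; lia.
Qed.

Lemma height_add mu a : height (wt_add mu a) =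
  height mu + \sum_(i : 'I_n) (n%:Z - 1 - 2 * i%:Z) * a i.
Proof.
have [c h] := repr_pi [ffun i => repr mu i + a i].
rewrite /height /wt_add; under eq_bigr => i _ do rewrite h ffunE !mulrDr.
by rewrite !big_split /= -mulr_suml height_coef_sum mul0r addr0.
Qed.

Lemma height_alpha mu j c : height (wt_add mu [ffun i => c * alpha j i]) = height mu + 2 * c.
Proof.
rewrite height_add; congr (_ + _).
have delta (i0 : 'I_n) : \sum_(i : 'I_n) (n%:Z - 1 - 2 * i%:Z) * (c * (i == i0)%:R) =
    (n%:Z - 1 - 2 * i0%:Z) * c.
  rewrite (bigD1 i0) //= eqxx mulr1 big1 ?addr0 // => i /negPf->.
  by rewrite !mulr0.
under eq_bigr => i _ do rewrite !ffunE !mulrBr.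
by rewrite sumrB !delta /=; lia.
Qed.

End WeightTheory.

Section WeightSpaces.
Variables (R : realType) (n : nat) (V : vectType (ratfun R)) (k : 'I_n.-1 -> endo V).
Local Notation v := (vpar R).
Local Notation ws := (weight_space k).

(** Applying k_i minus its eigenvalue on the first weight space removes the first summand and
    rescales the others; for a suitable [i] the factor at [mu] is nonzero, as distinct powers of [v]
    differ. The case S = 0 gives independence of the weight spaces. *)
Lemma weight_sum_stable (S : {vspace V}) (s : seq (weight n)) (y : weight n -> V) :
    (forall i x, x \in S -> k i x \in S) -> uniq s ->
    (forall mu, y mu \in ws mu) -> \sum_(mu <- s) y mu \in S ->
  forall mu, mu \in s -> y mu \in S.
Proof.
move=> Sk; elim: s y => // nu s IH y /= /andP[nus us] yw yS.
have tl mu : mu \in s -> y mu \in S.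
  move=> mus; have munu : mu != nu by apply: contraNneq nus => <-.
  have [i ine] : exists i, wt_diff mu i != wt_diff nu i.
    apply/existsP; apply: contraNT munu; rewrite negb_exists => /forallP H.
    by apply/eqP/wt_diff_inj => i; apply/eqP; have := H i; rewrite negbK.
  pose z xi := (v ^ wt_diff xi i - v ^ wt_diff nu i) *: y xi.
  have zw xi : z xi \in ws xi by apply: memvZ.
  have : z mu \in S.
    apply: (IH z) => //.
    have -> : \sum_(xi <- s) z xi = k i (\sum_(xi <- nu :: s) y xi) -
        v ^ wt_diff nu i *: \sum_(xi <- nu :: s) y xi.
      rewrite !big_cons endoD scalerDr opprD addrACA.
      have /weight_spaceP-> := yw nu; rewrite subrr add0r.
      rewrite linear_sum scaler_sumr -sumrB; apply: eq_bigr => xi _ /=.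
      by have /weight_spaceP-> := yw xi; rewrite /z scalerBl.
    by rewrite memvB ?memvZ ?Sk.
  rewrite /z rpredZeq subr_eq0 => /predU1P[/vpar_exp_inj E|//].
  by rewrite E eqxx in ine.
move=> mu; rewrite inE => /predU1P[->|/tl//].
have : \sum_(xi <- s) y xi \in S by rewrite big_seq memv_suml.
by move=> sS; move: yS; rewrite big_cons => yS; rewrite -(addrK (\sum_(j <- s) y j) (y nu)) memvB.
Qed.

Lemma weight_sum0 (s : seq (weight n)) (y : weight n -> V) : uniq s ->
    (forall mu, y mu \in ws mu) -> \sum_(mu <- s) y mu = 0 ->
  forall mu, mu \in s -> y mu = 0.
Proof.
move=> us yw y0 mu mus; apply/eqP; rewrite -memv0.
apply: (weight_sum_stable _ us yw) => //; last by rewrite y0 mem0v.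
by move=> i x; rewrite !memv0 => /eqP->; rewrite linear0.
Qed.

Lemma weight_decomp (s : seq (weight n)) x : uniq s -> x \in (\sum_(mu <- s) ws mu)%VS ->
  exists2 y : weight n -> V, forall mu, y mu \in ws mu & x = \sum_(mu <- s) y mu.
Proof.
elim: s x => [|nu s IH] x; first by rewrite big_nil memv0 => _ /eqP->;
  exists (fun=> 0) => [mu|]; rewrite ?mem0v ?big_nil.
case/andP=> nus us; rewrite big_cons => /memv_addP[a aw [b /(IH _ us)[y yw bE] ->]].
exists (fun mu => if mu == nu then a else y mu) => [mu|].
  by case: eqP => [->|_]; [exact: aw|exact: yw].
rewrite big_cons eqxx bE; congr (_ + _); rewrite !big_seq; apply: eq_bigr => mu mus.
by case: eqP nus => // <-; rewrite mus.
Qed.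

Lemma weight_directv (s : seq (weight n)) : uniq s -> directv (\sum_(mu <- s) ws mu)%VS.
Proof.
move=> us; apply/directvP => /=; elim: s us => [|nu s IH] /=.
  by rewrite !big_nil dimv0.
case/andP=> nus us; rewrite !big_cons dimv_disjoint_sum ?IH //.
apply/eqP; rewrite -subv0; apply/subvP => x; rewrite memv_cap => /andP[xnu].
case/(weight_decomp us) => y yw xE; rewrite memv0; apply/eqP.
pose z mu := if mu == nu then - x else y mu.
suff /eqP : z nu = 0 by rewrite /z eqxx oppr_eq0 => /eqP.
apply: (@weight_sum0 (nu :: s) z) => [|mu||]; last exact: mem_head.
- by rewrite /= nus.
- by rewrite /z; case: eqP => [->|_]; [rewrite memvN; exact: xnu|exact: yw].
rewrite big_cons {1}/z eqxx xE addrC; apply/eqP; rewrite subr_eq0; apply/eqP.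
rewrite !big_seq; apply: eq_bigr => mu mus; rewrite /z.
by case: eqP nus => // <-; rewrite mus.
Qed.

Lemma type1_span : type1 k -> exists s : seq (weight n),
  uniq s /\ forall x, exists2 y : weight n -> V, forall mu, y mu \in ws mu &
    x = \sum_(mu <- s) y mu.
Proof.
case=> _ [s sE]; exists (undup s); split=> [|x]; first exact: undup_uniq.
apply: weight_decomp; first exact: undup_uniq.
by rewrite big_undup; [rewrite sE memvf|move=> U; exact: addvv].
Qed.

End WeightSpaces.

(** * Highest weights *)

Section SL2.
Variables (F : fieldType) (v : F) (n : nat) (V : vectType F).
Hypotheses (v0 : v != 0) (v1 : v ^+ 2 - 1 != 0).
Variables (e f k ki : 'I_n.-1 -> endo V).
Hypotheses (h : U_relations v e f k ki).

(* The quantum integer [m] [a - m + 1] in e f^m x = [m] [a - m + 1] f^(m-1) x. *)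
Definition qint (m : nat) (a : int) : F :=
  (v ^+ m - v ^- m) * (v ^ (a - m%:Z + 1) - v ^ (- (a - m%:Z + 1))) / (v - v^-1) ^+ 2.

(** In quantum integers: [m+1] [a-m] + [a-2m-2] = [m+2] [a-m-1]. *)
Lemma qint_step m a : qint m.+1 a + (v - v^-1)^-1 * (v ^ (a - 2 * m.+1%:Z) - v ^ (- (a - 2 * m.+1%:Z)))
  = qint m.+2 a.
Proof.
have vm0 : v ^+ m != 0 by rewrite expf_neq0.
have va0 : v ^ a != 0 by rewrite expfz_neq0.
have E1 : v ^ (a - m.+1%:Z + 1) = v ^ a / v ^+ m.
  have -> : a - m.+1%:Z + 1 = a + - m%:Z by lia.
  by rewrite expfzDr // -exprnN.
have E2 : v ^ (a - m.+2%:Z + 1) = v ^ a / v ^+ m / v.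
  have -> : a - m.+2%:Z + 1 = a + - m%:Z + (-1) by lia.
  by rewrite !expfzDr // !exprN1 -?exprnN.
have E3 : v ^ (a - 2 * m.+1%:Z) = v ^ a / v ^+ m / v ^+ m / v / v.
  have -> : a - 2 * m.+1%:Z = a + - m%:Z + - m%:Z + (-1) + (-1) by lia.
  by rewrite !expfzDr // !exprN1 -?exprnN.
rewrite /qint -!invr_expz E1 E2 E3 !exprS.
move: (v ^ a) (v ^+ m) va0 vm0 => A B A0 B0; field.
by rewrite -expr2 v0 v1 A0 B0.
Qed.

Lemma e_iter_f j a x m : k j x = v ^ a *: x -> e j x = 0 ->
  e j (iter m.+1 (f j) x) = qint m.+1 a *: iter m (f j) x.
Proof.
move=> xk ex.
have kx p : k j (iter p (f j) x) = v ^ (a - 2 * p%:Z) *: iter p (f j) x.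
  elim: p => [|p IH]; first by rewrite mulr0 subr0.
  rewrite iterS -endoM (rel_kMf h) scale_lfunE endoM IH cartan_diag endoZ scalerA -expfzDr //.
  by congr (v ^ _ *: _); lia.
have kix p : ki j (iter p (f j) x) = v ^ (- (a - 2 * p%:Z)) *: iter p (f j) x.
  have va : v ^ (a - 2 * p%:Z) != 0 by rewrite expfz_neq0.
  have : ki j (k j (iter p (f j) x)) = iter p (f j) x by rewrite -endoM (rel_kik h) endo1.
  rewrite kx endoZ => H; rewrite -[in RHS]H scalerA -invr_expz mulVf // scale1r.
  by [].
have efx y : e j (f j y) = f j (e j y) + (v - v^-1)^-1 *: (k j y - ki j y).
  have /lfunP/(_ y) := rel_ef h j j.
  rewrite eqxx scale1r endo_addE endo_oppE endo_scaleE !endoM endo_addE endo_oppE.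
  by move=> <-; rewrite addrC subrK.
have vv : v - v^-1 != 0 by apply: v_subV_neq0.
elim: m => [|m IH].
  rewrite iterS efx ex endo0 add0r kx kix -scalerBl scalerA; congr (_ *: _).
  rewrite /qint mulr0 subr0 subrK expr1 -invr_expz.
  have va0 : v ^ a != 0 by rewrite expfz_neq0.
  by move: (v ^ a) va0 => A A0; field; rewrite -expr2 v0 v1 A0.
rewrite iterS efx IH endoZ kx kix -scalerBl scalerA -iterS.
by rewrite -scalerDl qint_step.
Qed.

End SL2.

Section HighestWeight.
Variables (R : realType) (n : nat) (V : vectType (ratfun R)).
Variables (e f k ki : 'I_n.-1 -> endo V).
Local Notation v := (vpar R).
Local Notation ws := (weight_space k).
Hypotheses (h : U_relations v e f k ki) (t1 : type1 k).
Let v0 := vpar_neq0 R.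

Definition wt_shift (mu : weight n) (c : int) (j : 'I_n.-1) : weight n :=
  wt_add mu [ffun i => c * alpha j i].

Lemma wt_diff_shift mu c j i : wt_diff (wt_shift mu c j) i = wt_diff mu i + c * cartan i j.
Proof. by rewrite wt_diff_add -alpha_diff !ffunE; ring. Qed.

Lemma weight_e mu j x : x \in ws mu -> e j x \in ws (wt_shift mu 1 j).
Proof.
move/weight_spaceP => xk; apply/weight_spaceP => i.
rewrite -endoM (rel_kMe h) scale_lfunE endoM xk endoZ scalerA.
by rewrite wt_diff_shift mul1r [wt_diff _ _ + _]addrC [in RHS]expfzDr ?vpar_neq0.
Qed.

Lemma weight_f mu j x : x \in ws mu -> f j x \in ws (wt_shift mu (-1) j).
Proof.
move/weight_spaceP => xk; apply/weight_spaceP => i.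
rewrite -endoM (rel_kMf h) scale_lfunE endoM xk endoZ scalerA.
by rewrite wt_diff_shift mulN1r [wt_diff _ _ + _]addrC [in RHS]expfzDr ?vpar_neq0.
Qed.

Lemma height_bound : exists B : nat, forall mu x, x != 0 -> x \in ws mu ->
  (`|height mu| <= B)%N.
Proof.
have [s [us sV]] := type1_span t1.
exists (\sum_(mu <- s) `|height mu|)%N => mu x x0 xmu.
suff mus : mu \in s by rewrite (big_rem _ mus) leq_addr.
apply: contraNT x0 => mus; have [y yw xE] := sV x.
pose z nu := if nu == mu then - x else y nu.
have /eqP : z mu = 0; last by rewrite /z eqxx oppr_eq0.
apply: (@weight_sum0 _ _ _ k (mu :: s) z) => [|nu||]; last exact: mem_head.
- by rewrite /= mus.
- by rewrite /z; case: eqP => [->|_]; [rewrite memvN; exact: xmu|exact: yw].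
rewrite big_cons {1}/z eqxx {1}xE addrC; apply/eqP; rewrite subr_eq0; apply/eqP.
rewrite !big_seq; apply: eq_bigr => nu nus; rewrite /z.
by case: eqP mus => // <-; rewrite nus.
Qed.

Lemma highest_weight_exists mu x : x != 0 -> x \in ws mu ->
  exists la y, [/\ y != 0, y \in ws la & forall j, e j y = 0].
Proof.
have [B HB] := height_bound.
have [N] := ubnP `|B%:Z - height mu|%N; elim: N => // N IH in mu x *.
move=> muN x0 xmu; have [/existsP[j ejx]|] := boolP [exists j, e j x != 0].
  have ex := weight_e j xmu; apply: (IH _ _ _ ejx ex).
  have B1 := HB _ _ x0 xmu; have B2 := HB _ _ ejx ex.
  rewrite /wt_shift height_alpha in B2 *; clear -B1 B2 muN; lia.
rewrite negb_exists => /forallP H; exists mu, x; split; [exact: x0|exact: xmu|] => j.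
by apply/eqP; have := H j; rewrite negbK.
Qed.

Lemma highest_weight_dominant la x : x != 0 -> x \in ws la ->
  (forall j, e j x = 0) -> dominant la.
Proof.
move=> x0 xla ex; have [B HB] := height_bound.
have pos j : 0 <= wt_diff la j.
  have wf p : iter p (f j) x \in ws (wt_shift la (- p%:Z) j).
    elim: p => [|p IH].
      apply/weight_spaceP => i; rewrite wt_diff_shift oppr0 mul0r addr0.
      by have /weight_spaceP := xla; apply.
    have /weight_spaceP H := weight_f j IH; apply/weight_spaceP => i.
    rewrite iterS H !wt_diff_shift; congr (v ^ _ *: _); clear; lia.
  have ex0 : exists p, iter p (f j) x == 0.
    (* Each [f j] lowers the height by 2, so after this many steps it would lie below -B. *)
    exists (B + `|height la|).+1%N; apply/contraT => nz.
    have := HB _ _ nz (wf _); rewrite height_alpha; clear; lia.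
  have := ex_minnP ex0 => -[[|m] /eqP m0 mmin]; first by case/eqP: x0.
  have nz : iter m (f j) x != 0 by apply/negP => /mmin; rewrite ltnn.
  have /weight_spaceP/(_ j) xk := xla.
  (* At the first vanishing power, m + 1, the product [m+1] [a-m] has to be zero with a =
     [wt_diff la j]; this forces a = m, which is nonnegative. *)
  have := e_iter_f v0 (vpar_sq_sub1 R) h m xk (ex j); rewrite m0 endo0 => /esym/eqP.
  rewrite scaler_eq0 (negPf nz) orbF /qint !mulf_eq0 invr_eq0 expf_eq0 /=.
  rewrite (negPf (v_subV_neq0 v0 (vpar_sq_sub1 R))) orbF.
  case/orP; rewrite subr_eq0.
    rewrite -[v ^- _]/(v ^ (- m.+1%:Z)) -[v ^+ _]/(v ^ m.+1%:Z) => /eqP/vpar_exp_inj.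
    by clear; lia.
  by move/eqP/vpar_exp_inj; clear; lia.
move=> i i' ii'; have [d] := ubnP (i' - i)%N; elim: d => // d IH in i ii' *.
move=> dlt; have [<-|ne] := eqVneq i i'; first exact: lexx.
rewrite -val_eqE /= in ne.
have jm : (i < n.-1)%N by have := ltn_ord i'; clear -ne ii'; lia.
have := pos (Ordinal jm); rewrite /wt_diff.
have -> : lo (Ordinal jm) = i by apply/val_inj.
rewrite subr_ge0; apply: le_trans; apply: IH => /=; clear -ne ii' dlt; lia.
Qed.

End HighestWeight.

Section Type1.
Variables (R : realType) (n : nat) (L V : vectType (ratfun R)).
Variables (kL : 'I_n.-1 -> endo L) (k : 'I_n.-1 -> endo V).
Local Notation v := (vpar R).

Lemma type1_weight_vector (x : V) : type1 k -> x != 0 ->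
  exists mu y, y != 0 /\ y \in weight_space k mu.
Proof.
move=> /type1_span[s [_ sV]] x0; have [y yw xE] := sV x.
have [/hasP[mu _ ymu]|/hasPn H] := boolP (has (fun mu => y mu != 0) s).
  by exists mu, (y mu); split; [exact: ymu|exact: yw].
case/eqP: x0; rewrite xE big_seq big1 // => mu /H; rewrite negbK => /eqP->.
by [].
Qed.

(** The image of [E] is stable under the [k j], so it contains the weight components of each of its
    vectors; pulled back, they decompose [L], with weights shifted by [a]. *)
Lemma type1_embedding (E : 'Hom(L, V)) (a : {ffun 'I_n -> int}) : injective E ->
    (forall j x, E (kL j x) = v ^ (a (lo j) - a (hi j)) *: k j (E x)) ->
  type1 k -> type1 kL.
Proof.
move=> Einj Ek /type1_span[s [us sV]]; split; first exact: weight_directv.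
exists [seq wt_add mu a | mu <- s]; apply/eqP; rewrite eqEsubv subvf /=.
apply/subvP => x _; have [y yw xE] := sV (E x).
have yT : forall mu, mu \in s -> y mu \in limg E.
  apply: (weight_sum_stable _ us yw); last by rewrite -xE memv_img ?memvf.
  move=> j _ /memv_imgP[z _ ->]; set c := v ^ (a (lo j) - a (hi j)).
  have c0 : c != 0 by rewrite expfz_neq0 ?vpar_neq0.
  have -> : k j (E z) = E (c^-1 *: kL j z).
    by rewrite linearZ /= Ek scalerA mulVf // scale1r.
  by rewrite memv_img ?memvf.
have -> : x = \sum_(mu <- s) (E^-1)%VF (y mu).
  apply: Einj; rewrite xE linear_sum big_seq [RHS]big_seq; apply: eq_bigr => mu mus.
  by rewrite /= limg_lfunVK // yT.
rewrite big_seq; apply: memv_suml => mu mus.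
rewrite big_map (big_rem _ mus) /=; apply: (subvP (addvSl _ _)).
apply/weight_spaceP => j; apply: Einj.
rewrite linearZ /= Ek limg_lfunVK ?yT //.
have /weight_spaceP-> := yw mu.
by rewrite scalerA wt_diff_add [wt_diff _ _ + _]addrC [in RHS]expfzDr ?vpar_neq0.
Qed.

End Type1.

Lemma minimal_stable (F : fieldType) (H : vectType F) (P : {vspace H} -> Prop) (T : {vspace H}) :
  P T -> T <> 0%VS -> exists S, [/\ P S, (S <= T)%VS, S <> 0%VS &
    forall S', P S' -> (S' <= S)%VS -> S' = 0%VS \/ S' = S].
Proof.
have [d] := ubnP (\dim T); elim: d T => // d IH T dT PT T0.
have [[S' [PS' S'T S'0 neq]]|no] :=
    EM (exists S', [/\ P S', (S' <= T)%VS, S' <> 0%VS & S' <> T]).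
  have dS' : (\dim S' < d)%N.
    apply: leq_trans (_ : \dim T <= d)%N => //.
    rewrite ltn_neqAle dimvS // andbT; apply/eqP => dim_eq.
    by apply: neq; apply/eqP; rewrite eqEdim S'T dim_eq leqnn.
  have [S [PS SS' S0 Smin]] := IH S' dS' PS' S'0.
  by exists S; split=> //; apply: subv_trans SS' S'T.
exists T; split=> // S' PS' S'T.
have [->|S'0] := EM (S' = 0%VS); first by left.
right; have [//|neq] := EM (S' = T).
by case: no; exists S'.
Qed.

(** * Depth and the isomorphism *)

Section FWord.
Variables (F : fieldType) (n : nat) (V : vectType F) (f : 'I_n.-1 -> endo V).

Lemma foldr_fword p j x : (p + j <= n.-1)%N ->
  foldr (fun i y => f i y) x (take j (drop p (enum 'I_n.-1))) = fword (fam f) p j x.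
Proof.
elim: j p => [|j IH] p pj; first by rewrite take0.
have pm : (p < n.-1)%N by lia.
rewrite (drop_nth (Ordinal pm)) ?size_enum_ord //= IH ?addSnnS //.
have -> : nth (Ordinal pm) (enum 'I_n.-1) p = Ordinal pm by apply/val_inj; rewrite /= nth_enum_ord.
by have /= -> := famE f (Ordinal pm).
Qed.

End FWord.

Section Main.
Variables (R : realType) (n r : nat) (hr : (r <= n)%N) (M : MU_module R n).
Local Notation v := (vpar R).
Let v0 := vpar_neq0 R.
Let v1 := vpar_sq_sub1 R.
Let v2 := vpar_sq_add1 R.
Let h := MU_rel M.
Local Notation e := (MU_e M).
Local Notation f := (MU_f M).
Local Notation k := (MU_k M).
Local Notation l := (MU_l M).
Local Notation ws := (weight_space k).
Local Notation ellV := (ellM v e f k l).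
Local Notation inV := (inM v e f k l).

Let U := Urel_of v0 h.
Let Lr := Lrel_of h.

Lemma depth_ellP t x : (t <= n)%N -> (0 < n)%N ->
  (forall j, (j < t)%N -> l (f_word j x) = 0) <->
  (forall i, (i < t)%N -> ellV i x = 0).
Proof.
move=> tn n0; have tm : (0 + t <= n.-1.+1)%N by lia.
have [D1 D2] := depthP v0 v1 v2 U Lr x tm.
have fE j : (j < t)%N -> l (f_word j x) = ell v (fam e) (fam f) (fam k) l 0 (fword (fam f) 0 j x).
  move=> jt; have jm : (0 + j <= n.-1)%N by lia.
  by rewrite -(foldr_fword f x jm) drop0.
split=> H.
  by apply: D1 => j jt; rewrite -fE // H.
by move=> j jt; rewrite fE // D2.
Qed.

Lemma ellM_weight mu i x : (i <= n.-1)%N -> x \in ws mu -> ellV i x \in ws mu.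
Proof.
move=> im /weight_spaceP xk; apply/weight_spaceP => j.
have := k_ell v0 v1 v2 U Lr im (ltn_ord j) x; rewrite famE => ->.
by rewrite xk endoZ.
Qed.

Lemma betM_weight mu (j : 'I_n.-1) x : x \in ws mu ->
  betM v e f k l j x \in ws (wt_shift mu 1 j).
Proof.
move=> xmu; have jm : (j <= n.-1)%N := ltnW (ltn_ord j).
rewrite /betM betE famE; apply: memvB.
  by apply: (weight_e h); apply: ellM_weight.
apply: ellM_weight; first exact: jm.
by apply: (weight_e h).
Qed.

(* A vector as in the definition of depth is first projected to a simultaneous
   eigenvector of the l_i and then moved with the b_i. *)
Lemma top_vector x0 mu0 : (0 < n)%N -> x0 != 0 -> x0 \in ws mu0 -> has_depth x0 r ->
  exists s y mu, [/\ (r <= s <= n)%N, y != 0, y \in ws mu & inV (top n s) y].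
Proof.
move=> n0 x00 xmu [_ xd _].
have inle (i : 'I_n) : (i <= n.-1)%N by have := ltn_ord i; lia.
pose P y := y \in ws mu0 /\ forall i : 'I_n, (i < r)%N -> ellV i y = 0.
have Pell (i : 'I_n) y : P y -> P (ellV i y).
  case=> ymu y0; split=> [|i' i'r]; first exact: ellM_weight.
  by rewrite (ellM_comm v0 v1 v2 h) y0 // endo0.
have Px : P x0.
  by split=> [|i ir]; [exact: xmu|have [D _] := depth_ellP x0 hr n0; exact: (D xd)].
have [z [I [[zmu z_r] z0 Iz]]] := inM_component v0 v1 v2 h Pell Px x00.
(* Each [i < r] lies in [I]: otherwise [z] would be both killed and fixed by [ellV i]. *)
have rI : (r <= #|I|)%N.
  rewrite -{1}(top_card hr); apply/subset_leq_card/subsetP => i; rewrite inE => ir.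
  by apply: contraT => iI; have := Iz i; rewrite z_r // (negPf iI) => /esym/eqP; rewrite (negPf z0).
pose Q I := exists y mu, [/\ y != 0, y \in ws mu & inV I y].
have : Q (top n #|I|).
  apply: set_connect; last by exists z, mu0; split; [exact: z0|exact: zmu|exact: Iz].
  move=> j J hJ lJ [y [mu [y0 ymu Jy]]].
  have [Jb gb] := betM_down v0 v1 v2 h Jy hJ lJ.
  exists (betM v e f k l j y), (wt_shift mu 1 j); split; [|exact: betM_weight|exact: Jb].
  by apply: contraNneq y0 => b0; rewrite -gb b0 endo0.
case=> y [mu [y0 ymu Iy]]; exists #|I|, y, mu; split; [|exact: y0|exact: ymu|exact: Iy].
by rewrite rI -[X in (_ <= X)%N](card_ord n) max_card.
Qed.

Lemma top_depth s y : (0 < n)%N -> (s <= n)%N -> y != 0 -> inV (top n s) y -> has_depth y s.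
Proof.
move=> n0 sn y0 Iy; have ell0 i : (i < s)%N -> ellV i y = 0.
  move=> is_; have := Iy (Ordinal (leq_trans is_ sn)); rewrite inE /= is_.
  by [].
split=> //; first by have [_ D] := depth_ellP y sn n0; apply: D.
move=> lt_sn l0; have [D _] := depth_ellP y lt_sn n0.
have := Iy (Ordinal lt_sn); rewrite inE /= ltnn => ys.
case/eqP: y0; rewrite -ys; apply: D => // j; rewrite ltnS leq_eqVlt => /predU1P[->//|js].
by have [_ D'] := depth_ellP y sn n0; apply: D'.
Qed.

End Main.

(** * The factor L and the evaluation isomorphism *)

Section MultiplicityModule.
Variables (R : realType) (n r : nat) (hr : (r <= n)%N) (M : MU_module R n).
Local Notation v := (vpar R).
Let v0 := vpar_neq0 R.
Let v1 := vpar_sq_sub1 R.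
Let v2 := vpar_sq_add1 R.
Let h := MU_rel M.
Local Notation e := (MU_e M).
Local Notation f := (MU_f M).
Local Notation k := (MU_k M).
Local Notation ki := (MU_ki M).
Local Notation l := (MU_l M).
Local Notation W := (wedge (ratfun R) n r).
Local Notation H := 'Hom(W, M).

Definition mult_stab (S : {vspace H}) : Prop :=
  (S <= mult_space v r e f k l)%VS /\ forall j p, p \in S ->
  [/\ mult_e v r e j p \in S, mult_f v r f ki j p \in S,
      mult_k v r k j p \in S & mult_ki v r ki j p \in S].

Variable S : {vspace H}.
Hypothesis Sst : mult_stab S.
Let SX := Sst.1.
Let St := Sst.2.

Definition mult_module : U_module R n :=
  UModule (sub_U_relations v0 v1 v2 hr h SX St).
Local Notation L := mult_module.

Lemma mult_module_simple : S <> 0%VS ->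
    (forall S', mult_stab S' -> (S' <= S)%VS -> S' = 0%VS \/ S' = S) ->
  U_simple L.
Proof.
move=> S0 Smin; split.
  move=> L0; apply: S0; apply/eqP; rewrite -subv0; apply/subvP => p pS.
  have p0 : (vsproj S p : L) = 0 by apply/eqP; rewrite -memv0 -L0 memvf.
  by rewrite -(vsprojK pS) [vsproj S p]p0 linear0 mem0v.
move=> T Tst; pose T' : {vspace H} := (linfun (@vsval _ _ S) @: T)%VS.
have T'P p : reflect (exists2 x, x \in T & p = vsval x) (p \in T').
  apply: (iffP memv_imgP) => -[x xT ->]; exists x; rewrite ?lfunE //.
have T'S : (T' <= S)%VS by apply/subvP => _ /T'P[x _ ->]; exact: subvsP.
have T'st : mult_stab T'.
  split; first exact: subv_trans T'S SX.
  move=> j _ /T'P[x xT ->]; have [Te Tf Tk Tki] := Tst j.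
  split; apply/T'P.
  - exists (U_e L j x); first by apply: (subvP Te); exact: memv_img.
    by rewrite -(sub_eE St).
  - exists (U_f L j x); first by apply: (subvP Tf); exact: memv_img.
    by rewrite -(sub_fE St).
  - exists (U_k L j x); first by apply: (subvP Tk); exact: memv_img.
    by rewrite -(sub_kE St).
  - exists (U_ki L j x); first by apply: (subvP Tki); exact: memv_img.
    by rewrite -(sub_kiE St).
have [T0|TS] := Smin T' T'st T'S; [left|right].
  apply/eqP; rewrite -subv0; apply/subvP => x xT.
  have : vsval x \in T' by apply/T'P; exists x.
  rewrite T0 !memv0 => /eqP x0; apply/eqP/val_inj; rewrite [RHS]linear0.
  exact: x0.
apply/eqP; rewrite eqEsubv subvf; apply/subvP => x _.
have : vsval x \in T' by rewrite TS; exact: subvsP.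
by case/T'P => y yT /val_inj->.
Qed.

Lemma mult_module_type1 : MU_type1 M -> U_type1 L.
Proof.
move=> t1; pose q (x : L) : M := ev (top n r) x.
have ql : linear q by move=> c x y; rewrite /q evD evZ.
pose qm := GRing.isLinear.Build _ L M _ _ ql.
pose E : 'Hom(L, M) := linfun (HB.pack q qm : {linear L -> M}).
have EE x : E x = ev (top n r) x by rewrite lfunE.
(* Evaluation at the highest basis vector sends a vector x to the image of x (x) u_top, so the
   weights of [L] are weights of [M] minus that of u_top. *)
apply: (@type1_embedding _ _ _ _ _ k E [ffun i => - (i \in top n r)%:Z]) => //.
  by move=> x y; rewrite !EE; apply: (ev_inj SX); exact: top_card.
move=> j x; rewrite !EE (ev_k St) wedge_wtE !ffunE invr_expz.
by congr (v ^ _ *: _); ring.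
Qed.

Lemma mult_module_is_L : U_simple L -> U_type1 L -> exists la, dominant la /\ is_L la L.
Proof.
move=> Ls Lt; have [L0 Lmin] := Ls.
have [x x0] : exists x : L, x != 0.
  apply: contrapT => no; apply: L0; apply/eqP; rewrite -subv0; apply/subvP => x _.
  by rewrite memv0; apply/eqP; apply: contrapT => x0; apply: no; exists x; apply/eqP.
have [mu [y [y0 ymu]]] := type1_weight_vector Lt x0.
have [la [z [z0 zla ez]]] := highest_weight_exists (U_rel L) Lt y0 ymu.
exists la; split; first exact: (highest_weight_dominant (U_rel L) Lt z0 zla ez).
split; [exact: Ls|exact: Lt|]; exists z; split.
- exact: z0.
- exact: ez.
- by apply/weight_spaceP.
- move=> T Tst zT; have [T0|//] := Lmin T Tst.
  by rewrite T0 memv0 (negPf z0) in zT.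
Qed.

Lemma mult_module_iso : (0 < n)%N -> MU_simple M -> S <> 0%VS ->
  MU_iso M (tens_module L (wedge_module R n r)).
Proof.
move=> n0 [_ Msimple] S0.
have [g gE] := mult_eval_exists S.
have ginj := mult_eval_inj v0 SX gE.
have ge := mult_eval_e v0 v1 St gE.
have gf := mult_eval_f St gE.
have gk := mult_eval_k v0 v1 St gE.
have gki := mult_eval_ki v0 v1 St gE.
have gl := mult_eval_l SX gE n0.
have Ist : MU_stable (limg g).
  have stab (a : endo (tens L W)) (b : endo M) : (forall t, g (a t) = b (g t)) ->
      (b @: limg g <= limg g)%VS.
    move=> ab; apply/subvP => _ /memv_imgP[_ /memv_imgP[t _ ->] ->].
    by rewrite -ab memv_img ?memvf.
  split=> [j|]; last exact: stab gl.
  by split; [exact: stab (ge j)|exact: stab (gf j)|exact: stab (gk j)|exact: stab (gki j)].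
(* A zero image would mean that every map in [S] vanishes on all of W_r. *)
have gsurj : limg g = {:M}%VS.
  have [g0|//] := Msimple _ Ist; case: S0; apply/eqP; rewrite -subv0.
  apply/subvP => p pS; rewrite memv0; apply/eqP/lfunP => w.
  have : g (pure (vsproj S p) w) \in limg g by rewrite memv_img ?memvf.
  by rewrite g0 memv0 gE vsprojK // zero_lfunE => /eqP.
have kg : lker g == 0%VS by apply/lker0P.
have gK : cancel g (g^-1)%VF by exact: lker0_lfunK.
have Kg x : g ((g^-1)%VF x) = x by apply: limg_lfunVK; rewrite gsurj memvf.
have inv (a : endo (tens L W)) (b : endo M) : (forall t, g (a t) = b (g t)) ->
    forall x, (g^-1)%VF (b x) = a ((g^-1)%VF x).
  by move=> ab x; apply: ginj; rewrite ab !Kg.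
exists (g^-1)%VF; split; first by exists g.
move=> x; split=> [j|]; last exact: inv gl x.
by split; [exact: inv (ge j) x|exact: inv (gf j) x|exact: inv (gk j) x|exact: inv (gki j) x].
Qed.

End MultiplicityModule.

Theorem theorem5p1 (R : realType) (n r : nat) (hn : (2 <= n)%N)
    (hr : (r <= n)%N) (M : MU_module R n) (hsimple : MU_simple M)
    (htype1 : MU_type1 M) (hdepth : MU_depth M r) :
  exists lambda : weight n, dominant lambda /\
    exists L : U_module R n, is_L lambda L /\
      MU_iso M (tens_module L (wedge_module R n r)).
Proof.
have n0 : (0 < n)%N by exact: ltnW.
have v0 := vpar_neq0 R; have v1 := vpar_sq_sub1 R; have v2 := vpar_sq_add1 R.
have [[x [x0 [mu xmu] xr]] dmax] := hdepth.
have [s [y [nu [/andP[rs sn] y0 ynu Iy]]]] := top_vector hr n0 x0 xmu xr.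
have yw : weight_vector y by exists nu.
have yd : has_depth y s := top_depth hr n0 sn y0 Iy.
(* Projecting and moving with the b_i can only have increased the depth, from [r] to [s]; maximality
   of [r] excludes a strict increase. *)
have sr : s = r by apply/eqP; rewrite eqn_leq rs (dmax y s y0 yw yd).
rewrite {}sr in Iy.
have [p pX py] := mult_extend v0 v1 v2 hr (MU_rel M) Iy.
pose X := mult_space (vpar R) r (MU_e M) (MU_f M) (MU_k M) (MU_l M).
have Xst : mult_stab X.
  split; first exact: subvv.
  by move=> j q; apply: (mult_stable v0 v1 v2 hr (MU_rel M)).
have X0 : X <> 0%VS.
  move=> X0; rewrite -/X X0 memv0 in pX; case/eqP: y0.
  by rewrite -py (eqP pX) zero_lfunE.
have [S [Sst _ S0 Smin]] := minimal_stable Xst X0.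
have Lsimple := mult_module_simple hr Sst S0 Smin.
have [la [dla Lla]] := mult_module_is_L Lsimple (mult_module_type1 hr Sst htype1).
exists la; split; first exact: dla.
exists (mult_module hr Sst); split; first exact: Lla.
exact: mult_module_iso.
Qed.
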